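(* Let $m\in\mathbb{N}$ with $m>1$, and let $a_1,\dots,a_m$ be arbitrary real numbers, different from each other, which satisfy $\sum_{k=0}^m b_{2k}x^{2k}=\prod_{i=1}^m(x^2-a_i^2)$. Let $n-2=2\nu+1$ with $\nu\in\mathbb{N}_0=\{0,1,2,\dots\}$, let $\Delta_n$ be the $n$-dimensional Laplacian in $x\in\mathbb{R}^n$, and define $$P(\partial_x,\partial_t)=\sum_{k=0}^m b_{2k}\,\Delta_n^{m-k}\frac{\partial^{2k}}{\partial t^{2k}},\qquad x\in\mathbb{R}^n,\ t\in\mathbb{R}^1 .$$ Then for all $f(x,t)\in C^\infty(\mathbb{R}^n_x\times\mathbb{R}^1_t)$ and all $\varphi_r(x)\in C^\infty(\mathbb{R}^n)$, $r=0,1,\dots,2m-1$, the Cauchy problem $$P(\partial_x,\partial_t)u=f(x,t)\quad (x\in\mathbb{R}^n,\ t\in\mathbb{R}^1),\qquad \left.\frac{\partial^r u}{\partial t^r}\right|_{t=0}=\varphi_r(x)\quad (r=0,1,\dots,2m-1)$$ is solved by $$u(x,t)=\int_0^t d\tau\int_0^{t-\tau}d\tau'\,\frac{(t-\tau-\tau')^{2m-3}}{(2m-3)!}\sum_{j=1}^m\frac{a_j^{2m-2}}{\prod_{1\le i\le m,\, i\ne j}(a_j^2-a_i^2)}\left[\tau'\,\big(I^\nu\, \mathcal{M}_j[f(\cdot,\tau)](x,\cdot)\big)(\tau')+\sum_{l=0}^{\nu-1}\frac{a_j^{2l}\tau'^{\,2l+1}}{(2l+1)!}\Delta_n^l f(x,\tau)\right]$$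 $$\qquad+\sum_{k=1}^m b_{2k}\,\Delta_n^{m-k}\sum_{r=0}^{2k-1}\frac{\partial^{2k-1-r}}{\partial t^{2k-1-r}}\int_0^t d\tau\,\frac{(t-\tau)^{2m-3}}{(2m-3)!}\sum_{j=1}^m\frac{a_j^{2m-2}}{\prod_{1\le i\le m,\, i\ne j}(a_j^2-a_i^2)}\left[\tau\,\big(I^\nu\, \mathcal{M}_j[\varphi_r](x,\cdot)\big)(\tau)+\sum_{l=0}^{\nu-1}\frac{a_j^{2l}\tau^{2l+1}}{(2l+1)!}\Delta_n^l\varphi_r(x)\right],$$ where, for $g\in C^\infty(\mathbb{R}^n)$, $$\mathcal{M}_j[g](x,s)=(a_j^2\Delta_n)^\nu\left(\frac{1}{S_{n,j}(s)}\int_{|\xi-x|=|a_js|}g(\xi)\,dS(\xi)\right),\qquad S_{n,j}(s)=2(2\pi)^{\nu+1}(a_js)^{n-1},$$ and $(Ih)(\sigma)=\int_0^\sigma h(s)\,s\,ds$.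
   Context: $n=2\nu+3$ is odd, $n\ge3$. $\Delta_n=\sum_{i=1}^n\partial^2/\partial x_i^2$ acts in the variable $x$; $\Delta_n^0$ is the identity. The integral over $|\xi-x|=|a_js|$ is the surface integral, with surface element $dS(\xi)$, over the hypersphere $(\xi_1-x_1)^2+\cdots+(\xi_n-x_n)^2=(a_js)^2$ in $\mathbb{R}^n$. Where $a_js=0$, the quotient $\frac{1}{S_{n,j}(s)}\int_{|\xi-x|=|a_js|}g\,dS$ is understood as its limiting value as the radius tends to $0$, namely $g(x)/(1\cdot3\cdot5\cdots(2\nu+1))$. $I^\nu$ is the $\nu$-fold iterate of the operator $I$, acting on functions of the variable $s$ (with $x$, and $\tau$ in the first term, as fixed parameters); $I^0$ is the identity. It expresses a $\nu$-fold iterated integral $\int_0^{\sigma}\sigma\,d\sigma\cdots\int_0^{\sigma}(\cdot)\,\sigma\,d\sigma$ with $\nu$ integrations in total. Empty sums (as when $\nu=0$) are zero.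
   Formalization: The squares a_1^2,…,a_m^2, rather than only the numbers a_1,…,a_m, are assumed pairwise different; if a_i = -a_j for some i ≠ j, the formula divides by a_j^2 - a_i^2 = 0 and is undefined. *)

(* Defs.v *)
From HB Require Import structures.
From mathcomp Require Import all_boot all_order all_algebra.
From mathcomp Require Import all_classical all_reals all_analysis.

Set Implicit Arguments.
Unset Strict Implicit.
Unset Printing Implicit Defensive.

Import Order.TTheory GRing.Theory Num.Theory.
Import numFieldNormedType.Exports.

Local Open Scope classical_set_scope.
Local Open Scope ring_scope.

(* V is meant to be finite-dimensional ('rV_n or 'rV_n * R).  There, existence
   and continuity of all iterated directional derivatives of order at most k
   is the usual class C^k. *)
Fixpoint Ck (R : realType) (V : normedModType R) (k : nat) (f : V -> R) : Prop :=
  if k is k'.+1 then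
    continuous f /\
    (forall v : V, (forall x : V, derivable f x v) /\ Ck k' ('D_v f))
  else continuous f.

Definition Csmooth (R : realType) (V : normedModType R) (f : V -> R) : Prop :=
  forall k : nat, Ck k f.

Definition laplacian (R : realType) (n : nat) (g : 'rV[R]_n -> R) :
    'rV[R]_n -> R :=
  fun x => \sum_(i < n) 'D_(delta_mx 0 i) ('D_(delta_mx 0 i) g) x.

(* P(d_x, d_t) = sum_k b_{2k} Delta^(m-k) d_t^(2k) *)
Definition Pop (R : realType) (n m : nat) (b : nat -> R)
    (u : 'rV[R]_n -> R -> R) (x : 'rV[R]_n) (t : R) : R :=
  \sum_(0 <= k < m.+1)
    b (2 * k)%N *
    iter (m - k) (@laplacian R n) (fun y => derive1n (2 * k) (u y) t) x.

(* Oriented integral: c may be smaller than a, since t ranges over all of R. *)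
Definition oint (R : realType) (a c : R) (h : R -> R) : R :=
  if a <= c then \int[lebesgue_measure]_(s in `[a, c]) h s
  else - \int[lebesgue_measure]_(s in `[c, a]) h s.

(* Iterated integral of F over D 0 x D 1 x ... x D (d - 1). *)
Fixpoint box_integral (R : realType) (d : nat) (D : nat -> set R) :
    ('rV[R]_d -> R) -> R :=
  match d return ('rV[R]_d -> R) -> R with
  | 0 => fun F => F 0
  | d'.+1 => fun F =>
      \int[lebesgue_measure]_(s in D 0%N)
        @box_integral R d' (fun k => D k.+1)
          (fun th => F (row_mx (s%:M : 'rV[R]_1) th))
  end.

(* Hyperspherical coordinates (n >= 2), with angles th_0, ..., th_{n-2}:
   the i-th coordinate is r sin th_0 ... sin th_{i-1} cos th_i for i < n - 1,
   the last one is r sin th_0 ... sin th_{n-2}. *)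
Definition sphere_param (R : realType) (n : nat) (r : R) (th : 'rV[R]_n.-1) :
    'rV[R]_n :=
  \row_(i < n) (r * \prod_(k < n.-1)
    (if (k < i)%N then sin (th 0 k)
     else if (k == i :> nat) then cos (th 0 k) else 1)).

Definition angle_range (R : realType) (n : nat) (k : nat) : set R :=
  `[0, if k.+1 == n.-1 then 2 * pi else pi]%classic.

(* Surface integral of g over the hypersphere |xi - x| = r (n >= 2, r >= 0);
   dS is the square root of the Gram determinant of the parametrization, whose
   partial derivatives are the rows of the jacobian matrix.  The
   parametrization is one-to-one off a null set of angles when r > 0. *)
Definition sphere_integral (R : realType) (n : nat) (x : 'rV[R]_n) (r : R)
    (g : 'rV[R]_n -> R) : R :=
  @box_integral R n.-1 (angle_range n) (fun th =>
    g (x + sphere_param r th) *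
    Num.sqrt (\det (jacobian (sphere_param r) th *m
                    (jacobian (sphere_param r) th)^T))).

(* 1/S_{n,j}(s) times the integral of g over |xi - x| = |a s|,
   S_{n,j}(s) = 2 (2 pi)^(nu+1) (a s)^(n-1), extended by its limit at a s = 0. *)
Definition sphere_quotient (R : realType) (n nu : nat) (a : R)
    (g : 'rV[R]_n -> R) (s : R) (x : 'rV[R]_n) : R :=
  if a * s == 0 then g x / \prod_(0 <= k < nu.+1) (2 * k + 1)%:R
  else (2 * (2 * pi) ^+ nu.+1 * (a * s) ^+ n.-1)^-1 *
       sphere_integral x `|a * s| g.

(* M_j[g](x, s) *)
Definition Mj (R : realType) (n nu : nat) (a : R) (g : 'rV[R]_n -> R)
    (x : 'rV[R]_n) (s : R) : R :=
  iter nu (fun (h : 'rV[R]_n -> R) y => a ^+ 2 * laplacian h y)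
    (sphere_quotient nu a g s) x.

Definition Iop (R : realType) (h : R -> R) : R -> R :=
  fun sigma => oint 0 sigma (fun s => h s * s).

(* tau (I^nu M_j[g](x, .))(tau)
     + sum_(l < nu) a^(2l) tau^(2l+1) / (2l+1)! Delta^l g(x) *)
Definition bracket (R : realType) (n nu : nat) (a : R) (g : 'rV[R]_n -> R)
    (x : 'rV[R]_n) (tau : R) : R :=
  tau * iter nu (@Iop R) (Mj nu a g x) tau +
  \sum_(0 <= l < nu)
    (a ^+ (2 * l) * tau ^+ (2 * l).+1 / ((2 * l).+1)`!%:R) *
    iter l (@laplacian R n) g x.

Definition weighted_sum (R : realType) (n nu m : nat) (a : 'I_m -> R)
    (g : 'rV[R]_n -> R) (x : 'rV[R]_n) (tau : R) : R :=
  \sum_(j < m)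
    (a j ^+ (2 * m - 2) / \prod_(i < m | i != j) (a j ^+ 2 - a i ^+ 2)) *
    bracket nu (a j) g x tau.

Definition inhomogeneous_part (R : realType) (n nu m : nat) (a : 'I_m -> R)
    (f : 'rV[R]_n -> R -> R) (x : 'rV[R]_n) (t : R) : R :=
  oint 0 t (fun tau => oint 0 (t - tau) (fun tau' =>
    (t - tau - tau') ^+ (2 * m - 3) / (2 * m - 3)`!%:R *
    weighted_sum nu a (fun y => f y tau) x tau')).

Definition data_part (R : realType) (n nu m : nat) (a : 'I_m -> R)
    (b : nat -> R) (phi : nat -> 'rV[R]_n -> R) (x : 'rV[R]_n) (t : R) : R :=
  \sum_(1 <= k < m.+1) b (2 * k)%N *
    iter (m - k) (@laplacian R n) (fun y =>
      \sum_(0 <= r < 2 * k)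
        derive1n (2 * k - 1 - r) (fun t' =>
          oint 0 t' (fun tau =>
            (t' - tau) ^+ (2 * m - 3) / (2 * m - 3)`!%:R *
            weighted_sum nu a (phi r) y tau)) t) x.

Definition cauchy_formula (R : realType) (n nu m : nat) (a : 'I_m -> R)
    (b : nat -> R) (f : 'rV[R]_n -> R -> R) (phi : nat -> 'rV[R]_n -> R)
    (x : 'rV[R]_n) (t : R) : R :=
  inhomogeneous_part nu a f x t + data_part nu a b phi x t.

(* The C^(2m) clause guarantees that every derivative in the equation and in
   the initial conditions exists, so that the library's total derivative
   operators take their genuine values. *)
Definition solves_cauchy (R : realType) (n m : nat) (b : nat -> R)
    (f : 'rV[R]_n -> R -> R) (phi : nat -> 'rV[R]_n -> R)
    (u : 'rV[R]_n -> R -> R) : Prop :=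
  [/\ Ck (2 * m) (fun z : 'rV[R]_n * R => u z.1 z.2),
      forall (x : 'rV[R]_n) (t : R), Pop m b u x t = f x t &
      forall (r : nat) (x : 'rV[R]_n), (r < 2 * m)%N ->
        derive1n r (u x) 0 = phi r x].

(* Main.v *)
From HB Require Import structures.
Require Import Defs.
From mathcomp Require Import all_boot all_order all_algebra.
From mathcomp Require Import all_classical all_reals all_analysis.
From mathcomp Require Import ring lra zify.
Import numFieldNormedType.Exports.
Import Order.TTheory GRing.Theory Num.Theory.
Set Implicit Arguments.
Unset Strict Implicit.
Unset Printing Implicit Defensive.
Local Open Scope classical_set_scope.
Local Open Scope ring_scope.

(** Since sum_k b_(2k) X^(2k) = prod_i (X^2 - a_i^2), the operator is the product
    P = prod_i (d_t^2 - a_i^2 Delta) of wave operators, and the formula of the theorem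
    superposes solutions of the single wave equations.

    Spherical means.  Let A(v, r) be the integral of g(v + r omega) over the unit
    sphere of dimension d+1.  Written in hyperspherical coordinates it is a nested
    integral over the angles (box_integral_sphere; the Gram determinant of the
    parametrization is computed in gram_det).  By induction on the number of angles it
    satisfies the Euler-Poisson-Darboux equation r A'' + (d+1) A' = r Delta A
    (sphere_int_epd): in plane polar coordinates the difference of the two sides is the
    integral of a total derivative in the angle (polar_epd).  It is also even in r and
    takes the value area * g(v) at r = 0; this is why the quotient of the statement, which
    only sees the radius |a s| and is extended by its limit at 0, is smooth in s.

    Descent to the wave equation.  If h solves s h'' + (2p+4) h' = s a^2 Delta h, then
    k = s h' + (2p+3) h solves the same equation with p+1 replaced by p, and
    k' = s a^2 Delta h.  So the operator I, applied to a^2 Delta h, recovers k up to its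
    initial value (Iop_descend).  Iterating nu times from the spherical mean turns
    I^nu M_j into a solution with parameter 0 minus an even Taylor polynomial in s,
    exactly the one that the second term of the bracket restores.  Times s, this
    is the solution B_j of d_t^2 B = a_j^2 Delta B with B = 0, d_t B = g at t = 0
    (bracket_wave).

    Fundamental solution.  Let E be the (2m-2)-fold time integral of
    W = sum_j c_j B_j, c_j = a_j^(2m-2) / prod_(i != j) (a_j^2 - a_i^2).  Up to Taylor
    polynomials, (a_j^2 Delta)^i undoes a 2i-fold time integral of B_j
    (iter_Lap_iter_int), and the Taylor polynomials cancel in the sum over j by the
    Lagrange interpolation identities (lagrange_sum).  Hence P E is Delta applied to
    sum_j (sum_k b_(2k) a_j^(2k)) B_j / prod_(i != j) (a_j^2 - a_i^2), which is zero
    because a_j is a root (fundamental_eq).  The first 2m-1 time derivatives of E at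
    t = 0 are 0, and the next one is g.

    Conclusion.  The first term of the formula is the Duhamel integral of these
    fundamental solutions, with g = f(., tau).  In the second one, with E_r built from
    phi_r, the q-th time derivative at t = 0 reproduces phi_q: the terms r > q and the
    terms r = q, k < m involve time derivatives of E_r of too low an order, the term
    r = q, k = m gives phi_q, and the terms with r < q add up to d_t^(q-1-r) P E_r = 0
    (data_init).

    The underlying calculus is that of the classes C^k of iterated directional
    derivatives: they are stable under sums, products, composition and parametric
    integrals, and derivatives commute.  The Fundamental Theorem of Calculus is used in
    one form throughout (oint_primitive): an oriented integral is the difference of the
    values of one primitive. *)

(** * Oriented integrals of continuous functions *)

Section primitive.
Variable R : realType.
Local Notation mu := (@lebesgue_measure R).
Implicit Types (h H : R -> R).

Lemma continuous_integrable h (a c : R) :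
  continuous h -> mu.-integrable `[a, c] (EFin \o h).
Proof.
move=> ch; apply: continuous_compact_integrable; first exact: segment_compact.
exact: continuous_subspaceT.
Qed.

Lemma oint_split h (N a c : R) : continuous h -> N <= a -> N <= c ->
  oint a c h = (\int[mu]_(s in `[N, c]) h s) - \int[mu]_(s in `[N, a]) h s.
Proof.
move=> ch Na Nc; rewrite /oint.
have key x y : N <= x -> x <= y ->
    \int[mu]_(s in `[x, y]) h s =
    (\int[mu]_(s in `[N, y]) h s) - \int[mu]_(s in `[N, x]) h s.
  move=> Nx xy; rewrite Rintegral_itvB ?bnd_simp//; last exact: continuous_integrable.
  rewrite Rintegral_itv_obnd_cbnd//.
  by apply: integrableS (continuous_integrable x y ch) => //; apply: subset_itv_oc_cc.
case: ifPn => ac; first exact: key.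
by rewrite key// ?opprB// ltW// ltNge.
Qed.

(** One primitive serves all endpoints, in either order: linearity, changes of variables
    and differentiation in the endpoints then reduce to differentiating a primitive. *)
Lemma oint_primitive h : continuous h ->
  exists2 H : R -> R, (forall x : R, is_derive x (1:R) H (h x)) & forall a c, oint a c h = H c - H a.
Proof.
move=> ch.
(* All integrals are compared with integrals from a common left endpoint N. *)
exists (fun x => oint 0 x h); last first.
  move=> a c; pose N := Num.min 0 (Num.min a c).
  rewrite (@oint_split _ N 0 c)// ?(@oint_split _ N 0 a)// ?(@oint_split _ N a c)//;
    rewrite ?/N ?ge_min ?lexx ?orbT//.
  by rewrite opprB addrA subrK.
move=> x; pose N := Num.min 0 x - 1.
have Nx : N < x by rewrite /N; rewrite ltrBlDr gt_min ltrDl ltr01 orbT.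
have N0 : N <= 0 by rewrite /N lerBlDr add0r ge_min ler01.
have x1 : x < x + 1 by rewrite ltrDl.
have [dG G'] := @continuous_FTC1_closed R h N x (x + 1) x1 (continuous_integrable _ _ ch) Nx (ch x).
pose G y : R := \int[mu]_(t in `[N, y]) h t.
apply: (@near_eq_is_derive _ _ _ (fun y => G y - G 0)).
  near=> y; rewrite (@oint_split _ N)//.
  by near: y; exact: lt_le_nbhsr.
have cG : derivable (cst (G 0)) x 1 by exact: derivable_cst.
apply: DeriveDef; first exact: (derivableB dG cG).
rewrite (_ : (fun y => G y - G 0) = G - cst (G 0))//.
by rewrite (deriveB dG cG) derive_cst subr0 -derive1E.
Unshelve. all: by end_near. Qed.

End primitive.

Section oint_calculus.
Variable R : realType.
Implicit Types (h g H : R -> R).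

Lemma is_derive_continuous H h : (forall x : R, is_derive x (1:R) H (h x)) -> continuous H.
Proof.
move=> dH x; apply: differentiable_continuous; apply/derivable1_diffP.
by have [] := dH x.
Qed.

Lemma is_derive_MVT H h (a c : R) : a <= c ->
  (forall x : R, is_derive x (1:R) H (h x)) ->
  exists2 xi, xi \in `[a, c]%R & H c - H a = h xi * (c - a).
Proof.
move=> ac dH; apply: MVT_segment => //.
by apply: continuous_subspaceT; apply: is_derive_continuous dH.
Qed.

Lemma is_derive0_cst H : (forall x : R, is_derive x (1:R) H 0) -> forall x y, H x = H y.
Proof.
move=> dH x y; wlog xy : x y / x <= y.
  by move=> W; case: (leP x y) => [/W//|/ltW/W].
have [z _] := is_derive_MVT xy dH.
by rewrite mul0r => /eqP; rewrite subr_eq0 => /eqP.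
Qed.

(** Two primitives of h differ by a constant, so any explicit one computes the integral. *)
Lemma oint_FTC2 h H (a c : R) : continuous h ->
  (forall x : R, is_derive x (1:R) H (h x)) -> oint a c h = H c - H a.
Proof.
move=> ch dH; have [G dG ->] := oint_primitive ch.
have : (G - H) c = (G - H) a.
  apply: is_derive0_cst => x; have := is_deriveB (dG x) (dH x).
  by rewrite subrr.
rewrite -![(G - H) _]/(G _ - H _) => e; apply/eqP; rewrite subr_eq addrAC.
by rewrite -subr_eq opprK addrC -subr_eq addrAC e; rewrite subrK.
Qed.

Lemma oint_eq h g (a c : R) : h =1 g -> oint a c h = oint a c g.
Proof. by move=> /funext ->. Qed.

Lemma oint_le h (a c : R) : a <= c ->
  oint a c h = \int[lebesgue_measure]_(s in `[a, c]) h s.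
Proof. by rewrite /oint => ->. Qed.

Lemma ointaa h (a : R) : continuous h -> oint a a h = 0.
Proof. by move=> ch; have [H _ ->] := oint_primitive ch; rewrite subrr. Qed.

Lemma ointN h (a c : R) : continuous h -> oint a c h = - oint c a h.
Proof. by move=> ch; have [H _ e] := oint_primitive ch; rewrite !e opprB. Qed.

Lemma ointD h g (a c : R) : continuous h -> continuous g ->
  oint a c (fun s => h s + g s) = oint a c h + oint a c g.
Proof.
move=> ch cg; have [H dH ->] := oint_primitive ch.
have [G dG ->] := oint_primitive cg.
rewrite (@oint_FTC2 _ (H + G)); first by rewrite opprD addrACA.
by move=> x; apply: cvgD; [exact: ch|exact: cg].
Qed.

Lemma ointZ k h (a c : R) : continuous h ->
  oint a c (fun s => k * h s) = k * oint a c h.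
Proof.
move=> ch; have [H dH ->] := oint_primitive ch.
rewrite (@oint_FTC2 _ (k *: H)); first by rewrite mulrBr.
by move=> x; apply: cvgMr; exact: ch.
Qed.

Lemma ointB h g (a c : R) : continuous h -> continuous g ->
  oint a c (fun s => h s - g s) = oint a c h - oint a c g.
Proof.
move=> ch cg; rewrite -[- oint a c g]mulN1r -ointZ// -ointD//; last first.
  by move=> x; apply: cvgMr; exact: cg.
by apply: oint_eq => x; rewrite mulN1r.
Qed.

(** Mean value theorem for integrals; it replaces all estimates of integrals below. *)
Lemma oint_mean h (a c : R) : a <= c -> continuous h ->
  exists2 xi, xi \in `[a, c]%R & oint a c h = h xi * (c - a).
Proof. by move=> ac ch; have [H dH ->] := oint_primitive ch; apply: is_derive_MVT. Qed.

End oint_calculus.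

Section param.
Variables (R : realType) (V : normedModType R).

Lemma is_derive_line (f : V -> R) x v (t : R) : (forall x, derivable f x v) ->
  is_derive t (1:R) (fun t => f (x + t *: v)) ('D_v f (x + t *: v)).
Proof.
move=> df; have dl := df (x + t *: v).
have e : (fun h : R => h^-1 *: (((fun t => f (x + t *: v)) \o shift t) (h *: 1) - f (x + t *: v)))
  = (fun h => h^-1 *: ((f \o shift (x + t *: v)) (h *: v) - f (x + t *: v))).
  apply/funext => h /=; congr (_ *: (f _ - _)).
  by rewrite [h%:A]mulr1 scalerDl addrCA.
by apply: DeriveDef; rewrite /derivable /derive e.
Qed.

(** Mean value theorem along a line; the bound on s lets the increment t have any sign. *)
Lemma line_MVT (f : V -> R) x v (t : R) : (forall x, derivable f x v) ->
  exists2 s : R, `|s| <= `|t| & f (x + t *: v) - f x = t * 'D_v f (x + s *: v).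
Proof.
move=> df.
have dl s := is_derive_line x s df.
case: (leP 0 t) => t0.
  have [s] := is_derive_MVT t0 dl; rewrite in_itv/= => /andP[s0 st].
  rewrite scale0r addr0 subr0 mulrC => e.
  by exists s => //; rewrite !ger0_norm.
have [s] := is_derive_MVT (ltW t0) dl; rewrite in_itv/= => /andP[s0 st].
rewrite scale0r addr0 sub0r => e.
exists s; first by rewrite !ler0_norm ?lerN2// ltW.
by rewrite -opprB e mulrN opprK mulrC.
Qed.

(** Compactness of [a, c] makes the continuity of G in its first variable uniform in the
    second one. *)
Lemma tube (G : V * R -> R) (x : V) (a c e : R) : continuous G -> 0 < e ->
  \forall y \near x, forall s, s \in `[a, c] -> `|G (y, s) - G (x, s)| < e.
Proof.
move=> cG e0.
have /compact_near_coveringP/(_ _ (nbhs x) (fun y s => `|G (y, s) - G (x, s)| < e)) := @segment_compact R a c.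
have H : forall s, `[a, c]%classic s ->
   \forall s' \near s & y \near x, `|G (y, s') - G (x, s')| < e.
  move=> s _.
  have h0 : \forall z \near (x, s), `|G (x, s) - G z| < e / 2.
    by have /cvgrPdist_lt := cG (x, s); apply; rewrite divr_gt0.
  case: h0 => -[A B] /= [nA nB] AB.
  exists (B, A) => //= -[s' y]/= [Bs Ay].
  rewrite -(subrKA (G (x, s))) (le_lt_trans (ler_normD _ _))//.
  rewrite [e]splitr ltrD//; first by rewrite distrC; apply: (AB (y, s')).
  by apply: (AB (x, s')); split => //=; exact: nbhs_singleton nA.
move=> /(_ _ H); apply: filterS => y Hy s sac; exact: Hy.
Qed.

End param.

Section param_integral.
Variables (R : realType) (V : normedModType R).

Lemma pair_line (x v : V) (s h : R) :
  (x, s) + h *: (v, 0) = (x + h *: v, s) :> V * R.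
Proof. by rewrite -[LHS]/(x + h *: v, s + h * 0) mulr0 addr0. Qed.

Lemma slice_continuous (G : V * R -> R) x : continuous G -> continuous (fun s => G (x, s)).
Proof.
move=> cG s; apply: (@continuous_comp _ _ _ (fun s => (x, s)) G).
  exact: (cvg_pair (cvg_cst x) cvg_id).
exact: cG.
Qed.

Lemma oint_param_lt (G H : R -> R) (a c e : R) : a <= c ->
  0 < e -> continuous G -> continuous H ->
  (forall s, s \in `[a, c] -> `|G s - H s| < e / (1 + (c - a))) ->
  `|oint a c G - oint a c H| < e.
Proof.
move=> ac e0 cG cH GH; rewrite -ointB//.
have c0 : 0 <= c - a by rewrite subr_ge0.
have [s sac ->] := oint_mean ac (fun x => cvgB (cG x) (cH x)).
rewrite normrM (ger0_norm c0).
have p1 : 0 < 1 + (c - a) by rewrite ltr_wpDr.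
apply: (@le_lt_trans _ _ (e / (1 + (c - a)) * (c - a))).
  by rewrite ler_wpM2r// ltW// GH.
by rewrite -mulrA gtr_pMr// mulrC ltr_pdivrMr// mul1r ltrDr.
Qed.

Lemma oint_param_continuous (F : V * R -> R) (a c : R) : continuous F ->
  continuous (fun x => oint a c (fun s => F (x, s))).
Proof.
move=> cF.
wlog ac : a c / a <= c.
  move=> W; case: (leP a c) => [|/ltW]; first exact: W.
  move=> /W ca x; rewrite (_ : (fun x => _) = (fun x => - oint c a (fun s => F (x, s)))).
    by apply: cvgN; exact: ca.
  by apply/funext => y; rewrite ointN//; exact: slice_continuous.
move=> x; apply/cvgrPdist_lt => e e0.
have e1 : 0 < e / (1 + (c - a)) by rewrite divr_gt0// ltr_wpDr// subr_ge0.
have := tube x a c cF e1; apply: filterS => y Hy.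
rewrite distrC; apply: oint_param_lt => //; exact: slice_continuous.
Qed.

(** The difference quotient of F along v is a value of its derivative nearby, by the mean
    value theorem, so the tube lemma applied to this derivative controls the error. *)
Lemma oint_param_derive (F : V * R -> R) (a c : R) (v : V) : continuous F ->
  (forall z, derivable F z (v, 0)) -> continuous ('D_(v, 0) F) ->
  forall x, is_derive x v (fun x => oint a c (fun s => F (x, s)))
     (oint a c (fun s => 'D_(v, 0) F (x, s))).
Proof.
move=> cF dF cdF x.
have cs : continuous (fun s => 'D_(v, 0) F (x, s)).
  have := @slice_continuous ('D_(v, 0) F) x cdF; exact.
wlog ac : a c / a <= c.
  move=> W; case: (leP a c) => [|/ltW]; first exact: W.
  move=> /W ca; rewrite (_ : (fun x => _) = (- (fun x => oint c a (fun s => F (x, s))))).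
    by rewrite (ointN _ _ cs); exact: is_deriveN.
  by apply/funext => y; rewrite ointN//; exact: slice_continuous.
pose q h := h^-1 *: (((fun x => oint a c (fun s => F (x, s))) \o shift x) (h *: v)
    - oint a c (fun s => F (x, s))).
suff key : q h @[h --> 0^'] --> oint a c (fun s => 'D_(v, 0) F (x, s)).
  by apply: DeriveDef; [apply/cvg_ex; eexists; exact: key|exact: (cvg_lim (@Rhausdorff R) key)].
apply/cvgrPdist_lt => e e0.
have e1 : 0 < e / (1 + (c - a)) by rewrite divr_gt0// ltr_wpDr// subr_ge0.
have /nbhs_ballP[d /= d0 ball_d] := tube x a c cdF e1.
pose r := d / (1 + `|v|).
have p1 : 0 < 1 + `|v| by rewrite ltr_wpDr.
have r0 : 0 < r by rewrite divr_gt0.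
exists r => //= h; rewrite /ball_/= sub0r normrN => hr h0.
have -> : q h = oint a c (fun s => h^-1 * (F (h *: v + x, s) - F (x, s))).
  rewrite ointZ ?ointB//; try exact: slice_continuous.
  by move=> s; apply: cvgB; exact: slice_continuous.
rewrite distrC; apply: oint_param_lt => //.
- move=> s; apply: cvgMr; apply: cvgB; exact: slice_continuous.
move=> s sac.
have [t th E] := @line_MVT R (V * R)%type F (x, s) (v, 0) h dF.
have eq1 : h^-1 * (F (h *: v + x, s) - F (x, s)) = 'D_(v, 0) F (x + t *: v, s).
  have := E.
  rewrite !pair_line [_ + x]addrC.
  by move=> ->; rewrite mulKf.
rewrite eq1; apply: ball_d => //.
rewrite -ball_normE/= opprD addNKr normrN normrZ.
apply: (@le_lt_trans _ _ (`|h| * `|v|)); first by rewrite ler_wpM2r.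
apply: (@le_lt_trans _ _ (`|h| * (1 + `|v|))).
  by rewrite ler_wpM2l// lerDr.
by rewrite -ltr_pdivlMr.
Qed.

End param_integral.

(** * The classes C^k *)

Section Ck_closure.
Variables (R : realType) (V : normedModType R).
Implicit Types (f g : V -> R) (k : nat).

Lemma Ck_continuous k f : Ck k f -> continuous f.
Proof. by case: k => [|k] // []. Qed.

Lemma Ck_derivable k f : Ck k.+1 f -> forall x v, derivable f x v.
Proof. by move=> [_ H] x v; have [+ _] := H v; apply. Qed.

Lemma Ck_derive k f v : Ck k.+1 f -> Ck k ('D_v f).
Proof. by move=> [_ /(_ v)[]]. Qed.

Lemma CkW k f : Ck k.+1 f -> Ck k f.
Proof.
elim: k f => [|k IH] f; first by case.
move=> [cf H]; split=> // v; have [df kf] := H v; split=> //; exact: IH.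
Qed.

Lemma Ck_cst k (c : R) : Ck k (fun _ : V => c).
Proof.
elim: k c => [|k IH] c /=; first exact: cst_continuous.
split; first exact: cst_continuous.
move=> v; split; first by move=> x; exact: derivable_cst.
rewrite (_ : 'D_v _ = fun=> 0); first exact: IH.
by apply/funext => x; rewrite derive_cst.
Qed.

Lemma CkD k f g : Ck k f -> Ck k g -> Ck k (fun x => f x + g x).
Proof.
elim: k f g => [|k IH] f g /= kf kg.
  by move=> x; apply: cvgD; [exact: kf|exact: kg].
split; first by move=> x; apply: cvgD; [exact: kf.1|exact: kg.1].
move=> v; have [df kdf] := kf.2 v; have [dg kdg] := kg.2 v.
split; first by move=> x; exact: derivableD.
rewrite (_ : 'D_v _ = fun x => 'D_v f x + 'D_v g x); first exact: IH.
by apply/funext => x; rewrite deriveD.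
Qed.

Lemma CkM k f g : Ck k f -> Ck k g -> Ck k (fun x => f x * g x).
Proof.
elim: k f g => [|k IH] f g kf kg.
  by move=> x; apply: cvgM; [exact: kf|exact: kg].
have [kf' kg'] := (CkW kf, CkW kg).
split; first by move=> x; apply: cvgM; [exact: kf.1|exact: kg.1].
move=> v; have [df kdf] := kf.2 v; have [dg kdg] := kg.2 v.
split; first by move=> x; exact: derivableM.
rewrite (_ : 'D_v _ = fun x => f x * 'D_v g x + g x * 'D_v f x).
  by apply: CkD; exact: IH.
by apply/funext => x; rewrite deriveM.
Qed.

Lemma Ck_sum k (I : Type) (r : seq I) (P : pred I) (F : I -> V -> R) :
  (forall i, P i -> Ck k (F i)) -> Ck k (fun x => \sum_(i <- r | P i) F i x).
Proof.
move=> kF; elim: r => [|i r IH].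
  rewrite (_ : (fun x => _) = fun=> 0); first exact: Ck_cst.
  by apply/funext => x; rewrite big_nil.
have [Pi|nPi] := boolP (P i).
  rewrite (_ : (fun x => _) = fun x => F i x + \sum_(j <- r | P j) F j x).
    by apply: CkD => //; exact: kF.
  by apply/funext => x; rewrite big_cons Pi.
rewrite (_ : (fun x => _) = fun x => \sum_(j <- r | P j) F j x) //.
by apply/funext => x; rewrite big_cons (negbTE nPi).
Qed.

Lemma CkX k f n : Ck k f -> Ck k (fun x => f x ^+ n).
Proof.
move=> kf; elim: n => [|n IH].
  by rewrite (_ : (fun x => _) = fun=> 1); [exact: Ck_cst|apply/funext].
rewrite (_ : (fun x => _) = fun x => f x * f x ^+ n); first exact: CkM.
by apply/funext => x; rewrite exprS.
Qed.

End Ck_closure.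

Section linform.
Variables (R : realType) (V : normedModType R).

Definition linform (l : V -> R) :=
  (forall (a : R) (u v : V), l (a *: u + v) = a * l u + l v) /\ continuous l.

Lemma linform0 l : linform l -> l 0 = 0.
Proof.
by move=> [L _]; have := L 1 0 0; rewrite scaler0 addr0 mul1r => /eqP; rewrite -subr_eq subrr eq_sym => /eqP.
Qed.

Lemma linformD l u v : linform l -> l (u + v) = l u + l v.
Proof. by move=> [L _]; rewrite -[u in LHS]scale1r L mul1r. Qed.

Lemma linformZ l a u : linform l -> l (a *: u) = a * l u.
Proof. by move=> Ll; rewrite -[_ *: _]addr0 Ll.1 linform0// addr0. Qed.

Lemma linform_bounded l : linform l -> exists2 M, 0 < M & forall v, `|l v| <= M * `|v|.
Proof.
move=> Ll.
pose ll : V -> R^o := l.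
have LL : linear ll by move=> a u v; exact: Ll.1.
pose m := GRing.isLinear.Build _ _ _ _ _ LL.
pose L : {linear V -> R^o} := HB.pack ll m.
have cL : continuous (L : V -> R^o) := Ll.2.
by have [M M0 H] := linear_lipschitz cL; exists M.
Qed.

Lemma linform_derive l x v : linform l -> is_derive x v l (l v).
Proof.
move=> Ll; have q : {near 0^', (fun h : R => h^-1 *: ((l \o shift x) (h *: v) - l x)) =1 cst (l v)}.
  have := nbhs_dnbhs_neq (0 : R); apply: filterS => h h0 /=.
  by rewrite linformD// addrK linformZ// [_ *: _]mulKf.
have key : (fun h : R => h^-1 *: ((l \o shift x) (h *: v) - l x)) @ 0^' --> l v.
  exact: cvg_near_cst.
by apply: DeriveDef; [apply/cvg_ex; eexists; exact: key|exact: (cvg_lim (@Rhausdorff R) key)].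
Qed.

Lemma Ck_linform k l : linform l -> Ck k l.
Proof.
move=> Ll; case: k => [|k]; first exact: Ll.2.
split; first exact: Ll.2.
move=> v; split; first by move=> x; have [] := linform_derive x v Ll.
rewrite (_ : 'D_v _ = fun=> l v); first exact: Ck_cst.
by apply/funext => x; have [_] := linform_derive x v Ll.
Qed.

Definition findim := exists (I : finType) (e : I -> V) (c : I -> V -> R),
  (forall i, linform (c i)) /\ forall x, x = \sum_i c i x *: e i.

End linform.

(** * The chain rule in finite dimension *)

Section C1.
Variables (R : realType) (V : normedModType R).
Hypothesis fV : findim V.

(** The coordinates are changed one at a time: each step is a one-variable increment, to
    which the mean value theorem applies, and the base points of all steps tend to x. *)
Lemma C1_increment (f : V -> R) x (I : Type) (s : seq I) (e : I -> V) (c : I -> V -> R) :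
  (forall i, linform (c i)) -> Ck 1 f ->
  forall eps, 0 < eps -> \forall h \near 0,
   `|f (x + \sum_(i <- s) c i h *: e i) - f x - \sum_(i <- s) c i h * 'D_(e i) f x|
     <= eps * `|h|.
Proof.
move=> lc kf; elim: s => [|i s IH] eps e0.
  by apply: nearW => h; rewrite !big_nil addr0 subrr subr0 normr0 mulr_ge0// ltW.
have [M M0 HM] := linform_bounded (lc i).
have dfi : forall x, derivable f x (e i) by move=> y; exact: Ck_derivable kf _ _.
have [K K0 HK] : exists2 K, 0 < K & forall h, `|\sum_(j <- s) c j h *: e j| <= K * `|h|.
  elim: (s) => [|j s' [K K0 HK]]; first by exists 1 => // h; rewrite big_nil normr0 mul1r.
  have [N N0 HN] := linform_bounded (lc j).
  exists (N * `|e j| + K); first by rewrite ltr_wpDl// mulr_ge0// ltW.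
  move=> h; rewrite big_cons (le_trans (ler_normD _ _))// mulrDl lerD//.
  by rewrite normrZ mulrAC ler_wpM2r.
have e2 : 0 < eps / 2 by rewrite divr_gt0.
have e2M : 0 < eps / 2 / M by rewrite !divr_gt0.
have /cvgrPdist_le/(_ _ e2M)/nbhs_ballP[d /= d0 Hd] := Ck_continuous (Ck_derive (e i) kf) (x := x).
pose L := K + M * `|e i| + 1.
have L0 : 0 < L by rewrite ltr_wpDl// addr_ge0// ?mulr_ge0// ltW.
have dL : 0 < d / L by rewrite divr_gt0.
have nh : \forall h \near (0 : V), `|h| < d / L.
  by apply/nbhs_ballP; exists (d / L) => //= h; rewrite -ball_normE/= sub0r normrN.
near=> h.
have hd : `|h| < d / L by near: h.
have IHh : `|f (x + \sum_(i <- s) c i h *: e i) - f x - \sum_(i <- s) c i h * 'D_(e i) f x|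
     <= eps / 2 * `|h| by near: h; exact: IH.
rewrite !big_cons.
set y := \sum_(_ <- _) _ in IHh *; set z := \sum_(_ <- _) _ in IHh *.
have [t tc E] := line_MVT (x + y) (c i h) dfi.
rewrite [c i h *: e i + y]addrC addrA.
rewrite (_ : _ - _ = (f (x + y) - f x - z) +
    (f (x + y + c i h *: e i) - f (x + y) - c i h * 'D_(e i) f x)); last by ring.
rewrite (le_trans (ler_normD _ _))// [eps]splitr mulrDl lerD//.
rewrite E -mulrBr normrM.
have /Hd : ball x d (x + y + t *: e i).
  rewrite -ball_normE/= -addrA opprD addNKr normrN.
  rewrite (le_lt_trans (ler_normD _ _))//.
  apply: (@le_lt_trans _ _ (L * `|h|)); last by rewrite mulrC -ltr_pdivlMr.
  rewrite /L 2!mulrDl mul1r ler_wpDr// lerD//; first exact: HK.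
  rewrite normrZ mulrAC ler_wpM2r//.
  exact: le_trans tc (HM h).
rewrite distrC => Hd'.
apply: (@le_trans _ _ (M * `|h| * (eps / 2 / M))).
  by apply: ler_pM => //; exact: HM.
by rewrite mulrC mulrA divfK ?gt_eqF// mulrC.
Unshelve. all: by end_near. Qed.

(** Continuous partial derivatives give a Frechet derivative; this is the point where
    finite dimension is needed, and it makes the chain rule available. *)
Lemma C1_diff (f : V -> R) x : Ck 1 f -> differentiable f x.
Proof.
move=> kf; have [I [e [c [lc ce]]]] := fV.
pose ll h : R^o := \sum_i c i h * 'D_(e i) f x.
have LL : linear ll.
  move=> a u v; rewrite /ll/= scaler_sumr -big_split/=; apply: eq_bigr => i _.
  by rewrite (lc i).1 mulrDl -mulrA.
pose m := GRing.isLinear.Build _ _ _ _ _ LL.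
pose L : {linear V -> R^o} := HB.pack ll m.
have cL : continuous L.
  apply: (@Ck_continuous _ _ 0); apply: Ck_sum => i _.
  by apply: CkM; [exact: Ck_linform|exact: Ck_cst].
have H : f \o shift x = cst (f x) + L +o_ 0 id.
  apply/eqaddoP => eps e0.
  have := C1_increment x (index_enum I) e lc kf e0.
  apply: filterS => h /=; rewrite -ce [x + h]addrC.
  by rewrite -addrA -opprD.
apply/diff_locallyP.
by rewrite (diff_unique cL H); split.
Qed.

End C1.

Section is_derive_vec.
Variables (R : realType) (W V : normedModType R).

Lemma is_derive_scalel (p : W -> R) dp (x w : W) (e : V) :
  is_derive x w p dp -> is_derive x w (fun y => p y *: e) (dp *: e).
Proof.
move=> [dp' <-].
have key : (fun h : R => h^-1 *: (((fun y => p y *: e) \o shift x) (h *: w) - p x *: e)) @ 0^'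
   --> 'D_w p x *: e.
  rewrite (_ : (fun h => _) = fun h : R => (h^-1 *: ((p \o shift x) (h *: w) - p x)) *: e).
    by apply: cvgZr_tmp.
  by apply/funext => h; rewrite -scalerBl scalerA.
by apply: DeriveDef; [apply/cvg_ex; eexists; exact: key|exact: (cvg_lim (@norm_hausdorff _ _) key)].
Qed.

Lemma is_derive_big (I : Type) (r : seq I) (P : pred I) (F : I -> W -> V) dF (x w : W) :
  (forall i, P i -> is_derive x w (F i) (dF i)) ->
  is_derive x w (fun y => \sum_(i <- r | P i) F i y) (\sum_(i <- r | P i) dF i).
Proof.
move=> H; elim: r => [|i r IH].
  rewrite big_nil (_ : (fun y => _) = cst 0); first exact: is_derive_cst.
  by apply/funext => y; rewrite big_nil.
rewrite big_cons (_ : (fun y => _) = fun y => if P i then F i y + \sum_(j <- r | P j) F j y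
   else \sum_(j <- r | P j) F j y); last by apply/funext => y; rewrite big_cons.
by case: ifPn => [/H Hi|//]; exact: is_deriveD.
Qed.

Lemma derive_line (G : W -> V) x w :
  'D_w G x = 'D_1 (fun h : R => G (h *: w + x)) 0.
Proof.
rewrite /derive; set q := (X in X @ _); set q' := (X in _ = lim (X @ _)).
suff -> : q = q' by [].
by apply/funext => h; rewrite /q /q' /= addr0 scale0r add0r [h%:A]mulr1.
Qed.

End is_derive_vec.

Section chain.
Variables (R : realType) (V : normedModType R).
Hypothesis fV : findim V.

Lemma deriveE_lin (f : V -> R) x : Ck 1 f ->
  forall a (u v : V), 'D_(a *: u + v) f x = a * 'D_u f x + 'D_v f x.
Proof.
move=> kf a u v; have df := C1_diff fV x kf.
by rewrite !deriveE// linearP.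
Qed.

Lemma is_derive_chain (W : normedModType R) (f : V -> R) (G : W -> V) x w G' :
  Ck 1 f -> is_derive x w G G' -> is_derive x w (f \o G) ('D_G' f (G x)).
Proof.
move=> kf dG.
pose g (h : R) := G (h *: w + x).
have dg : differentiable g 0.
  apply/derivable1_diffP; case: dG => dG _.
  by have /derivable1P := dG.
have g0 : g 0 = G x by rewrite /g scale0r add0r.
have Dg : 'D_1 g 0 = G'.
  by case: dG => _ <-; rewrite (derive_line G x w).
have df : differentiable f (g 0) by exact: C1_diff.
have dfg : differentiable (f \o g) 0 by exact: differentiable_comp.
apply: DeriveDef.
  by apply/derivable1P/derivable1_diffP.
have -> : 'D_w (f \o G) x = 'D_1 (f \o g) 0.
  by rewrite (derive_line (f \o G) x w).
by rewrite deriveE// diff_comp// /= -(deriveE (1 : R) dg) Dg -deriveE// g0.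
Qed.

(** Smoothness of vector-valued maps is tested on continuous linear forms, which avoids
    choosing coordinates in the target. *)
Definition Cmap (W : normedModType R) k (G : W -> V) :=
  forall l, linform l -> Ck k (l \o G).

Lemma Cmap_is_derive (W : normedModType R) (I : finType) (e : I -> V) (c : I -> V -> R)
  (G : W -> V) x w : (forall i, linform (c i)) -> (forall x, x = \sum_i c i x *: e i) ->
  Cmap 1 G -> is_derive x w G (\sum_i 'D_w (c i \o G) x *: e i).
Proof.
move=> lc ce kG.
have H i : is_derive x w (fun y => (c i \o G) y *: e i) ('D_w (c i \o G) x *: e i).
  by apply: is_derive_scalel; apply/derivableP; exact: Ck_derivable (kG _ (lc i)) _ _.
rewrite (_ : G = fun y => \sum_i (c i \o G) y *: e i); last first.
  by apply/funext => y; rewrite {1}[G y]ce.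
rewrite (_ : \sum_i 'D_w (c i \o _) x *: e i = \sum_i 'D_w (c i \o G) x *: e i); last first.
  by apply: eq_bigr => i _; congr ('D_w (c i \o _) x *: _); apply/funext => y; rewrite [in RHS](ce (G y)).
by apply: is_derive_big.
Qed.

Lemma CmapW (W : normedModType R) k (G : W -> V) : Cmap k.+1 G -> Cmap k G.
Proof. by move=> kG l Ll; apply: CkW; exact: kG. Qed.

Lemma Cmap_continuous (W : normedModType R) k (G : W -> V) : Cmap k G -> continuous G.
Proof.
have [I [e [c [lc ce]]]] := fV => kG.
rewrite (_ : G = fun y => \sum_i (c i \o G) y *: e i); last first.
  by apply/funext => y; rewrite {1}[G y]ce.
apply: continuous_big => [|i _ x]; first exact: add_continuous.
apply: cvgZr_tmp; exact: (Ck_continuous (kG _ (lc i))).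
Qed.

(** In coordinates, the derivative of f o G is a sum of products of derivatives of
    coordinates of G with compositions of lower order. *)
Lemma Ck_comp (W : normedModType R) k (f : V -> R) (G : W -> V) :
  Ck k f -> Cmap k G -> Ck k (f \o G).
Proof.
have [I [e [c [lc ce]]]] := fV.
elim: k f G => [|k IH] f G kf kG.
  by move=> x; apply: continuous_comp; [exact: Cmap_continuous kG _|exact: kf].
have k1f : Ck 1 f by elim: (k) kf => // k' IHk /CkW.
have k1G : Cmap 1 G by move=> l Ll; elim: (k) (kG l Ll) => // k' IHk /CkW.
have E x w : is_derive x w (f \o G) (\sum_i 'D_w (c i \o G) x * 'D_(e i) f (G x)).
  have := is_derive_chain k1f (Cmap_is_derive x w lc ce k1G).
  suff -> : 'D_(\sum_i 'D_w (c i \o G) x *: e i) f (G x) =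
    \sum_i 'D_w (c i \o G) x * 'D_(e i) f (G x) by [].
  have df := C1_diff fV (G x) k1f.
  by rewrite deriveE// linear_sum; apply: eq_bigr => i _; rewrite linearZ -deriveE.
split; first by have := IH f G (CkW kf) (CmapW kG); exact: Ck_continuous.
move=> w; split; first by move=> x; have [] := E x w.
rewrite (_ : 'D_w _ = fun x => \sum_i 'D_w (c i \o G) x * 'D_(e i) f (G x)).
  apply: Ck_sum => i _; apply: CkM; first exact: Ck_derive (kG _ (lc i)).
  by apply: (IH ('D_(e i) f)); [exact: Ck_derive|exact: CmapW].
by apply/funext => x; have [_] := E x w.
Qed.

End chain.

(** * Smooth functions and smooth maps *)

Section linform_theory.
Variables (R : realType).
Implicit Types (V W : normedModType R).

Lemma linform_id : linform (fun x : R => x).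
Proof. by split=> // x; exact: cvg_id. Qed.

Lemma linform_fst V W (l : V -> R) : linform l -> linform (fun p : V * W => l p.1).
Proof.
move=> Ll; split=> [a u v|]; first exact: Ll.1.
by move=> x; apply: continuous_comp; [exact: cvg_fst|exact: Ll.2].
Qed.

Lemma linform_snd V W (l : W -> R) : linform l -> linform (fun p : V * W => l p.2).
Proof.
move=> Ll; split=> [a u v|]; first exact: Ll.1.
by move=> x; apply: continuous_comp; [exact: cvg_snd|exact: Ll.2].
Qed.

Lemma linform_inl V W (l : V * W -> R) : linform l -> linform (fun v => l (v, 0)).
Proof.
move=> Ll; split=> [a u v|].
  by rewrite -Ll.1 -[a *: (u, 0) + (v, 0)]/(a *: u + v, a *: 0 + 0) scaler0 addr0.
move=> x; apply: (@continuous_comp _ _ _ (fun v => (v, 0)) l); last exact: Ll.2.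
exact: (cvg_pair cvg_id (cvg_cst (0 : W))).
Qed.

Lemma linform_inr V W (l : V * W -> R) : linform l -> linform (fun w => l (0, w)).
Proof.
move=> Ll; split=> [a u v|].
  by rewrite -Ll.1 -[a *: (0, u) + (0, v)]/(a *: 0 + 0, a *: u + v) scaler0 addr0.
move=> x; apply: (@continuous_comp _ _ _ (fun v => (0, v)) l); last exact: Ll.2.
exact: (cvg_pair (cvg_cst (0 : V)) cvg_id).
Qed.

Lemma linform_pairE V W (l : V * W -> R) v w : linform l ->
  l (v, w) = l (v, 0) + l (0, w).
Proof.
by move=> Ll; rewrite -linformD// -[(v, 0) + (0, w)]/(v + 0, 0 + w) addr0 add0r.
Qed.

Lemma findim_real : findim (R : normedModType R).
Proof.
exists unit, (fun _ => 1), (fun _ x => x); split=> [_|x]; first exact: linform_id.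
rewrite (big_pred1 tt) => [|[]]; rewrite ?[_ *: _]mulr1//.
Qed.

Lemma findim_rV n : findim 'rV[R]_n.
Proof.
exists 'I_n, (fun i : 'I_n => delta_mx 0 i), (fun i (x : 'rV[R]_n) => x 0 i); split=> [i|x].
  by split=> [a u v|]; [rewrite !mxE|exact: coord_continuous].
exact: row_sum_delta.
Qed.

Lemma findim_prod V W : findim V -> findim W -> findim (V * W)%type.
Proof.
move=> [I [e [c [lc ce]]]] [J [e' [c' [lc' ce']]]].
exists (I + J)%type, (fun k => match k with inl i => (e i, 0) | inr j => (0, e' j) end),
  (fun k p => match k with inl i => c i p.1 | inr j => c' j p.2 end).
split=> [[i|j]|[v w]]; [exact: linform_fst|exact: linform_snd|].
rewrite big_sumType/= {1}(ce v) {1}(ce' w).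
rewrite (_ : \sum_i c i v *: (e i, 0) = (\sum_i c i v *: e i, 0)); last first.
  elim/big_ind2 : _ => // [|i _]; first by move=> x1 x2 y1 y2 -> ->; rewrite -[LHS]/(x1 + y1, 0 + 0) addr0.
  by rewrite -[LHS]/(c i v *: e i, c i v *: 0) scaler0.
rewrite (_ : \sum_i c' i w *: (0, e' i) = (0, \sum_i c' i w *: e' i)); last first.
  elim/big_ind2 : _ => // [|i _]; first by move=> x1 x2 y1 y2 -> ->; rewrite -[LHS]/(0 + 0, x1 + y1) addr0.
  by rewrite -[LHS]/(c' i w *: 0, c' i w *: e' i) scaler0.
by rewrite -[RHS]/(_ + 0, 0 + _) addr0 add0r.
Qed.

End linform_theory.

Section smooth.
Variables (R : realType).
Implicit Types (V W U : normedModType R).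

Definition smooth_map V W (G : W -> V) := forall k, Cmap k G.

Lemma smooth_continuous V (f : V -> R) : Csmooth f -> continuous f.
Proof. by move=> sf; exact: (sf 0%N). Qed.
Lemma smooth_derivable V (f : V -> R) x v : Csmooth f -> derivable f x v.
Proof. by move=> sf; exact: Ck_derivable (sf 1%N) x v. Qed.
Lemma smooth_D V (f : V -> R) v : Csmooth f -> Csmooth ('D_v f).
Proof. by move=> sf k; apply: Ck_derive; exact: sf. Qed.
Lemma smooth_cst V (c : R) : Csmooth (fun _ : V => c).
Proof. by move=> k; exact: Ck_cst. Qed.
Lemma smoothD V (f g : V -> R) : Csmooth f -> Csmooth g -> Csmooth (fun x => f x + g x).
Proof. by move=> sf sg k; exact: CkD. Qed.
Lemma smoothM V (f g : V -> R) : Csmooth f -> Csmooth g -> Csmooth (fun x => f x * g x).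
Proof. by move=> sf sg k; exact: CkM. Qed.
Lemma smoothZ V (f : V -> R) c : Csmooth f -> Csmooth (fun x => c * f x).
Proof. by move=> sf; apply: smoothM => //; exact: smooth_cst. Qed.
Lemma smoothN V (f : V -> R) : Csmooth f -> Csmooth (fun x => - f x).
Proof.
move=> sf; rewrite (_ : (fun x => _) = fun x => -1 * f x); first exact: smoothZ.
by apply/funext => x; rewrite mulN1r.
Qed.
Lemma smoothB V (f g : V -> R) : Csmooth f -> Csmooth g -> Csmooth (fun x => f x - g x).
Proof. by move=> sf sg; apply: smoothD => //; exact: smoothN. Qed.
Lemma smoothX V (f : V -> R) n : Csmooth f -> Csmooth (fun x => f x ^+ n).
Proof. by move=> sf k; exact: CkX. Qed.
Lemma smooth_sum V (I : Type) (r : seq I) (P : pred I) (F : I -> V -> R) :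
  (forall i, P i -> Csmooth (F i)) -> Csmooth (fun x => \sum_(i <- r | P i) F i x).
Proof. by move=> sF k; apply: Ck_sum => i Pi; exact: sF. Qed.
Lemma smooth_linform V (l : V -> R) : linform l -> Csmooth l.
Proof. by move=> Ll k; exact: Ck_linform. Qed.

Lemma smooth_map_real V (g : V -> R) : Csmooth g -> smooth_map g.
Proof.
move=> sg k l Ll; rewrite (_ : l \o g = fun x => l 1 * g x); first exact: smoothZ.
by apply/funext => x /=; rewrite -{1}[g x]mulr1 [l (_ * _)](linformZ _ _ Ll) mulrC.
Qed.
Lemma smooth_map_id V : smooth_map (fun x : V => x).
Proof. by move=> k l Ll; exact: Ck_linform. Qed.
Lemma smooth_map_cst V W (v : V) : smooth_map (fun _ : W => v).
Proof. by move=> k l Ll; exact: Ck_cst. Qed.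
Lemma smooth_mapD V W (G H : W -> V) : smooth_map G -> smooth_map H -> smooth_map (fun x => G x + H x).
Proof.
move=> sG sH k l Ll; rewrite (_ : _ \o _ = fun x => (l \o G) x + (l \o H) x).
  by apply: CkD; [exact: sG|exact: sH].
by apply/funext => x /=; rewrite linformD.
Qed.
Lemma smooth_mapZl V W (p : W -> R) (e : V) : Csmooth p -> smooth_map (fun x => p x *: e).
Proof.
move=> sp k l Ll; rewrite (_ : _ \o _ = fun x => l e * p x); first exact: smoothZ.
by apply/funext => x /=; rewrite linformZ// mulrC.
Qed.
Lemma smooth_map_pair V W U (G : W -> V) (H : W -> U) : smooth_map G -> smooth_map H ->
  smooth_map (fun x => (G x, H x)).
Proof.
move=> sG sH k l Ll.
rewrite (_ : _ \o _ = fun x => ((fun v => l (v, 0)) \o G) x + ((fun v => l (0, v)) \o H) x).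
  by apply: CkD; [apply: sG; exact: linform_inl|apply: sH; exact: linform_inr].
by apply/funext => x /=; rewrite linform_pairE.
Qed.
Lemma smooth_map_fst V W U (G : W -> V * U) : smooth_map G -> smooth_map (fun x => (G x).1).
Proof. by move=> sG k l Ll; apply: (sG _ (fun p => l p.1)); exact: linform_fst. Qed.
Lemma smooth_map_snd V W U (G : W -> V * U) : smooth_map G -> smooth_map (fun x => (G x).2).
Proof. by move=> sG k l Ll; apply: (sG _ (fun p => l p.2)); exact: linform_snd. Qed.
Lemma smooth_of_map V (g : V -> R) : smooth_map g -> Csmooth g.
Proof. by move=> sg k; exact: (sg k (fun x => x) (linform_id R)). Qed.

Lemma smooth_comp V W (f : V -> R) (G : W -> V) : findim V -> Csmooth f -> smooth_map G ->
  Csmooth (fun x => f (G x)).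
Proof. by move=> fV sf sG k; apply: Ck_comp. Qed.

Lemma smooth_derive_lin V (f : V -> R) x a u v : findim V -> Csmooth f ->
  'D_(a *: u + v) f x = a * 'D_u f x + 'D_v f x.
Proof. by move=> fV sf; apply: deriveE_lin => //; exact: sf. Qed.

Lemma smooth_deriveZ V (f : V -> R) x a u : findim V -> Csmooth f ->
  'D_(a *: u) f x = a * 'D_u f x.
Proof. by move=> fV sf; rewrite -[_ *: _]addr0 smooth_derive_lin// derive0 addr0. Qed.

Lemma smooth_deriveD V (f : V -> R) x u v : findim V -> Csmooth f ->
  'D_(u + v) f x = 'D_u f x + 'D_v f x.
Proof. by move=> fV sf; rewrite -[u in LHS]scale1r smooth_derive_lin// mul1r. Qed.

Lemma smooth_chain V W (f : V -> R) (G : W -> V) x w G' : findim V ->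
  Csmooth f -> is_derive x w G G' -> is_derive x w (fun y => f (G y)) ('D_G' f (G x)).
Proof. by move=> fV sf; apply: is_derive_chain => //; exact: sf. Qed.

Lemma is_derive_pair V W U (G : W -> V) (H : W -> U) x w G' H' :
  is_derive x w G G' -> is_derive x w H H' ->
  is_derive x w (fun y => (G y, H y)) (G', H').
Proof.
move=> [dG eG] [dH eH].
have key : (fun h : R => h^-1 *: (((fun y => (G y, H y)) \o shift x) (h *: w) - (G x, H x))) @ 0^'
   --> (G', H').
  rewrite -eG -eH.
  exact: (cvg_pair dG dH).
by apply: DeriveDef; [apply/cvg_ex; eexists; exact: key|exact: (cvg_lim (@norm_hausdorff _ _) key)].
Qed.

End smooth.

(** * Partial derivatives, parametric integrals and symmetry of second derivatives *)

Section slices.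
Variables (R : realType).
Implicit Types (V W U : normedModType R).

Lemma is_derive_inl V W U (G : V * W -> U) x y v d :
  is_derive (x, y) (v, 0) G d <-> is_derive x v (fun x => G (x, y)) d.
Proof.
have e : (fun h : R => h^-1 *: ((G \o shift (x, y)) (h *: (v, 0)) - G (x, y)))
  = (fun h : R => h^-1 *: (((fun x => G (x, y)) \o shift x) (h *: v) - G (x, y))).
  apply/funext => h /=; congr (_ *: (G _ - _)).
  by rewrite -[LHS]/(h *: v + x, h *: 0 + y) scaler0 add0r.
by split=> -[d1 d2]; apply: DeriveDef; move: d1 d2; rewrite /derivable /derive e.
Qed.

Lemma is_derive_inr V W U (G : V * W -> U) x y v d :
  is_derive (x, y) (0, v) G d <-> is_derive y v (fun y => G (x, y)) d.
Proof.
have e : (fun h : R => h^-1 *: ((G \o shift (x, y)) (h *: (0, v)) - G (x, y)))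
  = (fun h : R => h^-1 *: (((fun y => G (x, y)) \o shift y) (h *: v) - G (x, y))).
  apply/funext => h /=; congr (_ *: (G _ - _)).
  by rewrite -[LHS]/(h *: 0 + x, h *: v + y) scaler0 add0r.
by split=> -[d1 d2]; apply: DeriveDef; move: d1 d2; rewrite /derivable /derive e.
Qed.

Lemma derive_inl V W (G : V * W -> R) x y v : Csmooth G ->
  'D_(v, 0) G (x, y) = 'D_v (fun x => G (x, y)) x.
Proof.
move=> sG; have [_ <-//] := (is_derive_inl G x y v _).1 (derivableP (smooth_derivable sG)).
Qed.

Lemma derive_inr V W (G : V * W -> R) x y v : Csmooth G ->
  'D_(0, v) G (x, y) = 'D_v (fun y => G (x, y)) y.
Proof.
move=> sG; have [_ <-//] := (is_derive_inr G x y v _).1 (derivableP (smooth_derivable sG)).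
Qed.

Lemma smooth_is_derive V (f : V -> R) x v : Csmooth f -> is_derive x v f ('D_v f x).
Proof. by move=> sf; apply: derivableP; exact: smooth_derivable. Qed.

End slices.

Section oint_smooth.
Variables (R : realType) (V : normedModType R).

(** Derivatives pass under the integral sign, and the derivative of the integrand is again
    of the form covered by the induction. *)
Lemma Ck_oint k (F : V * R -> R) a c : Ck k F ->
  Ck k (fun x => oint a c (fun s => F (x, s))).
Proof.
elim: k F => [|k IH] F kF; first exact: oint_param_continuous kF.
split; first by apply: oint_param_continuous; exact: Ck_continuous kF.
have D v x := oint_param_derive a c (Ck_continuous kF) (fun z => @Ck_derivable _ _ _ _ kF z (v, 0))
    (Ck_continuous (Ck_derive (v, 0) kF)) x.
move=> v; split; first by move=> x; have [] := D v x.
rewrite (_ : 'D_v _ = fun x => oint a c (fun s => 'D_(v, 0) F (x, s))).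
  by apply: (IH ('D_(v, 0) F)); exact: Ck_derive.
by apply/funext => x; have [_] := D v x.
Qed.

Lemma smooth_oint (F : V * R -> R) a c : Csmooth F ->
  Csmooth (fun x => oint a c (fun s => F (x, s))).
Proof. by move=> sF k; exact: Ck_oint. Qed.

Lemma smooth_oint_derive (F : V * R -> R) a c v x : Csmooth F ->
  is_derive x v (fun x => oint a c (fun s => F (x, s)))
     (oint a c (fun s => 'D_(v, 0) F (x, s))).
Proof.
move=> sF; apply: oint_param_derive; first exact: smooth_continuous.
  by move=> z; exact: smooth_derivable.
by apply: smooth_continuous; exact: smooth_D.
Qed.

End oint_smooth.

Section schwarz.
Variables (R : realType) (V : normedModType R).

Lemma continuous_line (G : V -> R) x v : continuous G -> continuous (fun s : R => G (x + s *: v)).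
Proof.
move=> cG s; apply: (@continuous_comp _ _ _ (fun s : R => x + s *: v) G); last exact: cG.
apply: (@cvgD _ _ _ _ _ (cst x)); first exact: cvg_cst.
by apply: cvgZr_tmp.
Qed.

(** Write f(x + s v) = f(x) + int_0^s D_v f(x + r v) dr, differentiate along w under the
    integral sign, then with respect to s at s = 0. *)
Lemma schwarz (f : V -> R) v w x : Csmooth f -> 'D_v ('D_w f) x = 'D_w ('D_v f) x.
Proof.
move=> sf; pose K (s : R) := 'D_w ('D_v f) (x + s *: v).
have cK : continuous K by apply: (@continuous_line ('D_w ('D_v f))); apply: smooth_continuous; do 2!apply: smooth_D.
have cl (G : V -> R) : continuous G -> continuous (fun p : V * R => G (p.1 + p.2 *: v)).
  move=> cG p; apply: (@continuous_comp _ _ _ (fun p : V * R => p.1 + p.2 *: v) G); last exact: cG.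
  apply: (@cvgD _ _ _ _ _ (fun p : V * R => p.1) (fun p : V * R => p.2 *: v)); first exact: cvg_fst.
  by apply: (@cvgZr_tmp _ _ _ _ _ (fun p : V * R => p.2)); exact: cvg_snd.
have E y s : f (y + s *: v) = f y + oint 0 s (fun s => 'D_v f (y + s *: v)).
  have cl1 : continuous (fun s : R => 'D_v f (y + s *: v)).
    by apply: (@continuous_line ('D_v f)); apply: smooth_continuous; exact: smooth_D.
  rewrite (oint_FTC2 0 s cl1 (fun t => is_derive_line y t (fun z => smooth_derivable sf))).
  by rewrite scale0r addr0 addrCA subrr addr0.
have dl (G : V -> R) (y : V) (s : R) : Csmooth G ->
    is_derive (y, s) (w, 0 : R) (fun p : V * R => G (p.1 + p.2 *: v)) ('D_w G (y + s *: v)).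
  move=> sG; apply/is_derive_inl => /=.
  have e : (fun h : R => h^-1 *: ((G \o shift (y + s *: v)) (h *: w) - G (y + s *: v)))
    = (fun h : R => h^-1 *: (((fun y => G (y + s *: v)) \o shift y) (h *: w) - G (y + s *: v))).
    by apply/funext => h /=; rewrite addrA.
  by apply: DeriveDef; have [] := smooth_is_derive (y + s *: v) w sG; rewrite /derivable /derive e.
have E2 s : 'D_w f (x + s *: v) = 'D_w f x + oint 0 s K.
  have [_ <-] := (is_derive_inl _ _ _ _ _).1 (dl f x s sf).
  rewrite /= (_ : (fun y => _) = f + (fun y => oint 0 s (fun s => 'D_v f (y + s *: v)))); last first.
    by apply/funext => y; rewrite E.
  pose F (p : V * R) := 'D_v f (p.1 + p.2 *: v).
  have DF z : is_derive z (w, 0 : R) F ('D_w ('D_v f) (z.1 + z.2 *: v)).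
    by case: z => y r; apply: dl; exact: smooth_D.
  have H : is_derive x w (fun y => oint 0 s (fun s => F (y, s))) (oint 0 s (fun s => 'D_(w, 0 : R) F (x, s))).
    apply: oint_param_derive; first by apply: (cl ('D_v f)); apply: smooth_continuous; exact: smooth_D.
      by move=> z; have [] := DF z.
    rewrite (_ : 'D_(w, 0 : R) F = fun z => 'D_w ('D_v f) (z.1 + z.2 *: v)).
      by apply: (cl ('D_w ('D_v f))); apply: smooth_continuous; do 2!apply: smooth_D.
    by apply/funext => z; have [_] := DF z.
  have [H1 H2] := H.
  rewrite deriveD//; last exact: smooth_derivable.
  congr (_ + _); rewrite H2; apply: oint_eq => r; by have [_] := DF (x, r).
have [H dH He] := oint_primitive cK.
have e : (fun s : R => 'D_w f (x + s *: v)) = H + cst ('D_w f x - H 0).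
  by apply/funext => s; rewrite E2 He/= /cst; rewrite -[RHS]/(H s + _); ring.
have A : is_derive (0 : R) (1 : R) (fun s : R => 'D_w f (x + s *: v)) ('D_v ('D_w f) (x + 0 *: v)).
  exact: (is_derive_line x 0 (fun z => smooth_derivable (smooth_D w sf))).
have B : is_derive (0 : R) (1 : R) (H + cst ('D_w f x - H 0)) (K 0 + 0).
  by apply: is_deriveD; exact: dH.
move: A; rewrite e => -[_]; case: B => _ ->.
by rewrite /K scale0r !addr0 => ->.
Qed.

End schwarz.

(** * Trigonometric functions and Duhamel integrals *)

Section real_functions.
Variable R : realType.

Lemma is_derive_dir (f : R -> R) (x v d : R) :
  is_derive x (1 : R) f d -> is_derive x v f (v * d).
Proof.
move=> [df <-].
have df' : differentiable f x by apply/derivable1_diffP.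
apply: DeriveDef; first exact: diff_derivable.
by rewrite !deriveE// -[in LHS](mulr1 v) linearZ.
Qed.

Lemma smooth_sin_cos : Csmooth (@sin R) /\ Csmooth (@cos R).
Proof.
have cs : continuous (@sin R) by move=> x; exact: continuous_sin.
have cc : continuous (@cos R) by move=> x; exact: continuous_cos.
suff H k : Ck k (@sin R) /\ Ck k (@cos R) by split=> k; have [] := H k.
elim: k => [//|k [IHs IHc]].
split; split=> // v.
- have D (x : R) := is_derive_dir v (is_derive_sin x).
  split; first by move=> x; have [] := D x.
  rewrite (_ : 'D_v _ = fun x => v * cos x); first by apply: CkM => //; exact: Ck_cst.
  by apply/funext => x; have [_] := D x.
- have D (x : R) := is_derive_dir v (is_derive_cos x).
  split; first by move=> x; have [] := D x.
  rewrite (_ : 'D_v _ = fun x => v * - sin x); last by apply/funext => x; have [_] := D x.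
  rewrite (_ : (fun x => _) = fun x => - v * sin x).
    by apply: CkM => //; exact: Ck_cst.
  by apply/funext => x; rewrite mulrN mulNr.
Qed.

Lemma smooth_sin (V : normedModType R) (p : V -> R) : Csmooth p -> Csmooth (fun x => sin (p x)).
Proof. by move=> sp; apply: (smooth_comp (@findim_real R) smooth_sin_cos.1); exact: smooth_map_real. Qed.

Lemma smooth_cos (V : normedModType R) (p : V -> R) : Csmooth p -> Csmooth (fun x => cos (p x)).
Proof. by move=> sp; apply: (smooth_comp (@findim_real R) smooth_sin_cos.2); exact: smooth_map_real. Qed.

(** Moves a variable endpoint into the integrand, so that smoothness in the endpoint becomes
    smoothness in a parameter. *)
Lemma oint_scale (h : R -> R) (t : R) : continuous h ->
  oint 0 t h = t * oint 0 1 (fun s => h (t * s)).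
Proof.
move=> ch; have [H dH ->] := oint_primitive ch.
have cht : continuous (fun s : R => h (t * s)).
  move=> s; apply: (@continuous_comp _ _ _ (fun s => t * s) h); last exact: ch.
  by apply: cvgMr.
rewrite -ointZ//.
have D (s : R) : is_derive s (1 : R) (fun s => H (t * s)) (t * h (t * s)).
  have A : is_derive s (1 : R) (fun s : R => t * s) (t *: 1) by exact: is_deriveZ.
  by have := is_derive1_comp (dH (t * s)) A; rewrite -[t *: 1]/(t * 1) mulr1 mulrC.
rewrite (oint_FTC2 0 1 _ D) ?mulr1 ?mulr0//.
by move=> s; apply: cvgMr; exact: cht.
Qed.

End real_functions.

Section oint_end.
Variables (R : realType) (V : normedModType R).
Hypothesis fV : findim V.

Let fVR : findim (V * R)%type. Proof. exact: findim_prod fV (@findim_real R). Qed.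

Lemma smooth_oint_end (F : V * R -> R) : Csmooth F ->
  Csmooth (fun p : V * R => oint 0 p.2 (fun s => F (p.1, s))).
Proof.
move=> sF.
rewrite (_ : (fun p => _) = fun p => p.2 * oint 0 1 (fun s => F (p.1, p.2 * s))); last first.
  apply/funext => -[x t] /=; rewrite oint_scale//.
  by apply: slice_continuous; exact: smooth_continuous.
apply: smoothM; first exact: smooth_linform (linform_snd _ (linform_id R)).
apply: (@smooth_oint _ _ (fun q : (V * R) * R => F (q.1.1, q.1.2 * q.2))).
apply: (smooth_comp fVR sF); apply: smooth_map_pair.
  by do 2!apply: smooth_map_fst; exact: smooth_map_id.
apply: smooth_map_real; apply: smoothM; apply: smooth_of_map; last by apply: smooth_map_snd; exact: smooth_map_id.
by apply: smooth_map_snd; apply: smooth_map_fst; exact: smooth_map_id.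
Qed.

Lemma oint_end_derive_t (F : V * R -> R) x t : Csmooth F ->
  'D_((0 : V), (1 : R)) (fun p : V * R => oint 0 p.2 (fun s => F (p.1, s))) (x, t) = F (x, t).
Proof.
move=> sF; rewrite derive_inr; last exact: smooth_oint_end.
have cs := @slice_continuous _ _ F x (smooth_continuous sF).
have [H dH /= He] := oint_primitive cs.
rewrite (_ : (fun y => _) = H - cst (H 0)); last by apply/funext => y; rewrite He.
have D : is_derive t (1 : R) (H - cst (H 0)) (F (x, t) - 0) by apply: is_deriveB; exact: dH.
by have [_ ->] := D; rewrite subr0.
Qed.

Lemma oint_end_derive_x (F : V * R -> R) x t v : Csmooth F ->
  'D_(v, (0 : R)) (fun p : V * R => oint 0 p.2 (fun s => F (p.1, s))) (x, t)
    = oint 0 t (fun s => 'D_(v, (0 : R)) F (x, s)).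
Proof.
move=> sF; rewrite derive_inl; last exact: smooth_oint_end.
by have [_ <-] := smooth_oint_derive 0 t v x sF.
Qed.

End oint_end.

Section linmap.
Variables (R : realType) (V W : normedModType R).

Lemma is_derive_linmap (L : W -> V) x w : (forall h : R, L (h *: w + x) = h *: L w + L x) ->
  is_derive x w L (L w).
Proof.
move=> LL.
have key : (fun h : R => h^-1 *: ((L \o shift x) (h *: w) - L x)) @ 0^' --> L w.
  apply: cvg_near_cst.
  have := nbhs_dnbhs_neq (0 : R); apply: filterS => h h0 /=.
  by rewrite LL addrK scalerA mulVf// scale1r.
by apply: DeriveDef; [apply/cvg_ex; eexists; exact: key|exact: (cvg_lim (@norm_hausdorff _ _) key)].
Qed.

End linmap.

Section duhamel.
Variables (R : realType) (V : normedModType R).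
Hypothesis fV : findim V.

Let fVR : findim (V * R)%type. Proof. exact: findim_prod fV (@findim_real R). Qed.

Definition duhamel (F : (V * R) * R -> R) (p : V * R) : R :=
  oint 0 p.2 (fun s => F ((p.1, s), p.2 - s)).

Variable F : (V * R) * R -> R.
Hypothesis sF : Csmooth F.

Let G (q : (V * R) * R) := F ((q.1.1, q.2), q.1.2 - q.2).
Let sG : Csmooth G.
Proof.
apply: (smooth_comp (findim_prod fVR (@findim_real R)) sF); apply: smooth_map_pair; first apply: smooth_map_pair.
- by do 2!apply: smooth_map_fst; exact: smooth_map_id.
- by apply: smooth_map_snd; exact: smooth_map_id.
- apply: smooth_map_real; apply: smoothB; apply: smooth_of_map; first by apply: smooth_map_snd; apply: smooth_map_fst; exact: smooth_map_id.
  by apply: smooth_map_snd; exact: smooth_map_id.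
Qed.

Let P (q : (V * R) * R) : R := oint 0 q.2 (fun s => G (q.1, s)).

Let duhamelE : duhamel F = fun p => P (p, p.2).
Proof. by []. Qed.


Lemma duhamel0 v : duhamel F (v, 0) = 0.
Proof.
by apply: ointaa; exact (@slice_continuous _ _ G (v, 0) (smooth_continuous sG)).
Qed.

Lemma smooth_duhamel : Csmooth (duhamel F).
Proof.
rewrite duhamelE; apply: (@smooth_comp _ _ _ P (fun p => (p, p.2))) => //.
- exact: findim_prod fVR (@findim_real R).
- by apply: (smooth_oint_end fVR).
- by apply: smooth_map_pair; [exact: smooth_map_id|apply: smooth_map_snd; exact: smooth_map_id].
Qed.

(** The endpoint contributes F((x, t), 0), the integrand the derivative of F in its last
    variable. *)
Lemma duhamel_derive x t v c :
  'D_(v, c) (duhamel F) (x, t) = duhamel ('D_((v, 0), c) F) (x, t) + c * F ((x, t), 0).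
Proof.
have sP : Csmooth P by exact: (smooth_oint_end fVR).
have fV3 : findim ((V * R) * R)%type by exact: findim_prod fVR (@findim_real R).
have dp : is_derive (x, t) (v, c) (fun p : V * R => (p, p.2)) ((v, c), c).
  exact: (is_derive_linmap (L := fun p : V * R => (p, p.2))).
have [_ /= E] := smooth_chain fV3 sP dp; rewrite duhamelE E.
rewrite (_ : ((v, c), c) = c *: ((0 : V * R), (1 : R)) + ((v, c), (0 : R))); last first.
  by rewrite -[RHS]/(c *: 0 + (v, c), c * 1 + 0) scaler0 add0r mulr1 addr0.
rewrite (smooth_derive_lin (x, t, t) c (0, 1) (v, c, 0) fV3 sP).
rewrite (oint_end_derive_t fVR (x, t) t sG) (oint_end_derive_x fVR (x, t) t (v, c) sG) addrC.
have sP0 : G ((x, t), t) = F ((x, t), 0) by rewrite /G /= subrr.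
rewrite sP0 /duhamel /=.
suff -> : oint 0 t (fun s => 'D_(v, c, 0) G (x, t, s)) = oint 0 t (fun s => 'D_(v, 0, c) F (x, s, t - s)) by [].
  apply: oint_eq => s.
  have dg : is_derive ((x, t), s) ((v, c), (0 : R))
     (fun q : (V * R) * R => ((q.1.1, q.2), q.1.2 - q.2)) ((v, 0), c - 0).
    by apply: (is_derive_linmap (L := fun q : (V * R) * R => ((q.1.1, q.2), q.1.2 - q.2)))
      => h; congr (_, _, _) => //=; rewrite scalerBr addrACA opprD.
  have [_ ->] := smooth_chain fV3 sF dg.
  by rewrite subr0.
Qed.

End duhamel.

(** * Plane polar coordinates *)

Section polar.
Variables (R : realType) (V : normedModType R).
Hypothesis fV : findim V.
Variables (e : V) (T : R).

Let fVR : findim (V * R)%type. Proof. exact: findim_prod fV (@findim_real R). Qed.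
(** The point at polar coordinates (r, th) of the half-plane spanned by e and the radial
    variable of V * R. *)
Definition polar (v : V) (r th : R) : V * R := (v + (r * cos th) *: e, r * sin th).

Definition polar_int (w : R -> R) (N : V * R -> R) (p : V * R) : R :=
  oint 0 T (fun th => w th * N (polar p.1 p.2 th)).

Lemma smooth_polar (w : R -> R) (N : V * R -> R) : Csmooth w -> Csmooth N ->
  Csmooth (fun q : (V * R) * R => w q.2 * N (polar q.1.1 q.1.2 q.2)).
Proof.
move=> sw sN.
have s2 : Csmooth (fun q : (V * R) * R => q.2) by apply: smooth_of_map; apply: smooth_map_snd; exact: smooth_map_id.
have s12 : Csmooth (fun q : (V * R) * R => q.1.2).
  by apply: smooth_of_map; apply: smooth_map_snd; apply: smooth_map_fst; exact: smooth_map_id.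
apply: smoothM; first by apply: (smooth_comp (@findim_real R) sw); exact: smooth_map_real.
apply: (smooth_comp fVR sN); apply: smooth_map_pair.
  apply: smooth_mapD; first by do 2!apply: smooth_map_fst; exact: smooth_map_id.
  by apply: smooth_mapZl; apply: smoothM => //; exact: smooth_cos.
by apply: smooth_map_real; apply: smoothM => //; exact: smooth_sin.
Qed.

Lemma smooth_polar_int w N : Csmooth w -> Csmooth N -> Csmooth (polar_int w N).
Proof.
move=> sw sN.
exact: (@smooth_oint R _ (fun q : (V * R) * R => w q.2 * N (polar q.1.1 q.1.2 q.2)) 0 T (smooth_polar sw sN)).
Qed.

Lemma continuous_polar w N v r : Csmooth w -> Csmooth N ->
  continuous (fun th => w th * N (polar v r th)).
Proof.
move=> sw sN.
exact: (@slice_continuous R _ (fun q : (V * R) * R => w q.2 * N (polar q.1.1 q.1.2 q.2)) (v, r)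
  (smooth_continuous (smooth_polar sw sN))).
Qed.

(** For a fixed angle, polar is linear in (v, r), so only the chain rule is needed. *)
Lemma polar_int_derive w N u c v r : Csmooth w -> Csmooth N ->
  'D_(u, c) (polar_int w N) (v, r) =
  oint 0 T (fun th => w th * ('D_(u, (0 : R)) N (polar v r th) +
     c * (cos th * 'D_(e, (0 : R)) N (polar v r th) +
          sin th * 'D_((0 : V), (1 : R)) N (polar v r th)))).
Proof.
move=> sw sN; have sK := smooth_polar sw sN.
have [_ ->] := smooth_oint_derive 0 T (u, c) (v, r) sK.
apply: oint_eq => th; rewrite derive_inl// /=.
have dL : is_derive (v, r) (u, c) (fun p : V * R => polar p.1 p.2 th) (u + (c * cos th) *: e, c * sin th).
  apply: (is_derive_linmap (L := fun p : V * R => polar p.1 p.2 th)) => h.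
  congr (_, _) => /=.
    by rewrite scalerDr scalerA addrACA -scalerDl mulrA mulrDl.
  by rewrite mulrDl -[h *: c]/(h * c) -mulrA.
have dN := smooth_chain fVR sN dL.
have [_ ->] : is_derive (v, r) (u, c) (fun p : V * R => w th * N (polar p.1 p.2 th)) (w th *: ('D_(u + (c * cos th) *: e, c * sin th) N (polar v r th))).
  exact: is_deriveZ.
congr (_ * _).
rewrite (_ : (u + _, _) = (c * cos th) *: (e, (0 : R)) + ((c * sin th) *: ((0 : V), (1 : R)) + (u, (0 : R)))); last first.
  rewrite -[RHS]/((c * cos th) *: e + ((c * sin th) *: 0 + u), (c * cos th) * 0 + ((c * sin th) * 1 + 0)).
  by rewrite scaler0 mulr0 !add0r addr0 mulr1 addrC.
rewrite (smooth_derive_lin _ _ (e, (0 : R)) _ fVR sN) (smooth_derive_lin _ _ ((0 : V), (1 : R)) _ fVR sN).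
move: (derive N _ (e, 0)) (derive N _ (0, 1)) (derive N _ (u, 0)) => d1 d2 d3.
by ring.
Qed.

Lemma polar_int_dr w N : Csmooth w -> Csmooth N ->
  'D_((0 : V), (1 : R)) (polar_int w N) = fun p =>
  polar_int (fun th => w th * cos th) ('D_(e, (0 : R)) N) p +
  polar_int (fun th => w th * sin th) ('D_((0 : V), (1 : R)) N) p.
Proof.
move=> sw sN; apply/funext => -[v r]; rewrite polar_int_derive// /polar_int -ointD.
- by apply: oint_eq => th; rewrite derive0 /=; ring.
- exact (@continuous_polar _ _ v r (smoothM sw (smooth_sin_cos R).2) (smooth_D (e, (0 : R)) sN)).
- exact (@continuous_polar _ _ v r (smoothM sw (smooth_sin_cos R).1) (smooth_D ((0 : V), (1 : R)) sN)).
Qed.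

Lemma polar_int_dx w N u : Csmooth w -> Csmooth N ->
  'D_(u, (0 : R)) (polar_int w N) = polar_int w ('D_(u, (0 : R)) N).
Proof.
move=> sw sN; apply/funext => -[v r]; rewrite polar_int_derive//.
by apply: oint_eq => th; rewrite mul0r addr0.
Qed.

Lemma polar_dth N v r th : Csmooth N ->
  is_derive th (1 : R) (fun th => N (polar v r th))
   (- (r * sin th) * 'D_(e, (0 : R)) N (polar v r th) + r * cos th * 'D_((0 : V), (1 : R)) N (polar v r th)).
Proof.
move=> sN.
have dL : is_derive th (1 : R) (polar v r) (0 + (r *: - sin th) *: e, r *: cos th).
  apply: is_derive_pair.
  apply: (@is_deriveD _ _ _ (cst v)); apply: is_derive_scalel.
have := smooth_chain fVR sN dL.
suff -> : 'D_(0 + (r *: - sin th) *: e, r *: cos th) N (polar v r th) =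
 - (r * sin th) * 'D_(e, (0 : R)) N (polar v r th) + r * cos th * 'D_((0 : V), (1 : R)) N (polar v r th) by [].
rewrite (_ : (0 + _, _) = (r *: - sin th) *: (e, (0 : R)) + ((r * cos th) *: ((0 : V), (1 : R)))); last first.
  rewrite -[RHS]/((r *: - sin th) *: e + (r * cos th) *: 0, (r *: - sin th) * 0 + (r * cos th) * 1).
  by rewrite scaler0 mulr0 !add0r addr0 mulr1.
by rewrite smooth_derive_lin// smooth_deriveZ// -[r *: - sin th]/(r * - sin th) mulrN.
Qed.

End polar.

Section is_oint.
Variables (R : realType) (T : R).

(** Carrying the continuity of the integrand along makes it possible to collect linear
    combinations of integrals into one integral. *)
Definition is_oint (x : R) (h : R -> R) := continuous h /\ x = oint 0 T h.

Lemma is_ointD x y h g : is_oint x h -> is_oint y g -> is_oint (x + y) (fun s => h s + g s).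
Proof.
move=> [ch ->] [cg ->]; split; last by rewrite ointD.
by move=> s; apply: cvgD; [exact: ch|exact: cg].
Qed.

Lemma is_ointZ k x h : is_oint x h -> is_oint (k * x) (fun s => k * h s).
Proof.
move=> [ch ->]; split; last by rewrite ointZ.
by move=> s; apply: cvgMr; exact: ch.
Qed.

End is_oint.

Section polar_epd.
Variables (R : realType) (V : normedModType R).
Hypothesis fV : findim V.

Let fVR : findim (V * R)%type. Proof. exact: findim_prod fV (@findim_real R). Qed.

Lemma smooth_sinX (p : nat) : Csmooth (fun th : R => sin th ^+ p).
Proof. by apply: smoothX; exact: (smooth_sin_cos R).1. Qed.

(** The pointwise identity behind polar_epd.  Here s and c are the sine and cosine of the angle, w
    and w1 * c are s^p and its derivative, and a, b, yy, yr, rr are the partial derivatives of N.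
    The left-hand side is the derivative in the angle of w (s a - c b). *)
Lemma polar_alg (r s c w w1 pp P a b yy yr ry rr D : R) :
  c ^+ 2 + s ^+ 2 = 1 -> w1 * s = pp * w -> r * w * D = r * w * rr + w1 * b ->
  ry = yr -> P = 1 + pp ->
  w * (s * (- (r * s) * yy + r * c * yr) + a * c - (c * (- (r * s) * ry + r * c * rr) + b * (- s)))
   + (s * a - c * b) * (w1 * c) =
  - r * (w * (yy + D)) + (r * (w * c * c * yy + w * c * s * yr + (w * s * c * ry + w * s * s * rr))
   + P * (w * c * a + w * s * b)).
Proof.
move=> cs w1s HD -> ->; apply/eqP; rewrite -subr_eq0; apply/eqP.
have c2 : c ^+ 2 = 1 - s ^+ 2 by rewrite -cs addrK.
transitivity ((r * w * D - r * w * rr - w1 * b) + (w1 * s - pp * w) * (a * c + s * b)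
  + (1 - s ^+ 2 - c ^+ 2) * (w1 * b + r * w * yy + r * w * rr)); first by ring.
by rewrite HD w1s c2; ring.
Qed.

(** The Laplacian in polar coordinates.  If D plays the role of the part of the Laplacian
    transversal to e, so that r D = r N_rr + (p / sin th) N_r on weighting by sin^p, then the
    difference of the two sides is the integral over [0, T] of the derivative of
    sin^p th (sin th N_y - cos th N_r), whose boundary values agree. *)
Lemma polar_epd (e : V) (T : R) (p : nat) (N D : V * R -> R) v r :
  Csmooth N -> Csmooth D ->
  (forall th, r * sin th ^+ p * D (polar e v r th) =
     r * sin th ^+ p * 'D_(0, 1) ('D_(0, 1) N) (polar e v r th) +
     p%:R * sin th ^+ p.-1 * 'D_(0, 1) N (polar e v r th)) ->
  (sin T ^+ p.+1 * 'D_(e, 0) N (polar e v r T) - sin T ^+ p * cos T * 'D_(0, 1) N (polar e v r T) =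
   sin 0 ^+ p.+1 * 'D_(e, 0) N (polar e v r 0) - sin 0 ^+ p * cos 0 * 'D_(0, 1) N (polar e v r 0)) ->
  let A := polar_int e T (fun th => sin th ^+ p) N in
  r * 'D_(0, 1) ('D_(0, 1) A) (v, r) + p.+1%:R * 'D_(0, 1) A (v, r) =
  r * polar_int e T (fun th => sin th ^+ p) (fun q => 'D_(e, 0) ('D_(e, 0) N) q + D q) (v, r).
Proof.
move=> sN sD H bd A.
pose w (th : R) := sin th ^+ p.
have sw : Csmooth w := smooth_sinX p.
have swc : Csmooth (fun th => w th * cos th) := smoothM sw (smooth_sin_cos R).2.
have sws : Csmooth (fun th => w th * sin th) := smoothM sw (smooth_sin_cos R).1.
have sNy := smooth_D (e, (0 : R)) sN; have sNr := smooth_D ((0 : V), (1 : R)) sN.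
set Ny := 'D_(e, (0 : R)) N in sNy *; set Nr := 'D_((0 : V), (1 : R)) N in sNr H bd *.
have sNyy := smooth_D (e, (0 : R)) sNy; have sNyr := smooth_D ((0 : V), (1 : R)) sNy.
have sNrr := smooth_D ((0 : V), (1 : R)) sNr.
set Nyy := 'D_(e, (0 : R)) Ny in sNyy *; set Nyr := 'D_((0 : V), (1 : R)) Ny in sNyr *.
set Nrr := 'D_((0 : V), (1 : R)) Nr in sNrr H *.
have sNry := smooth_D (e, (0 : R)) sNr.
set Nry := 'D_(e, (0 : R)) Nr in sNry *.
have NryE q : Nry q = Nyr q by exact: schwarz.
have dA : 'D_((0 : V), (1 : R)) A = fun q => polar_int e T (fun th => w th * cos th) Ny q +
    polar_int e T (fun th => w th * sin th) Nr q by exact: polar_int_dr.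
have dA1 : 'D_((0 : V), (1 : R)) (polar_int e T (fun th => w th * cos th) Ny) = fun q =>
    polar_int e T (fun th => w th * cos th * cos th) Nyy q +
    polar_int e T (fun th => w th * cos th * sin th) Nyr q by exact: polar_int_dr.
have dA2 : 'D_((0 : V), (1 : R)) (polar_int e T (fun th => w th * sin th) Nr) = fun q =>
    polar_int e T (fun th => w th * sin th * cos th) Nry q +
    polar_int e T (fun th => w th * sin th * sin th) Nrr q.
  exact: polar_int_dr.
have sswc := smooth_polar_int fV e T swc sNy.
have ssws := smooth_polar_int fV e T sws sNr.
have ddA : 'D_((0 : V), (1 : R)) ('D_((0 : V), (1 : R)) A) (v, r) =
    (polar_int e T (fun th => w th * cos th * cos th) Nyy (v, r) +
    polar_int e T (fun th => w th * cos th * sin th) Nyr (v, r)) +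
    (polar_int e T (fun th => w th * sin th * cos th) Nry (v, r) +
    polar_int e T (fun th => w th * sin th * sin th) Nrr (v, r)).
  transitivity ('D_((0 : V), (1 : R)) (polar_int e T (fun th => w th * cos th) Ny +
     polar_int e T (fun th => w th * sin th) Nr) (v, r)).
    exact (congr1 (fun f => derive f (v, r) ((0 : V), (1 : R))) dA).
  transitivity ('D_((0 : V), (1 : R)) (polar_int e T (fun th => w th * cos th) Ny) (v, r) +
     'D_((0 : V), (1 : R)) (polar_int e T (fun th => w th * sin th) Nr) (v, r)).
    exact (deriveD (smooth_derivable sswc) (smooth_derivable ssws)).
  exact (congr2 +%R (congr1 (fun f => f (v, r)) dA1) (congr1 (fun f => f (v, r)) dA2)).
have I1 w0 N0 : Csmooth w0 -> Csmooth N0 ->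
    is_oint T (polar_int e T w0 N0 (v, r)) (fun th => w0 th * N0 (polar e v r th)).
  by move=> sw0 sN0; split=> //; exact: continuous_polar.
have J1 := I1 _ _ (smoothM swc (smooth_sin_cos R).2) sNyy.
have J2 := I1 _ _ (smoothM swc (smooth_sin_cos R).1) sNyr.
have J3 := I1 _ _ (smoothM sws (smooth_sin_cos R).2) sNry.
have J4 := I1 _ _ (smoothM sws (smooth_sin_cos R).1) sNrr.
have J5 := I1 _ _ swc sNy.
have J6 := I1 _ _ sws sNr.
have J7 := I1 _ _ sw (smoothD sNyy sD).
have := is_ointD (is_ointZ r (is_ointD (is_ointD J1 J2) (is_ointD J3 J4))) (is_ointZ p.+1%:R (is_ointD J5 J6)).
move=> /(is_ointD (is_ointZ (- r) J7)).
pose K (s : R) := let q := polar e v r s in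
   - r * (w s * (Nyy q + D q)) +
     (r * (w s * cos s * cos s * Nyy q + w s * cos s * sin s * Nyr q +
       (w s * sin s * cos s * Nry q + w s * sin s * sin s * Nrr q)) +
      p.+1%:R * (w s * cos s * Ny q + w s * sin s * Nr q)).
rewrite -/K => -[cK EK].
pose w1 (th : R) := p%:R * sin th ^+ p.-1.
have dw th : is_derive th (1 : R) w (w1 th * cos th).
  rewrite /w /w1; have := is_derive_sin th => ds.
  rewrite (_ : (fun th => _) = (@sin R) ^+ p); last by apply/funext => t; rewrite exprfctE.
  exact: (is_deriveX p ds).
have dyy th := polar_dth fV e v r th sNy.
have drr th := polar_dth fV e v r th sNr.
(* The total derivative in the angle; its derivative K is the combined integrand. *)
pose Phi (th : R) := w th * (sin th * Ny (polar e v r th) - cos th * Nr (polar e v r th)).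
have dPhi th : is_derive th (1 : R) Phi (K th).
  have E := is_deriveM (dw th) (is_deriveB (is_deriveM (is_derive_sin th) (dyy th))
     (is_deriveM (is_derive_cos th) (drr th))).
  apply: is_derive_eq.
  have w1s : w1 th * sin th = p%:R * w th.
    by rewrite /w1 /w; case: (p) => [|p']; rewrite ?mul0r// -mulrA -exprSr.
  exact (@polar_alg r _ _ _ _ _ _ (Ny (polar e v r th)) _ (Nyy (polar e v r th)) _ _ _ _ (cos2Dsin2 th) w1s (H th) (NryE (polar e v r th)) (esym (nat1r p))).
move: EK; rewrite (oint_FTC2 0 T cK dPhi).
have -> : Phi T - Phi 0 = 0.
  by apply/eqP; rewrite subr_eq0; apply/eqP; rewrite /Phi /w !mulrBr !mulrA -!exprSr.
rewrite mulNr addrC => /eqP; rewrite subr_eq0 => /eqP EK.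
have dAv : 'D_((0 : V), (1 : R)) A (v, r) =
    polar_int e T (fun th => w th * cos th) Ny (v, r) +
    polar_int e T (fun th => w th * sin th) Nr (v, r).
  exact (congr1 (fun f => f (v, r)) dA).
by rewrite ddA dAv.
Qed.

End polar_epd.

(** * Integrals over spheres *)

Section sphere.
Variables (R : realType) (V : normedModType R).
Hypothesis fV : findim V.
Implicit Types (e : nat -> V) (g : V -> R).

Let fVR : findim (V * R)%type. Proof. exact: findim_prod fV (@findim_real R). Qed.

Definition Lap e n g : V -> R := fun x => \sum_(i < n) 'D_(e i) ('D_(e i) g) x.

Lemma smooth_Lap e n g : Csmooth g -> Csmooth (Lap e n g).
Proof. by move=> sg; apply: smooth_sum => i _; do 2!apply: smooth_D. Qed.

(** The degenerate sphere of dimension 0, parametrized by a signed radius. *)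
Definition pencil (u : V) g (p : V * R) : R := g (p.1 + p.2 *: u).

Lemma smooth_pencil u g : Csmooth g -> Csmooth (pencil u g).
Proof.
move=> sg; apply: (smooth_comp fV sg); apply: smooth_mapD; first by apply: smooth_map_fst; exact: smooth_map_id.
by apply: smooth_mapZl; apply: smooth_of_map; apply: smooth_map_snd; exact: smooth_map_id.
Qed.

Lemma pencil_derive u g w c : Csmooth g ->
  'D_(w, c) (pencil u g) = pencil u (fun x => 'D_w g x + c * 'D_u g x).
Proof.
move=> sg; apply/funext => -[v r].
have dL : is_derive (v, r) (w, c) (fun p : V * R => p.1 + p.2 *: u) (w + c *: u).
  apply: (is_derive_linmap (L := fun p : V * R => p.1 + p.2 *: u)) => h /=.
  by rewrite scalerDr scalerA addrACA -scalerDl.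
have [_ ->] := smooth_chain fV sg dL.
by rewrite smooth_deriveD// smooth_deriveZ.
Qed.

Lemma pencil_dx u w g : Csmooth g ->
  'D_(w, (0 : R)) (pencil u g) = pencil u ('D_w g).
Proof.
move=> sg; rewrite pencil_derive//; congr pencil.
by apply/funext => x; rewrite mul0r addr0.
Qed.

Lemma pencil_dr u g : Csmooth g ->
  'D_((0 : V), (1 : R)) (pencil u g) = pencil u ('D_u g).
Proof.
move=> sg; rewrite pencil_derive//; congr pencil.
by apply/funext => x; rewrite derive0 add0r mul1r.
Qed.

(** The integral of x |-> g (v + r x) over the unit sphere of dimension d + 1 in the span of
    e 0, ..., e (d + 1).  Each angle sweeps half-circles over spheres of one dimension less,
    except for the innermost one, which sweeps the full circle. *)
Fixpoint sphere_int (d : nat) (e : nat -> V) (g : V -> R) : V * R -> R :=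
  polar_int (e 0%N) (if d is 0 then 2 * pi else pi) (fun th => sin th ^+ d)
    (if d is d'.+1 then sphere_int d' (fun i => e i.+1) g else pencil (e 1%N) g).

Lemma smooth_sphere_int d e g : Csmooth g -> Csmooth (sphere_int d e g).
Proof.
move=> sg; elim: d e => [|d IH] e /=; apply: smooth_polar_int => //.
- exact: smooth_sinX.
- exact: smooth_pencil.
- exact: smooth_sinX.
Qed.

Lemma polar_intD (e : V) T w (N M : V * R -> R) p : Csmooth w -> Csmooth N -> Csmooth M ->
  polar_int e T w (fun q => N q + M q) p = polar_int e T w N p + polar_int e T w M p.
Proof.
move=> sw sN sM; rewrite /polar_int -ointD; try exact: continuous_polar.
by apply: oint_eq => th; rewrite mulrDr.
Qed.

Lemma sphere_int_D d e g h : Csmooth g -> Csmooth h ->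
  sphere_int d e (fun x => g x + h x) = fun p => sphere_int d e g p + sphere_int d e h p.
Proof.
move=> sg sh; elim: d e => [|d IH] e.
  apply/funext => p; rewrite /= -polar_intD//; try exact: smooth_pencil.
  exact: smooth_sinX.
apply/funext => p /=; rewrite IH -polar_intD//; try exact: smooth_sphere_int.
exact: smooth_sinX.
Qed.

Lemma sphere_int_0 d e : sphere_int d e (fun=> 0) = fun=> 0.
Proof.
have P0 (u : V) T w : polar_int u T w (fun=> 0) = fun=> 0.
  apply/funext => p; rewrite /polar_int (oint_eq _ _ (g := fun=> 0 * 0)).
    rewrite (@ointZ R 0 (fun=> 0)) ?mul0r//; exact: cst_continuous.
  by move=> th; rewrite mulr0 mul0r.
by elim: d e => [|d IH] e /=; rewrite ?IH; exact: P0.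
Qed.

Lemma sphere_int_sum d e n (G : 'I_n -> V -> R) : (forall i, Csmooth (G i)) ->
  sphere_int d e (fun x => \sum_(i < n) G i x) = fun p => \sum_(i < n) sphere_int d e (G i) p.
Proof.
move=> sG; elim: n G sG => [|n IH] G sG.
  rewrite (_ : (fun x => _) = fun=> 0); last by apply/funext => x; rewrite big_ord0.
  by rewrite sphere_int_0; apply/funext => p; rewrite big_ord0.
rewrite (_ : (fun x => _) = fun x => G ord0 x + \sum_(i < n) G (lift ord0 i) x); last first.
  by apply/funext => x; rewrite big_ord_recl.
rewrite sphere_int_D//; last exact: smooth_sum.
by rewrite IH//; apply/funext => p; rewrite big_ord_recl.
Qed.

Lemma sphere_int_dx d e g u : Csmooth g -> 'D_(u, (0 : R)) (sphere_int d e g) = sphere_int d e ('D_u g).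
Proof.
move=> sg; elim: d e => [|d IH] e.
  etransitivity.
    apply: polar_int_dx => //; [exact: smooth_sinX|exact: smooth_pencil].
  by congr (polar_int _ _ _ _); exact: pencil_dx.
etransitivity.
  apply: polar_int_dx => //; [exact: smooth_sinX|exact: smooth_sphere_int].
by congr (polar_int _ _ _ _); exact: IH.
Qed.

Lemma Lap2 e g : Lap e 2 g = fun x => 'D_(e 0%N) ('D_(e 0%N) g) x + 'D_(e 1%N) ('D_(e 1%N) g) x.
Proof. by apply/funext => x; rewrite /Lap big_ord_recl big_ord1. Qed.

Lemma polar_alg0 (r w w' a b c : R) : a = b -> r * w * a = r * w * b + 0%:R * w' * c.
Proof. by move=> ->; rewrite !mul0r addr0. Qed.

(** The transversal part of the Laplacian is controlled by the equation for the spheres of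
    one dimension less; on the innermost circle it is a plain second derivative. *)
Lemma sphere_int_epd d e g v r : Csmooth g ->
  r * 'D_(0, 1) ('D_(0, 1) (sphere_int d e g)) (v, r) + d.+1%:R * 'D_(0, 1) (sphere_int d e g) (v, r) =
  r * sphere_int d e (Lap e d.+2 g) (v, r).
Proof.
elim: d e g v r => [|d IH] e g v r sg.
  have sP := smooth_pencil (e 1%N) sg.
  have sPr := pencil_dr (e 1%N) sg.
  have sPrr := pencil_dr (e 1%N) (smooth_D (e 1%N) sg).
  have sPy := pencil_dx (e 1%N) (e 0%N) sg.
  have sPyy := pencil_dx (e 1%N) (e 0%N) (smooth_D (e 0%N) sg).
  have HD q : pencil (e 1%N) ('D_(e 1%N) ('D_(e 1%N) g)) q = 'D_(0, 1) ('D_(0, 1) (pencil (e 1%N) g)) q.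
    transitivity ('D_(0, 1) (pencil (e 1%N) ('D_(e 1%N) g)) q).
      exact (esym (congr1 (fun f => f q) sPrr)).
    exact (esym (congr1 (fun f => derive f q (0, 1)) sPr)).
  have HX : (fun q => 'D_(e 0%N, 0) ('D_(e 0%N, 0) (pencil (e 1%N) g)) q +
      pencil (e 1%N) ('D_(e 1%N) ('D_(e 1%N) g)) q) = pencil (e 1%N) (Lap e 2 g).
    apply/funext => q.
    transitivity (pencil (e 1%N) ('D_(e 0%N) ('D_(e 0%N) g)) q +
      pencil (e 1%N) ('D_(e 1%N) ('D_(e 1%N) g)) q); last first.
      by rewrite Lap2.
    have -> // : 'D_(e 0%N, 0) ('D_(e 0%N, 0) (pencil (e 1%N) g)) q =
      pencil (e 1%N) ('D_(e 0%N) ('D_(e 0%N) g)) q.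
    transitivity ('D_(e 0%N, 0) (pencil (e 1%N) ('D_(e 0%N) g)) q).
      exact (congr1 (fun f => derive f q (e 0%N, 0)) sPy).
    exact (congr1 (fun f => f q) sPyy).
  have E := polar_epd fV (e := e 0%N) (T := 2 * pi) (p := 0) (v := v) (r := r) sP
    (smooth_pencil (e 1%N) (smooth_D (e 1%N) (smooth_D (e 1%N) sg))).
  etransitivity; first apply: E.
  - by move=> th; exact (polar_alg0 _ _ _ _ (HD _)).
  - by rewrite /polar mulr_natl cos2pi sin2pi sin0 cos0.
  exact (congr1 (fun N => r * polar_int (e 0%N) (2 * pi) (fun th => sin th ^+ 0) N (v, r)) HX).
have sN := smooth_sphere_int d (fun i => e i.+1) sg.
have E := polar_epd fV (e := e 0%N) (T := pi) (p := d.+1) (v := v) (r := r) sN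
    (smooth_sphere_int d (fun i => e i.+1) (smooth_Lap (fun i => e i.+1) d.+2 sg)).
etransitivity; first apply: E.
- move=> th.
  have := IH (fun i => e i.+1) g (v + (r * cos th) *: e 0%N) (r * sin th) sg.
  rewrite -/(polar (e 0%N) v r th) exprS /=.
  move: (sphere_int _ _ _ _) (derive _ _ _) (derive _ _ _) (sin th) => D a b s0 H.
  transitivity (s0 ^+ d * (r * s0 * D)); first by ring.
  by rewrite -H; ring.
- by rewrite sinpi sin0 !expr0n /= !mul0r.
(* The second derivative along the first axis joins the transversal Laplacian. *)
have HL : Lap e d.+3 g = fun x => 'D_(e 0%N) ('D_(e 0%N) g) x + Lap (fun i => e i.+1) d.+2 g x.
  by apply/funext => x; rewrite /Lap big_ord_recl.
have HS := sphere_int_D d (fun i => e i.+1) (smooth_D (e 0%N) (smooth_D (e 0%N) sg)) (smooth_Lap (fun i => e i.+1) d.+2 sg).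
have e1 := sphere_int_dx d (fun i => e i.+1) (e 0%N) sg.
have e2 := sphere_int_dx d (fun i => e i.+1) (e 0%N) (smooth_D (e 0%N) sg).
have HX : (fun q => 'D_(e 0%N, 0) ('D_(e 0%N, 0) (sphere_int d (fun i => e i.+1) g)) q +
      sphere_int d (fun i => e i.+1) (Lap (fun i => e i.+1) d.+2 g) q) =
   sphere_int d (fun i => e i.+1) (Lap e d.+3 g).
  rewrite HL; etransitivity; last exact (esym HS).
  apply/funext => q.
  have -> // : 'D_(e 0%N, 0) ('D_(e 0%N, 0) (sphere_int d (fun i => e i.+1) g)) q =
    sphere_int d (fun i => e i.+1) ('D_(e 0%N) ('D_(e 0%N) g)) q.
  transitivity ('D_(e 0%N, (0 : R)) (sphere_int d (fun i => e i.+1) ('D_(e 0%N) g)) q).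
    exact (congr1 (fun f => derive f q (e 0%N, (0 : R))) e1).
  exact (congr1 (fun f => f q) e2).
exact (congr1 (fun N => r * polar_int (e 0%N) pi (fun th => sin th ^+ d.+1) N (v, r)) HX).
Qed.

End sphere.

Section even_area.
Variables (R : realType).

(** The reflection of the angle that changes the sign of its cosine. *)
Lemma oint_reflect (K : R -> R) T : continuous K ->
  oint 0 T (fun th => K (T - th)) = oint 0 T K.
Proof.
move=> cK; have [H dH ->] := oint_primitive cK.
have cK' : continuous (fun th => K (T - th)).
  move=> s; apply: (@continuous_comp _ _ _ (fun th : R => T - th) K); last exact: cK.
  by apply: (@cvgB _ _ _ _ _ (cst T)); [exact: cvg_cst|exact: cvg_id].
have D (s : R) : is_derive s (1 : R) (fun th => - H (T - th)) (K (T - s)).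
  have A : is_derive s (1 : R) (cst T - id) (0 - 1) by exact: is_deriveB.
  have := is_deriveN (@is_derive1_comp R H (cst T - id) s _ _ (dH (T - s)) A).
  by rewrite sub0r mulrN1 opprK.
by rewrite (oint_FTC2 0 T cK' D) subrr subr0 opprK addrC.
Qed.

Lemma oint_halfturn (K : R -> R) T : continuous K -> (forall th, K (th + 2 * T) = K th) ->
  oint 0 (2 * T) (fun th => K (th + T)) = oint 0 (2 * T) K.
Proof.
move=> cK pK; have [H dH ->] := oint_primitive cK.
have cK' : continuous (fun th => K (th + T)).
  move=> s; apply: (@continuous_comp _ _ _ (fun th : R => th + T) K); last exact: cK.
  by apply: (@cvgD _ _ _ _ _ id (cst T)); [exact: cvg_id|exact: cvg_cst].
have D t (s : R) : is_derive s (1 : R) (fun th => H (th + t)) (K (s + t)).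
  have A : is_derive s (1 : R) (id + cst t) (1 + 0) by exact: is_deriveD.
  have := @is_derive1_comp R H (id + cst t) s _ _ (dH (s + t)) A.
  by rewrite addr0 mulr1.
rewrite (oint_FTC2 0 (2 * T) cK' (D T)) add0r.
have dd s : is_derive s (1 : R) ((fun th => H (th + 2 * T)) - H) 0.
  have := is_deriveB (D (2 * T) s) (dH s); by rewrite pK subrr.
have := is_derive0_cst dd T 0; rewrite -![(_ - _ : R -> R) _]/(_ - _) add0r => E.
by rewrite [2 * T + T]addrC E.
Qed.

(** Integrates the derivative of sin^(p+1) cos over [0, pi]. *)
Lemma wallis p : p.+2%:R * oint 0 pi (fun th : R => sin th ^+ p.+2) =
  p.+1%:R * oint 0 pi (fun th : R => sin th ^+ p).
Proof.
have c1 q : continuous (fun th : R => sin th ^+ q) by apply: smooth_continuous; exact: smooth_sinX.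
have d1 q (th : R) : is_derive th (1 : R) (fun th : R => sin th ^+ q.+1) (q.+1%:R * sin th ^+ q * cos th).
  rewrite (_ : (fun th => _) = (@sin R) ^+ q.+1); last by apply/funext => t; rewrite exprfctE.
  exact: (is_deriveX q.+1 (is_derive_sin th)).
have [I1 I2] := (is_ointZ p.+1%:R (conj (c1 p) erefl) : is_oint pi _ _,
  is_ointZ (- p.+2%:R) (conj (c1 p.+2) erefl) : is_oint pi _ _).
have [cK EK] := is_ointD I1 I2.
have d2 (th : R) : is_derive th (1 : R) ((fun th : R => sin th ^+ p.+1) * cos)
    (p.+1%:R * sin th ^+ p + - p.+2%:R * sin th ^+ p.+2).
  have := is_deriveM (d1 p th) (is_derive_cos th).
  set A := (X in is_derive _ _ _ X); suff -> : A = p.+1%:R * sin th ^+ p + - p.+2%:R * sin th ^+ p.+2 by [].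
  rewrite {}/A -[_ *: _]/(_ * _) -[cos th *: _]/(_ * _).
  have -> : cos th * (p.+1%:R * sin th ^+ p * cos th) = p.+1%:R * sin th ^+ p * (1 - sin th ^+ 2).
    by rewrite -(cos2Dsin2 th); ring.
  by rewrite -[in RHS]natr1 !exprS; ring.
move: EK; rewrite (oint_FTC2 0 pi cK d2).
rewrite -![(_ * _ : R -> R) _]/(_ * _) sinpi sin0 !expr0n /= !mul0r subrr mulNr => /eqP.
by rewrite subr_eq0 => /eqP.
Qed.

Lemma oint_cst (T c : R) : oint 0 T (fun=> c) = T * c.
Proof.
have D (x : R) : is_derive x (1 : R) (c \*: id) c.
  by have := is_deriveZ c (is_derive_id x (1 : R)); rewrite [_ *: _]mulr1.
by rewrite (oint_FTC2 0 T (@cst_continuous _ _ c) D) /= [c *: T]mulrC [c *: 0]mulr0 subr0.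
Qed.

Lemma wallis0 : oint 0 pi (fun th : R => sin th ^+ 0) = pi.
Proof.
rewrite (oint_eq 0 pi (g := fun=> 1))//.
by rewrite (@oint_FTC2 _ _ id) ?subr0//; exact: cst_continuous.
Qed.

Lemma wallis1 : oint 0 pi (fun th : R => sin th ^+ 1) = 2.
Proof.
have D (x : R) : is_derive x (1 : R) (- cos) (sin x ^+ 1).
  by have := is_deriveN (is_derive_cos x); rewrite opprK.
have c1 : continuous (fun th : R => sin th ^+ 1) by apply: smooth_continuous; exact: smooth_sinX.
by rewrite (oint_FTC2 0 pi c1 D) -![(- cos) _]/(- cos _) cospi cos0; ring.
Qed.

(** The area of the unit sphere of dimension d + 1. *)
Fixpoint area (d : nat) : R :=
  if d is d'.+1 then area d' * oint 0 pi (fun th : R => sin th ^+ d) else 2 * pi.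

(** The quantity on the left does not change when p is replaced by p + 1, by the Wallis
    recurrence. *)
Lemma wallis_prod p : p.+1%:R * (oint 0 pi (fun th : R => sin th ^+ p) * oint 0 pi (fun th : R => sin th ^+ p.+1))
  = 2 * pi.
Proof.
elim: p => [|p IH]; last first.
  by rewrite mulrCA wallis mulrCA [X in _ * X]mulrC IH.
by rewrite mul1r wallis0 wallis1 mulrC.
Qed.

Lemma areaSS d : d.+2%:R * area d.+2 = 2 * pi * area d.
Proof. by rewrite /= -mulrA mulrCA wallis_prod mulrC. Qed.

Lemma area_odd nu : area (2 * nu).+1 * \prod_(0 <= k < nu.+1) (2 * k + 1)%:R = 2 * (2 * pi) ^+ nu.+1.
Proof.
elim: nu => [|nu IH].
  rewrite big_nat1 mulr1 expr1 /=.
  by rewrite (wallis1 : oint 0 pi (fun th : R => sin th ^+ 1) = 2) mulrC.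
rewrite big_nat_recr// exprS [RHS]mulrCA -IH.
rewrite (_ : (2 * nu.+1).+1 = (2 * nu).+1.+2); last by rewrite mulnS.
rewrite (_ : (2 * nu.+1 + 1)%N = (2 * nu).+1.+2); last by rewrite mulnS addn1.
have alg (X P k c Y : R) : k * X = c * Y -> X * (P * k) = c * (Y * P).
  by move=> E; rewrite mulrCA [X * k]mulrC E mulrC mulrA.
exact (alg _ _ _ _ _ (areaSS (2 * nu).+1)).
Qed.

Variable (V : normedModType R).
Hypothesis fV : findim V.

(** The antipodal map preserves the sphere: in angles, the half-turn of the innermost one and
    the reflection of the others. *)
Lemma sphere_int_even d e (g : V -> R) v r : Csmooth g -> sphere_int d e g (v, - r) = sphere_int d e g (v, r).
Proof.
move=> sg; elim: d e v r => [|d IH] e v r.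
  have cK := @continuous_polar R V fV (e 0%N) _ _ v r (smooth_sinX R 0) (smooth_pencil fV (e 1%N) sg).
  rewrite /= /polar_int /= -(oint_halfturn cK).
    apply: oint_eq => th; congr (_ * _); congr (pencil _ _ _).
    by rewrite /polar sinDpi cosDpi !mulrN !mulNr.
  by move=> th; congr (_ * _); rewrite /polar mulr_natl sinD2pi cosD2pi.
have cK := @continuous_polar R V fV (e 0%N) _ _ v r (smooth_sinX R d.+1) (smooth_sphere_int fV d (fun i => e i.+1) sg).
rewrite /= /polar_int -(oint_reflect pi cK).
apply: oint_eq => th; rewrite /polar.
have -> : sin (pi - th) = sin th by rewrite sinB sinpi cospi; ring.
have -> : cos (pi - th) = - cos th by rewrite cosB sinpi cospi; ring.
by rewrite /= !mulNr IH mulrN.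
Qed.

Lemma sphere_int_center d e (g : V -> R) v : Csmooth g -> sphere_int d e g (v, 0) = area d * g v.
Proof.
move=> sg; elim: d e v => [|d IH] e v.
  rewrite /= /polar_int (oint_eq _ _ (g := fun=> g v)).
    exact: oint_cst.
  by move=> th; rewrite /polar /pencil !mul0r !scale0r !addr0 expr0 mul1r.
rewrite /= /polar_int mulrAC -ointZ; last by apply: smooth_continuous; exact: smooth_sinX.
by apply: oint_eq => th; rewrite /polar !mul0r scale0r addr0 IH mulrC.
Qed.

End even_area.

(** * Hyperspherical coordinates *)

Section coords.
Variable R : realType.
Implicit Types (t : nat -> R).

(** The factor contributed by the q-th angle y to the i-th hyperspherical coordinate. *)
Definition coord_factor (i q : nat) (y : R) : R := if (q < i)%N then sin y else if q == i then cos y else 1.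
Definition dcoord_factor (i q : nat) (y : R) : R := if (q < i)%N then cos y else if q == i then - sin y else 0.
Definition sphere_coord m t i : R := \prod_(q < m) coord_factor i q (t q).
(** The partial derivative of the i-th coordinate in the k-th angle. *)
Definition dsphere_coord m k t i : R := \prod_(q < m) (if q == k :> nat then dcoord_factor i q (t q) else coord_factor i q (t q)).
Definition tail_angles t k := t k.+1.

Lemma sphere_coord_0 m t : sphere_coord m.+1 t 0 = cos (t 0%N).
Proof. by rewrite /sphere_coord big_ord_recl big1 ?mulr1. Qed.
Lemma sphere_coord_S m t i : sphere_coord m.+1 t i.+1 = sin (t 0%N) * sphere_coord m (tail_angles t) i.
Proof. by rewrite /sphere_coord big_ord_recl. Qed.
Lemma dsphere_coord0_0 m t : dsphere_coord m.+1 0 t 0 = - sin (t 0%N).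
Proof. by rewrite /dsphere_coord big_ord_recl big1 ?mulr1. Qed.
Lemma dsphere_coord0_S m t i : dsphere_coord m.+1 0 t i.+1 = cos (t 0%N) * sphere_coord m (tail_angles t) i.
Proof. by rewrite /dsphere_coord big_ord_recl. Qed.
Lemma dsphere_coordS_0 m k t : (k < m)%N -> dsphere_coord m.+1 k.+1 t 0 = 0.
Proof.
by move=> km; rewrite /dsphere_coord big_ord_recl (bigD1 (Ordinal km))//= eqxx mul0r mulr0.
Qed.
Lemma dsphere_coordS_S m k t i : dsphere_coord m.+1 k.+1 t i.+1 = sin (t 0%N) * dsphere_coord m k (tail_angles t) i.
Proof. by rewrite /dsphere_coord big_ord_recl. Qed.

Lemma sphere_coord_norm m t : \sum_(i < m.+1) sphere_coord m t i * sphere_coord m t i = 1.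
Proof.
elim: m t => [|m IH] t; first by rewrite big_ord1 /sphere_coord big_ord0 mulr1.
rewrite big_ord_recl sphere_coord_0 (eq_bigr (fun i : 'I_m.+1 => sin (t 0%N) ^+ 2 * (sphere_coord m (tail_angles t) i * sphere_coord m (tail_angles t) i))).
  by rewrite -mulr_sumr IH mulr1 -expr2 cos2Dsin2.
by move=> i _; rewrite sphere_coord_S; ring.
Qed.

Lemma sphere_coord_normal m k t : (k < m)%N -> \sum_(i < m.+1) sphere_coord m t i * dsphere_coord m k t i = 0.
Proof.
elim: m k t => [//|m IH] [|k] t km; rewrite big_ord_recl sphere_coord_0.
  rewrite dsphere_coord0_0 (eq_bigr (fun i : 'I_m.+1 => sin (t 0%N) * cos (t 0%N) * (sphere_coord m (tail_angles t) i * sphere_coord m (tail_angles t) i))).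
    by rewrite -mulr_sumr sphere_coord_norm; ring.
  by move=> i _; rewrite sphere_coord_S dsphere_coord0_S; ring.
rewrite dsphere_coordS_0// mulr0 add0r (eq_bigr (fun i : 'I_m.+1 => sin (t 0%N) ^+ 2 * (sphere_coord m (tail_angles t) i * dsphere_coord m k (tail_angles t) i))).
  by rewrite -mulr_sumr IH// mulr0.
by move=> i _; rewrite sphere_coord_S dsphere_coordS_S; ring.
Qed.

(** The coordinate directions are orthogonal: splitting off the first angle, the new tangent
    vector is (- sin, cos u) with u on the smaller sphere, and the others are (0, sin v_k) with
    v_k tangent to the smaller sphere, hence orthogonal to u. *)
Lemma dsphere_coord_gram m k l t : (k < m)%N -> (l < m)%N ->
  \sum_(i < m.+1) dsphere_coord m k t i * dsphere_coord m l t i = (\prod_(q < k) sin (t q) ^+ 2) *+ (k == l).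
Proof.
elim: m k l t => [//|m IH] [|k] [|l] t km lm; rewrite [LHS]big_ord_recl.
- rewrite dsphere_coord0_0 (eq_bigr (fun i : 'I_m.+1 => cos (t 0%N) ^+ 2 * (sphere_coord m (tail_angles t) i * sphere_coord m (tail_angles t) i))).
    by rewrite -mulr_sumr sphere_coord_norm big_ord0 mulr1 mulrNN -expr2 addrC cos2Dsin2.
  by move=> i _; rewrite dsphere_coord0_S; ring.
- rewrite dsphere_coordS_0// mulr0 add0r (eq_bigr (fun i : 'I_m.+1 => cos (t 0%N) * sin (t 0%N) * (sphere_coord m (tail_angles t) i * dsphere_coord m l (tail_angles t) i))).
    by rewrite -mulr_sumr sphere_coord_normal// mulr0.
  by move=> i _; rewrite dsphere_coordS_S dsphere_coord0_S; ring.
- rewrite dsphere_coordS_0// mul0r add0r (eq_bigr (fun i : 'I_m.+1 => cos (t 0%N) * sin (t 0%N) * (sphere_coord m (tail_angles t) i * dsphere_coord m k (tail_angles t) i))).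
    by rewrite -mulr_sumr sphere_coord_normal// mulr0.
  by move=> i _; rewrite dsphere_coordS_S dsphere_coord0_S; ring.
- rewrite dsphere_coordS_0// mul0r add0r (eq_bigr (fun i : 'I_m.+1 => sin (t 0%N) ^+ 2 * (dsphere_coord m k (tail_angles t) i * dsphere_coord m l (tail_angles t) i))).
    by rewrite -mulr_sumr IH// big_ord_recl eqSS mulrnAr.
  by move=> i _; rewrite !dsphere_coordS_S; ring.
Qed.

(** The density of the surface measure of the unit sphere.  The absolute values make it
    agree with the square root of the Gram determinant for all angles. *)
Definition gram_weight m t : R := \prod_(k < m) \prod_(q < k) `|sin (t q)|.

Lemma gram_weightS m t : gram_weight m.+1 t = `|sin (t 0%N)| ^+ m * gram_weight m (tail_angles t).
Proof.
rewrite /gram_weight big_ord_recl big_ord0 mul1r.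
under eq_bigr do rewrite big_ord_recl.
by rewrite big_split /= big_const_ord iter_mulr_1.
Qed.

Definition angles m (th : 'rV[R]_m) (k : nat) : R := if insub k is Some j then th 0 j else 0.

Lemma anglesE m (th : 'rV[R]_m) (k : 'I_m) : angles th k = th 0 k.
Proof. by rewrite /angles valK. Qed.

Lemma angles_row0 m (s : R) (th : 'rV[R]_m) : angles (row_mx (s%:M : 'rV[R]_1) th) 0 = s.
Proof.
have := anglesE (row_mx (s%:M : 'rV[R]_1) th) (lshift m ord0).
by rewrite row_mxEl !mxE eqxx mulr1n.
Qed.

Lemma angles_rowS m (s : R) (th : 'rV[R]_m) : tail_angles (angles (row_mx (s%:M : 'rV[R]_1) th)) = angles th.
Proof.
apply/funext => k; rewrite /tail_angles; case: (ltnP k m) => km.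
  have := anglesE (row_mx (s%:M : 'rV[R]_1) th) (rshift 1 (Ordinal km)).
  by rewrite row_mxEr -(anglesE th (Ordinal km)).
by rewrite /angles !insubF// ltnNge ?add1n ?ltnS km.
Qed.

Lemma sphere_paramE m r (th : 'rV[R]_m) (i : 'I_m.+1) :
  @sphere_param R m.+1 r th 0 i = r * sphere_coord m (angles th) i.
Proof.
rewrite mxE; congr (_ * _); apply: eq_bigr => k _; rewrite anglesE /coord_factor.
by [].
Qed.

Lemma is_derive_coord_factor i q (y : R) : is_derive y (1 : R) (coord_factor i q) (dcoord_factor i q y).
Proof.
rewrite /coord_factor /dcoord_factor; case: (_ < _)%N; first exact: is_derive_sin.
by case: (_ == _); [exact: is_derive_cos|exact: is_derive_cst].
Qed.

(** Along the k-th axis only the k-th factor of the product varies. *)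
Lemma sphere_param_derive m r (th : 'rV[R]_m) (k : 'I_m) (i : 'I_m.+1) :
  'D_(delta_mx 0 k) (fun th => @sphere_param R m.+1 r th 0 i) th = r * dsphere_coord m k (angles th) i.
Proof.
rewrite (derive_line (fun th => @sphere_param R m.+1 r th 0 i)).
pose c := r * \prod_(q < m | q != k) coord_factor i q (th 0 q).
have -> : (fun h : R => @sphere_param R m.+1 r (h *: delta_mx 0 k + th) 0 i) =
   c \*: (coord_factor i k \o (id + cst (th 0 k))).
  apply/funext => h; rewrite sphere_paramE /sphere_coord (bigD1 k)//= anglesE !mxE !eqxx mulr1.
  rewrite (eq_bigr (fun q : 'I_m => coord_factor i q (th 0 q))); last first.
    move=> q qk; congr coord_factor; rewrite anglesE !mxE eqxx (negbTE qk) mulr0 add0r//.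
  rewrite mulrCA mulrC /c -[RHS]/(_ * _); congr (_ * _).
have A : is_derive (0 : R) (1 : R) (id + cst (th 0 k)) (1 + 0) by exact: is_deriveD.
have [_ ->] := is_deriveZ c (is_derive1_comp (is_derive_coord_factor i k ((id + cst (th 0 k)) 0)) A).
rewrite -[_ *: _]/(_ * _) addr0 mulr1 -![(id + _) 0]/(0 + th 0 k) add0r.
rewrite /dsphere_coord (bigD1 k)//= eqxx anglesE /c -mulrA; congr (_ * _); rewrite mulrC; congr (_ * _).
by apply: eq_bigr => q qk; rewrite anglesE ifN.
Qed.

Lemma smooth_sphere_param m r (i : 'I_m.+1) : Csmooth (fun th : 'rV[R]_m => @sphere_param R m.+1 r th 0 i).
Proof.
rewrite (_ : (fun th => _) = fun th : 'rV[R]_m => r * \prod_(q < m) coord_factor i q (th 0 q)); last first.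
  by apply/funext => th; rewrite sphere_paramE /sphere_coord; under eq_bigr do rewrite anglesE.
apply: smoothZ.
have sF (q : 'I_m) : Csmooth (fun th : 'rV[R]_m => coord_factor i q (th 0 q)).
  have sq : Csmooth (fun th : 'rV[R]_m => th 0 q).
    by apply: smooth_linform; split=> [a u v|]; [rewrite !mxE|exact: coord_continuous].
  rewrite /coord_factor; case: (_ < _)%N; first exact: smooth_sin.
  by case: (_ == _); [exact: smooth_cos|exact: smooth_cst].
elim: (index_enum _) => [|q s IH].
  by rewrite (_ : (fun th => _) = fun=> 1); [exact: smooth_cst|apply/funext => th; rewrite big_nil].
rewrite (_ : (fun th => _) = fun th : 'rV[R]_m => coord_factor i q (th 0 q) * \prod_(q <- s) coord_factor i q (th 0 q)).
  exact: smoothM.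
by apply/funext => th; rewrite big_cons.
Qed.

Lemma sphere_param_diff m r (th : 'rV[R]_m) : differentiable (@sphere_param R m.+1 r) th.
Proof.
have -> : @sphere_param R m.+1 r = \sum_(i < m.+1) (fun th : 'rV[R]_m => @sphere_param R m.+1 r th 0 i *: delta_mx 0 i).
  by apply/funext => y; rewrite fct_sumE {1}[sphere_param _ _]row_sum_delta.
apply: differentiable_sum => i; apply: differentiableZl.
by apply: C1_diff; [exact: findim_rV|exact: smooth_sphere_param].
Qed.

(** The Gram matrix is diagonal with entries the squares of r prod_(q < k) sin th_q. *)
Lemma gram_det m r (th : 'rV[R]_m) : 0 <= r ->
  let J := jacobian (@sphere_param R m.+1 r) th in
  Num.sqrt (\det (J *m J^T)) = r ^+ m * gram_weight m (angles th).
Proof.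
move=> r0 J.
have JE k i : J k i = r * dsphere_coord m k (angles th) i.
  have -> : J k i = ('D_(delta_mx 0 k) (@sphere_param R m.+1 r) th) 0 i.
    by rewrite (deriveEjacobian _ (sphere_param_diff r th)) -rowE [RHS]mxE.
  rewrite -sphere_param_derive derive_mx ?mxE//.
  by apply/derivable_mxP => i' j'; rewrite ord1; exact: smooth_derivable (smooth_sphere_param _ _).
have -> : J *m J^T = diag_mx (\row_(k < m) (r * \prod_(q < k) `|sin (angles th q)|) ^+ 2).
  apply/matrixP => k l; rewrite !mxE.
  rewrite (eq_bigr (fun i : 'I_m.+1 => r ^+ 2 * (dsphere_coord m k (angles th) i * dsphere_coord m l (angles th) i))).
    rewrite -mulr_sumr dsphere_coord_gram// mulrnAr exprMn -prodrXl.
    by congr ((_ * _) *+ _); apply: eq_bigr => q _; rewrite real_normK ?num_real.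
  by move=> i _; rewrite [_^T _ _]mxE !JE; ring.
rewrite det_diag; under eq_bigr do rewrite mxE.
rewrite prodrXl sqrtr_sqr ger0_norm; last first.
  by apply: prodr_ge0 => k _; rewrite mulr_ge0// prodr_ge0.
by rewrite big_split /= prodr_const card_ord.
Qed.

End coords.

Section box.
Variables (R : realType).

Section V.
Variable V : normedModType R.
Hypothesis fV : findim V.
Implicit Types (e : nat -> V) (g : V -> R).

Definition sphere_point e m (t : nat -> R) : V := \sum_(i < m.+1) sphere_coord m t i *: e i.

Lemma sphere_pointS e m t : sphere_point e m.+1 t =
  cos (t 0%N) *: e 0%N + sin (t 0%N) *: sphere_point (fun i => e i.+1) m (tail_angles t).
Proof.
rewrite /sphere_point big_ord_recl sphere_coord_0; congr (_ + _).
by rewrite scaler_sumr; apply: eq_bigr => i _; rewrite sphere_coord_S scalerA.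
Qed.

Lemma sphere_point0 e t : sphere_point e 0 t = e 0%N.
Proof. by rewrite /sphere_point big_ord1 /sphere_coord big_ord0 scale1r. Qed.

(** The outer angle contributes sin^d, which passes into the constant c when the
    induction hypothesis is applied to the remaining angles. *)
Lemma box_integral_sphere d e g v r c : Csmooth g ->
  @box_integral R d.+1 (angle_range d.+2)
    (fun th => c * (g (v + r *: sphere_point e d.+1 (angles th)) * gram_weight d.+1 (angles th))) =
  c * sphere_int d e g (v, r).
Proof.
move=> sg; elim: d e v r c => [|d IH] e v r c.
  have pi2 : (0 : R) <= 2 * pi by rewrite mulr_ge0// pi_ge0.
  rewrite [LHS]/= -(oint_le _ pi2) [sphere_int _ _ _ _]/= /polar_int -ointZ; last first.
    exact: (@continuous_polar R V fV (e 0%N) _ _ v r (smooth_sinX R 0) (smooth_pencil fV (e 1%N) sg)).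
  apply: oint_eq => th; congr (_ * _).
  rewrite sphere_pointS sphere_point0 angles_row0 gram_weightS /gram_weight big_ord0 !expr0 mulr1 mul1r /pencil /polar /=.
  by rewrite scalerDr !scalerA addrA mulr1.
have pi0 : (0 : R) <= pi by exact: pi_ge0.
rewrite -[sphere_int d.+1 e g _]/(oint 0 pi (fun th => sin th ^+ d.+1 *
   sphere_int d (fun i => e i.+1) g (polar (e 0%N) v r th))) -ointZ; last first.
  exact: (@continuous_polar R V fV (e 0%N) _ _ v r (smooth_sinX R d.+1) (smooth_sphere_int fV d (fun i => e i.+1) sg)).
rewrite -[LHS]/(\int[lebesgue_measure]_(s in angle_range d.+3 0)
  @box_integral R d.+1 (fun k => angle_range d.+3 k.+1) (fun th => c *
    (g (v + r *: sphere_point e d.+2 (angles (row_mx (s%:M : 'rV[R]_1) th))) *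
     gram_weight d.+2 (angles (row_mx (s%:M : 'rV[R]_1) th))))).
rewrite (oint_le _ pi0); apply: eq_Rintegral => s; rewrite inE => sD.
have s0pi : 0 <= s <= pi by move: sD; rewrite /angle_range /= in_itv.
have sin0 : 0 <= sin s by exact: sin_ge0_pi.
rewrite -[RHS]/(c * (sin s ^+ d.+1 * sphere_int d (fun i => e i.+1) g (v + (r * cos s) *: e 0%N, r * sin s))).
(* The weight of the outer angle becomes part of the constant. *)
rewrite mulrA -IH.
apply: (congr1 (@box_integral R d.+1 (angle_range d.+2))); apply/funext => th.
rewrite sphere_pointS angles_row0 angles_rowS gram_weightS angles_row0 angles_rowS (ger0_norm sin0).
rewrite scalerDr !scalerA addrA; move: (g _) (gram_weight _ _) => G W; ring.
Qed.

End V.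

(** Bridges spheres about a point of space and spheres in the horizontal slices of
    space times a parameter, on which the partial Laplacians of V * W act. *)
Lemma sphere_int_push (V W : normedModType R) (L : V -> W) d (e : nat -> V) (e' : nat -> W) (g : W -> R) v r :
  (forall x c i, L (x + c *: e i) = L x + c *: e' i) ->
  sphere_int d e (g \o L) (v, r) = sphere_int d e' g (L v, r).
Proof.
elim: d e e' v r => [|d IH] e e' v r HL /=; apply: oint_eq => th; congr (_ * _).
  by rewrite /pencil /polar /= !HL.
rewrite /polar /= -HL; apply: IH => x c i; exact: HL.
Qed.

Definition axis n (i : nat) : 'rV[R]_n := \row_(j < n) (j == i :> nat)%:R.

Lemma axisE n (i : 'I_n) : axis n i = delta_mx 0 i.
Proof. by apply/rowP => j; rewrite !mxE eqxx. Qed.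

Lemma sphere_integralE d (x : 'rV[R]_d.+2) r (g : 'rV[R]_d.+2 -> R) : 0 <= r -> Csmooth g ->
  sphere_integral x r g = r ^+ d.+1 * sphere_int d (axis d.+2) g (x, r).
Proof.
move=> r0 sg; rewrite -box_integral_sphere//; last exact: findim_rV.
rewrite /sphere_integral; congr (box_integral _ _); apply/funext => th.
rewrite gram_det// mulrCA; congr (_ * (g _ * _)); congr (x + _).
rewrite [LHS]row_sum_delta /sphere_point scaler_sumr; apply: eq_bigr => i _.
by rewrite sphere_paramE scalerA axisE.
Qed.

End box.

(** * Laplacians along part of the variables *)

Section derive_rules.
Variables (R : realType) (V : normedModType R).
Implicit Types F G : V -> R.

Lemma derive_smoothD F G w : Csmooth F -> Csmooth G ->
  'D_w (fun x => F x + G x) = fun x => 'D_w F x + 'D_w G x.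
Proof. by move=> sF sG; apply/funext => x; rewrite deriveD//; exact: smooth_derivable. Qed.

Lemma derive_smoothZ c F w : Csmooth F -> 'D_w (fun x => c * F x) = fun x => c * 'D_w F x.
Proof.
move=> sF; apply/funext => x.
by have [_ ->] := is_deriveZ c (smooth_is_derive x w sF).
Qed.

Lemma derive_smoothM F G w : Csmooth F -> Csmooth G ->
  'D_w (fun x => F x * G x) = fun x => F x * 'D_w G x + G x * 'D_w F x.
Proof.
move=> sF sG; apply/funext => x.
by have [_ ->] := is_deriveM (smooth_is_derive x w sF) (smooth_is_derive x w sG).
Qed.

Lemma derive_smooth_sum (I : Type) (r : seq I) (P : pred I) (F : I -> V -> R) w : (forall i, P i -> Csmooth (F i)) ->
  'D_w (fun x => \sum_(i <- r | P i) F i x) = fun x => \sum_(i <- r | P i) 'D_w (F i) x.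
Proof.
move=> sF; apply/funext => x.
by have [_ ->] := is_derive_big r (fun i Pi => smooth_is_derive x w (sF i Pi)).
Qed.

Lemma schwarz_fun F v w : Csmooth F -> 'D_v ('D_w F) = 'D_w ('D_v F).
Proof. by move=> sF; apply/funext => x; exact: schwarz. Qed.

Lemma Lap_derive (e : nat -> V) n F w : Csmooth F -> Lap e n ('D_w F) = 'D_w (Lap e n F).
Proof.
move=> sF; apply/funext => x.
transitivity (\sum_(i < n) 'D_w ('D_(e i) ('D_(e i) F)) x); last first.
  have sDD (i : 'I_n) : true -> Csmooth ('D_(e i) ('D_(e i) F)) by move=> _; do 2!apply: smooth_D.
  exact (esym (congr1 (fun f => f x) (derive_smooth_sum (index_enum 'I_n) w sDD))).
apply: eq_bigr => i _.
transitivity ('D_(e i) ('D_w ('D_(e i) F)) x).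
  exact (congr1 (fun f => derive f x (e i)) (schwarz_fun (e i) w sF)).
exact: (schwarz (e i) w x (smooth_D (e i) sF)).
Qed.

Lemma LapD (e : nat -> V) n F G : Csmooth F -> Csmooth G ->
  Lap e n (fun x => F x + G x) = fun x => Lap e n F x + Lap e n G x.
Proof.
move=> sF sG; apply/funext => x; rewrite /Lap -big_split; apply: eq_bigr => i _.
transitivity ('D_(e i) (fun x => 'D_(e i) F x + 'D_(e i) G x) x).
  exact (congr1 (fun f => derive f x (e i)) (derive_smoothD (e i) sF sG)).
exact (congr1 (fun f => f x) (derive_smoothD (e i) (smooth_D (e i) sF) (smooth_D (e i) sG))).
Qed.

Lemma LapZ (e : nat -> V) n c F : Csmooth F ->
  Lap e n (fun x => c * F x) = fun x => c * Lap e n F x.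
Proof.
move=> sF; apply/funext => x; rewrite /Lap mulr_sumr; apply: eq_bigr => i _.
transitivity ('D_(e i) (fun x => c * 'D_(e i) F x) x).
  exact (congr1 (fun f => derive f x (e i)) (derive_smoothZ c (e i) sF)).
exact (congr1 (fun f => f x) (derive_smoothZ c (e i) (smooth_D (e i) sF))).
Qed.

Lemma Lap_sum (e : nat -> V) n (I : Type) (r : seq I) (P : pred I) (F : I -> V -> R) :
  (forall i, P i -> Csmooth (F i)) ->
  Lap e n (fun x => \sum_(i <- r | P i) F i x) = fun x => \sum_(i <- r | P i) Lap e n (F i) x.
Proof.
move=> sF; apply/funext => x; rewrite /Lap exchange_big; apply: eq_bigr => i _.
transitivity ('D_(e i) (fun x => \sum_(j <- r | P j) 'D_(e i) (F j) x) x).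
  exact (congr1 (fun f => derive f x (e i)) (derive_smooth_sum r (e i) sF)).
exact (congr1 (fun f => f x) (derive_smooth_sum r (e i) (fun j Pj => smooth_D (e i) (sF j Pj)))).
Qed.

End derive_rules.

Section horizontal.
Variables (R : realType) (V W : normedModType R).

(** Directions of V seen in V * W: a Laplacian along hor e acts on the first variable and treats
    the second as a parameter. *)
Definition hor (e : nat -> V) (i : nat) : V * W := (e i, 0).

Lemma Lap_slice e n (H : V * W -> R) v w : Csmooth H ->
  Lap (hor e) n H (v, w) = Lap e n (fun v => H (v, w)) v.
Proof.
move=> sH; apply: eq_bigr => i _.
rewrite (derive_inl v w (e i) (smooth_D (hor e i) sH)).
congr (derive _ v (e i)); apply/funext => v'.
exact: derive_inl.
Qed.

Lemma iter_Lap_slice e n c j (H : V * W -> R) v w : Csmooth H ->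
  iter j (fun F x => c * Lap (hor e) n F x) H (v, w) =
  iter j (fun F x => c * Lap e n F x) (fun v => H (v, w)) v.
Proof.
elim: j H v => [//|j IH] H v sH; rewrite !iterSr IH; last by apply: smoothZ; exact: smooth_Lap.
have X : (fun v' => c * Lap (hor e) n H (v', w)) = (fun x => c * Lap e n (fun v => H (v, w)) x).
  by apply/funext => v'; rewrite Lap_slice.
exact (congr1 (fun G => iter j (fun F x => c * Lap e n F x) G v) X).
Qed.

Lemma smooth_slice (H : V * W -> R) w : findim V -> findim W -> Csmooth H -> Csmooth (fun v => H (v, w)).
Proof.
move=> fV fW sH; apply: (smooth_comp (findim_prod fV fW) sH).
by apply: smooth_map_pair; [exact: smooth_map_id|exact: smooth_map_cst].
Qed.

End horizontal.

Section vertical.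
Variables (R : realType) (V : normedModType R).

Lemma smooth_snd : Csmooth (fun q : V * R => q.2).
Proof. exact: smooth_linform (linform_snd _ (linform_id R)). Qed.

Lemma derive_snd (w : V * R) : 'D_w (fun q : V * R => q.2) = fun=> w.2.
Proof.
apply/funext => q.
by have [_ ->] := linform_derive q w (linform_snd V (linform_id R)).
Qed.

Lemma derive_tM (F : V * R -> R) (w : V * R) : Csmooth F ->
  'D_w (fun q : V * R => q.2 * F q) = fun q : V * R => q.2 * 'D_w F q + w.2 * F q.
Proof.
move=> sF; etransitivity; first exact: (derive_smoothM w smooth_snd sF).
apply/funext => q; rewrite [F q * _]mulrC.
exact (congr1 (fun d => q.2 * 'D_w F q + d * F q) (congr1 (fun f => f q) (derive_snd w))).
Qed.

Lemma Lap_tM (e : nat -> V) n (F : V * R -> R) : Csmooth F ->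
  Lap (hor R e) n (fun q : V * R => q.2 * F q) = fun q : V * R => q.2 * Lap (hor R e) n F q.
Proof.
move=> sF; apply/funext => q; rewrite /Lap mulr_sumr; apply: eq_bigr => i _.
have E (G : V * R -> R) : Csmooth G -> 'D_(hor R e i) (fun q : V * R => q.2 * G q) = fun q : V * R => q.2 * 'D_(hor R e i) G q.
  move=> sG; etransitivity; first exact: derive_tM.
  by apply/funext => p; rewrite mul0r addr0.
transitivity ('D_(hor R e i) (fun q : V * R => q.2 * 'D_(hor R e i) F q) q).
  exact (congr1 (fun f => derive f q (hor R e i)) (E _ sF)).
exact (congr1 (fun f => f q) (E _ (smooth_D (hor R e i) sF))).
Qed.

Lemma derive_rescale (F : V * R -> R) a (w : V * R) : findim V -> Csmooth F ->
  'D_w (fun q : V * R => F (q.1, a * q.2)) = fun q : V * R => 'D_(w.1, a * w.2) F (q.1, a * q.2).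
Proof.
move=> fV sF; apply/funext => q.
have dL : is_derive q w (fun q : V * R => (q.1, a * q.2)) (w.1, a * w.2).
  apply: (is_derive_linmap (L := fun q : V * R => (q.1, a * q.2))) => h.
  by congr (_, _) => /=; rewrite mulrDr [RHS]/= -[h *: (a * w.2)]/(h * (a * w.2)) mulrCA.
by have [_ ->] := smooth_chain (findim_prod fV (@findim_real R)) sF dL.
Qed.

Lemma smooth_rescale (F : V * R -> R) a : findim V -> Csmooth F -> Csmooth (fun q : V * R => F (q.1, a * q.2)).
Proof.
move=> fV sF; apply: (smooth_comp (findim_prod fV (@findim_real R)) sF).
apply: smooth_map_pair; first by apply: smooth_map_fst; exact: smooth_map_id.
by apply: smooth_map_real; apply: smoothZ; exact: smooth_snd.
Qed.

End vertical.

(** * Descent of the Euler-Poisson-Darboux equation *)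

Section EPD_descent.
Variables (R : realType) (V : normedModType R).
Hypothesis fV : findim V.
Variables (e : nat -> V) (n : nat) (a : R).

Let fVR : findim (V * R)%type. Proof. exact: findim_prod fV (@findim_real R). Qed.

Definition odd_fact p : R := \prod_(0 <= k < p.+1) (2 * k + 1)%:R.
Definition even_fact p : R := \prod_(0 <= k < p) (2 * k + 2)%:R.

Lemma odd_factS p : odd_fact p.+1 = odd_fact p * (2 * p + 3)%:R.
Proof. by rewrite /odd_fact big_nat_recr//=; congr (_ * _%:R); rewrite mulnS addnAC addnC addnA. Qed.

Lemma odd_fact_neq0 p : odd_fact p != 0.
Proof. by rewrite prodf_seq_neq0; apply/allP => i _; rewrite pnatr_eq0 addn1. Qed.

Lemma even_factS p : even_fact p.+1 = even_fact p * (2 * p + 2)%:R.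
Proof. by rewrite /even_fact big_nat_recr. Qed.

Lemma even_odd_fact p : even_fact p * odd_fact p = ((2 * p).+1)`!%:R.
Proof.
elim: p => [|p IH]; first by rewrite /even_fact /odd_fact big_nil big_nat1 mul1r.
have F k : (k.+3)`! = ((k.+1)`! * ((k + 2) * (k + 3)))%N.
  by rewrite (factS k.+2) (factS k.+1) addn2 addn3 mulnA mulnC [(k.+3 * _)%N]mulnC.
by rewrite even_factS odd_factS mulrACA IH -!natrM -F [in RHS]mulnS.
Qed.

Local Notation dt F := ('D_((0 : V), (1 : R)) F).
Local Notation LapH := (Lap (hor R e) n).

(** The Euler-Poisson-Darboux equation h'' + ((2p+2) / s) h' = a^2 Lap h, multiplied by s
    to make sense at s = 0, with initial value g / (2p+1)!!.  For p = nu this is satisfied by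
    the normalized spherical mean in dimension 2 nu + 3. *)
Definition epd_solution p (g : V -> R) (h : V * R -> R) :=
  [/\ Csmooth h,
      forall q, q.2 * dt (dt h) q + (2 * p + 2)%:R * dt h q = q.2 * (a ^+ 2 * LapH h q) &
      forall v, h (v, 0) = g v / odd_fact p].

(** The operator s^(-2p-2) d/ds s^(2p+3), which lowers the dimension by 2. *)
Definition descend p (h : V * R -> R) (q : V * R) : R := q.2 * dt h q + (2 * p + 3)%:R * h q.

Lemma smooth_descend p h : Csmooth h -> Csmooth (descend p h).
Proof. by move=> sh; apply: smoothD; [apply: smoothM; [exact: smooth_snd|exact: smooth_D]|exact: smoothZ]. Qed.

(** The left-hand side is s h'' + (2p+4) h', so this is the equation satisfied by h. *)
Lemma descend_dt p g h : epd_solution p.+1 g h -> forall q, dt (descend p h) q = q.2 * (a ^+ 2 * LapH h q).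
Proof.
move=> [sh E _] q; rewrite -E.
have sd := smooth_D ((0 : V), (1 : R)) sh.
transitivity (dt (fun q : V * R => q.2 * dt h q) q + dt (fun q : V * R => (2 * p + 3)%:R * h q) q).
  exact (congr1 (fun f => f q) (derive_smoothD _ (smoothM (smooth_snd V) sd) (smoothZ (2 * p + 3)%:R sh))).
have -> : dt (fun q : V * R => q.2 * dt h q) q = q.2 * dt (dt h) q + 1 * dt h q.
  exact (congr1 (fun f => f q) (derive_tM _ sd)).
have -> : dt (fun q : V * R => (2 * p + 3)%:R * h q) q = (2 * p + 3)%:R * dt h q.
  exact (congr1 (fun f => f q) (derive_smoothZ _ _ sh)).
rewrite -addrA -mulrDl; congr (_ + _ * _); rewrite mulnS -addnA [in RHS]addnC -addnA.
by rewrite -[1]/(1%:R) -natrD; congr (_%:R); rewrite addnC -addnA.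
Qed.

Lemma epd_descend p g h : epd_solution p.+1 g h -> epd_solution p g (descend p h).
Proof.
move=> Hh; have Dt := descend_dt Hh; case: Hh => sh E H0.
have sd := smooth_D ((0 : V), (1 : R)) sh.
have sL : Csmooth (LapH h) by exact: smooth_Lap.
split; first exact: smooth_descend.
  move=> q; rewrite Dt.
  have -> : dt (dt (descend p h)) q = q.2 * (a ^+ 2 * dt (LapH h) q) + 1 * (a ^+ 2 * LapH h q).
    transitivity (dt (fun q : V * R => q.2 * (a ^+ 2 * LapH h q)) q).
      have Dt' : dt (descend p h) = fun q : V * R => q.2 * (a ^+ 2 * LapH h q) by apply/funext.
      exact (congr1 (fun f => dt f q) Dt').
    transitivity (q.2 * dt (fun q => a ^+ 2 * LapH h q) q + 1 * (a ^+ 2 * LapH h q)).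
      exact (congr1 (fun f => f q) (derive_tM _ (smoothZ (a ^+ 2) sL))).
    exact (congr1 (fun d => q.2 * d + 1 * (a ^+ 2 * LapH h q)) (congr1 (fun f => f q) (derive_smoothZ (a ^+ 2) _ sL))).
  have -> : LapH (descend p h) q = q.2 * LapH (dt h) q + (2 * p + 3)%:R * LapH h q.
    transitivity (LapH (fun q : V * R => q.2 * dt h q) q + LapH (fun q : V * R => (2 * p + 3)%:R * h q) q).
      exact (congr1 (fun f => f q) (LapD _ _ (smoothM (smooth_snd V) sd) (smoothZ (2 * p + 3)%:R sh))).
    exact (congr2 +%R (congr1 (fun f => f q) (Lap_tM e n sd)) (congr1 (fun f => f q) (LapZ (hor R e) n _ sh))).
  have -> : LapH (dt h) q = dt (LapH h) q.
    exact (congr1 (fun f => f q) (Lap_derive (hor R e) n _ sh)).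
  move: (derive _ _ _) (LapH h q) => A B.
  have -> : (2 * p + 3)%:R = 1 + (2 * p + 2)%:R :> R by rewrite -[1]/(1%:R) -natrD addnCA.
  by move: (_%:R) => c; ring.
have c0 : (2 * p + 3)%:R != 0 :> R by rewrite pnatr_eq0 addn3.
move=> v; rewrite /descend /= mul0r add0r H0 odd_factS.
move: c0 (odd_fact_neq0 p); move: (_%:R) (odd_fact p) => c d c0 d0.
by field; rewrite c0 d0.
Qed.

Local Notation aLap n e := (fun F x => a ^+ 2 * Lap e n F x).

Lemma smooth_aLap (W : normedModType R) (d : nat -> W) F : Csmooth F -> Csmooth (aLap n d F).
Proof. by move=> sF; apply: smoothZ; exact: smooth_Lap. Qed.

Lemma smooth_iter_aLap (W : normedModType R) (d : nat -> W) j F :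
  Csmooth F -> Csmooth (iter j (aLap n d) F).
Proof. by move=> sF; elim: j => [//|j IH]; exact: smooth_aLap. Qed.

Lemma iter_aLap_dt j (F : V * R -> R) : Csmooth F ->
  dt (iter j (aLap n (hor R e)) F) = iter j (aLap n (hor R e)) (dt F).
Proof.
move=> sF; elim: j => [//|j IH]; have sj := smooth_iter_aLap (hor R e) j sF.
apply/funext => q.
transitivity (a ^+ 2 * dt (LapH (iter j (aLap n (hor R e)) F)) q).
  exact (congr1 (fun f => f q) (derive_smoothZ (a ^+ 2) _ (smooth_Lap (hor R e) n sj))).
transitivity (a ^+ 2 * LapH (dt (iter j (aLap n (hor R e)) F)) q).
  exact (congr1 (fun f => a ^+ 2 * f q) (esym (Lap_derive (hor R e) n _ sj))).
exact (congr1 (fun f => a ^+ 2 * LapH f q) IH).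
Qed.

Lemma iter_aLap_tM j (F : V * R -> R) : Csmooth F ->
  iter j (aLap n (hor R e)) (fun q : V * R => q.2 * F q) =
  fun q => q.2 * iter j (aLap n (hor R e)) F q.
Proof.
move=> sF; elim: j => [//|j IH]; have sj := smooth_iter_aLap (hor R e) j sF.
apply/funext => q.
transitivity (a ^+ 2 * LapH (fun q : V * R => q.2 * iter j (aLap n (hor R e)) F q) q).
  exact (congr1 (fun f => a ^+ 2 * LapH f q) IH).
transitivity (a ^+ 2 * (q.2 * LapH (iter j (aLap n (hor R e)) F) q)).
  exact (congr1 (fun f => a ^+ 2 * f q) (Lap_tM e n sj)).
by rewrite mulrCA.
Qed.

Lemma iter_aLapZ (W : normedModType R) (d : nat -> W) j c F : Csmooth F ->
  iter j (aLap n d) (fun x => c * F x) = fun x => c * iter j (aLap n d) F x.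
Proof.
move=> sF; elim: j => [//|j IH]; have sj := smooth_iter_aLap d j sF.
apply/funext => q.
transitivity (a ^+ 2 * Lap d n (fun x => c * iter j (aLap n d) F x) q).
  exact (congr1 (fun f => a ^+ 2 * Lap d n f q) IH).
transitivity (a ^+ 2 * (c * Lap d n (iter j (aLap n d) F) q)).
  exact (congr1 (fun f => a ^+ 2 * f q) (LapZ d n c sj)).
by rewrite mulrCA.
Qed.

(** By descend_dt, the descended function is a primitive of s a^2 Lap h, and the powers of
    Lap pass through d/ds and the multiplication by s.  The term subtracted is its initial
    value. *)
Lemma Iop_descend p g h j v : Csmooth g -> epd_solution p.+1 g h -> forall s,
  Iop (fun s => iter j.+1 (aLap n (hor R e)) h (v, s)) s =
  iter j (aLap n (hor R e)) (descend p h) (v, s) - iter j (aLap n e) g v / odd_fact p.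
Proof.
move=> sg Hh s; have [sh _ _] := Hh.
have sk := smooth_descend p sh.
have sjk := smooth_iter_aLap (hor R e) j sk.
have cs : continuous (fun s => iter j.+1 (aLap n (hor R e)) h (v, s) * s).
  have sm1 : Csmooth (fun q : V * R => iter j.+1 (aLap n (hor R e)) h q * q.2).
    by apply: smoothM; [exact: smooth_iter_aLap|exact: smooth_snd].
  exact (@slice_continuous R V _ v (smooth_continuous sm1)).
have D (t : R) : is_derive t (1 : R) (fun t => iter j (aLap n (hor R e)) (descend p h) (v, t))
    (iter j.+1 (aLap n (hor R e)) h (v, t) * t).
  have := (is_derive_inr _ _ _ _ _).1 (smooth_is_derive (v, t) ((0 : V), (1 : R)) sjk).
  suff -> : dt (iter j (aLap n (hor R e)) (descend p h)) (v, t) =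
     iter j.+1 (aLap n (hor R e)) h (v, t) * t by [].
  transitivity (iter j (aLap n (hor R e)) (dt (descend p h)) (v, t)).
    exact (congr1 (fun f => f (v, t)) (iter_aLap_dt j sk)).
  have Dt : dt (descend p h) = fun q : V * R => q.2 * (a ^+ 2 * LapH h q).
    by apply/funext; exact: descend_dt Hh.
  transitivity (iter j (aLap n (hor R e)) (fun q : V * R => q.2 * aLap n (hor R e) h q) (v, t)).
    exact (congr1 (fun f => iter j (aLap n (hor R e)) f (v, t)) Dt).
  rewrite iterSr mulrC.
  exact (congr1 (fun f => f (v, t)) (iter_aLap_tM j (smooth_aLap (hor R e) sh))).
rewrite /Iop (oint_FTC2 0 s cs D); congr (_ - _).
rewrite iter_Lap_slice//.
have [_ _ H0] := epd_descend Hh.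
have -> : (fun v => descend p h (v, 0)) = fun v => (odd_fact p)^-1 * g v.
  by apply/funext => x; rewrite H0 mulrC.
by rewrite (iter_aLapZ _ _ _ sg) mulrC.
Qed.

Lemma continuous_iter_Iop j (A : R -> R) : continuous A -> continuous (iter j (@Iop R) A).
Proof.
move=> cA; elim: j => [//|j IH].
apply: (@is_derive_continuous _ _ (fun s => iter j (@Iop R) A s * s)) => t.
have cs : continuous (fun s => iter j (@Iop R) A s * s).
  by move=> s; apply: cvgM; [exact: IH|exact: cvg_id].
have [H dH He] := oint_primitive cs.
have -> : iter j.+1 (@Iop R) A = H - cst (H 0) by apply/funext => s; rewrite /= /Iop He.
have := is_deriveB (dH t) (is_derive_cst (H 0) t (1 : R)).
by rewrite subr0.
Qed.

Lemma is_derive_pow k (t : R) :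
  is_derive t (1 : R) (fun t => t ^+ k.+1 / k.+1%:R) (t ^+ k).
Proof.
have := is_deriveZ (k.+1%:R^-1) (is_deriveX k.+1 (is_derive_id t (1 : R))).
set d := (X in is_derive _ _ _ X -> _); have -> : d = t ^+ k.
  by rewrite /d -[_ *: 1]/(_ * 1) mulr1 -[_ *: _]/(_ * _) mulKf// pnatr_eq0.
suff -> : k.+1%:R^-1 \*: (id ^+ k.+1 : R -> R) = fun t => t ^+ k.+1 / k.+1%:R by [].
by apply/funext => x; rewrite /= exprfctE mulrC.
Qed.

Lemma iter_IopB j (A : R -> R) c : continuous A ->
  iter j (@Iop R) (fun s => A s - c) = fun s => iter j (@Iop R) A s - c * s ^+ (2 * j) / even_fact j.
Proof.
move=> cA; elim: j => [|j IH].
  by apply/funext => s; rewrite muln0 expr0 mulr1 /even_fact big_nil divr1.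
rewrite [LHS]iterS IH; apply/funext => s; rewrite iterS /Iop.
have cj := @continuous_iter_Iop j A cA.
have cjs : continuous (fun s => iter j (@Iop R) A s * s).
  by move=> t; apply: cvgM; [exact: cj|exact: cvg_id].
have cX : continuous (fun s : R => s ^+ (2 * j).+1).
  by apply: smooth_continuous; apply: smoothX; exact: smooth_linform (linform_id R).
pose k := c / even_fact j.
have ckX : continuous (fun s : R => k * s ^+ (2 * j).+1).
  by move=> t; apply: cvgMr; exact: cX.
rewrite (oint_eq 0 s (g := fun s => iter j (@Iop R) A s * s - k * s ^+ (2 * j).+1)); last first.
  by move=> t; rewrite mulrBl exprSr /k; congr (_ - _); rewrite -!mulrA; congr (_ * _); rewrite mulrCA.
rewrite ointB// ointZ//; congr (_ - _).
rewrite (oint_FTC2 0 s cX (is_derive_pow (2 * j).+1)) expr0n /= mul0r subr0.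
rewrite even_factS (_ : (2 * j + 2)%N = (2 * j).+2) ?addn2// mulnS /k.
rewrite -[(2 + 2 * j)%N]/((2 * j).+2) invfM.
by move: (s ^+ _) (_^-1) (_^-1) => x y z; ring.
Qed.

(** Each application of I lowers the parameter by one and leaves an initial value, which
    the remaining applications integrate to a monomial. *)
Lemma iter_Iop_epd j q g h : Csmooth g -> epd_solution (q + j) g h -> exists2 k, epd_solution q g k &
  forall v s, iter j (@Iop R) (fun s => iter j (aLap n (hor R e)) h (v, s)) s =
   k (v, s) - \sum_(0 <= l < j) s ^+ (2 * l) / (even_fact l * odd_fact (q + l)) * iter l (aLap n e) g v.
Proof.
move=> sg; elim: j h => [|j IH] h Hh.
  by rewrite addn0 in Hh; exists h => // v s; rewrite big_geq// subr0.
rewrite addnS in Hh; have Hk := epd_descend Hh.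
have [k Hk' E] := IH _ Hk.
exists k => // v s; rewrite iterSr.
have -> : Iop (fun s => iter j.+1 (aLap n (hor R e)) h (v, s)) = fun s =>
  iter j (aLap n (hor R e)) (descend (q + j) h) (v, s) - iter j (aLap n e) g v / odd_fact (q + j).
  by apply/funext => t; rewrite (Iop_descend _ _ sg Hh).
have [sk _ _] := Hk.
have cA := @slice_continuous R V _ v (smooth_continuous (smooth_iter_aLap (hor R e) j sk)).
rewrite (iter_IopB j _ cA) E big_nat_recr//= opprD addrA; congr (_ - _).
by rewrite invfM; ring.
Qed.

End EPD_descent.

(** * From spherical means to the wave equation *)

Section wave.
Variables (R : realType) (V : normedModType R).
Hypothesis fV : findim V.
Variables (e : nat -> V) (n : nat) (a : R).

Let fVR : findim (V * R)%type. Proof. exact: findim_prod fV (@findim_real R). Qed.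
Local Notation dt F := ('D_((0 : V), (1 : R)) F).
Local Notation LapH := (Lap (hor R e) n).

Lemma rescale_dt (F : V * R -> R) : Csmooth F ->
  dt (fun q : V * R => F (q.1, a * q.2)) = fun q => a * dt F (q.1, a * q.2).
Proof.
move=> sF; apply/funext => q.
transitivity ('D_((0 : V), a * 1) F (q.1, a * q.2)).
  exact (congr1 (fun f => f q) (derive_rescale a ((0 : V), (1 : R)) fV sF)).
rewrite (_ : ((0 : V), a * 1) = a *: ((0 : V), (1 : R))); first exact: smooth_deriveZ.
by rewrite -[RHS]/(a *: 0, a * 1) scaler0.
Qed.

Lemma rescale_dx (F : V * R -> R) (u : V) : Csmooth F ->
  'D_(u, (0 : R)) (fun q : V * R => F (q.1, a * q.2)) = fun q => 'D_(u, (0 : R)) F (q.1, a * q.2).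
Proof.
move=> sF; apply/funext => q.
transitivity ('D_(u, a * 0) F (q.1, a * q.2)).
  exact (congr1 (fun f => f q) (derive_rescale a (u, (0 : R)) fV sF)).
by rewrite mulr0.
Qed.

Lemma rescale_Lap (F : V * R -> R) : Csmooth F ->
  LapH (fun q : V * R => F (q.1, a * q.2)) = fun q => LapH F (q.1, a * q.2).
Proof.
move=> sF; apply/funext => q; apply: eq_bigr => i _.
transitivity ('D_(hor R e i) (fun q : V * R => 'D_(hor R e i) F (q.1, a * q.2)) q).
  exact (congr1 (fun f => derive f q (hor R e i)) (rescale_dx (e i) sF)).
exact (congr1 (fun f => f q) (rescale_dx (e i) (smooth_D (hor R e i) sF))).
Qed.

Lemma sphere_int_Lap d (e' : nat -> V) g : Csmooth g -> LapH (sphere_int d e' g) = sphere_int d e' (Lap e n g).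
Proof.
move=> sg; apply/funext => q.
have sDD (i : 'I_n) : Csmooth ('D_(e i) ('D_(e i) g)) by do 2!apply: smooth_D.
transitivity (\sum_(i < n) sphere_int d e' ('D_(e i) ('D_(e i) g)) q); last first.
  exact (esym (congr1 (fun f => f q) (sphere_int_sum fV d e' sDD))).
apply: eq_bigr => i _.
transitivity ('D_(hor R e i) (sphere_int d e' ('D_(e i) g)) q).
  exact (congr1 (fun f => derive f q (hor R e i)) (sphere_int_dx fV d e' (e i) sg)).
exact (congr1 (fun f => f q) (sphere_int_dx fV d e' (e i) (smooth_D (e i) sg))).
Qed.

(** The quotient of the surface integral by S_(n,j)(s), in dimension n = 2 nu + 3. *)
Definition mean nu (g : V -> R) (q : V * R) : R :=
  (2 * (2 * pi) ^+ nu.+1)^-1 * sphere_int (2 * nu).+1 e g (q.1, a * q.2).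

Lemma epd_mean nu g : n = (2 * nu).+3 -> Csmooth g -> epd_solution e n a nu g (mean nu g).
Proof.
move=> En sg.
have sA := smooth_sphere_int fV (2 * nu).+1 e sg.
pose F := sphere_int (2 * nu).+1 e g.
have sR (G : V * R -> R) : Csmooth G -> Csmooth (fun q : V * R => G (q.1, a * q.2)).
  by move=> sG; exact: smooth_rescale.
have sd := smooth_D ((0 : V), (1 : R)) sA.
pose C : R := (2 * (2 * pi) ^+ nu.+1)^-1.
have d1 : dt (mean nu g) = fun q => C * (a * dt F (q.1, a * q.2)).
  etransitivity; first exact (derive_smoothZ C _ (sR _ sA)).
  apply/funext => q; exact (congr1 (fun f => C * f q) (rescale_dt sA)).
have d2 q : dt (dt (mean nu g)) q = C * (a * (a * dt (dt F) (q.1, a * q.2))).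
  transitivity (dt (fun q => C * (a * dt F (q.1, a * q.2))) q).
    exact (congr1 (fun f => dt f q) d1).
  transitivity (C * dt (fun q => a * dt F (q.1, a * q.2)) q).
    exact (congr1 (fun f => f q) (derive_smoothZ C _ (smoothZ a (sR _ sd)))).
  transitivity (C * (a * dt (fun q => dt F (q.1, a * q.2)) q)).
    exact (congr1 (fun f => C * f q) (derive_smoothZ a _ (sR _ sd))).
  exact (congr1 (fun f => C * (a * f q)) (rescale_dt sd)).
have dL q : LapH (mean nu g) q = C * sphere_int (2 * nu).+1 e (Lap e n g) (q.1, a * q.2).
  transitivity (C * LapH (fun q : V * R => F (q.1, a * q.2)) q).
    exact (congr1 (fun f => f q) (LapZ (hor R e) n C (sR _ sA))).
  transitivity (C * LapH F (q.1, a * q.2)).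
    exact (congr1 (fun f => C * f q) (rescale_Lap sA)).
  exact (congr1 (fun f => C * f (q.1, a * q.2)) (sphere_int_Lap (2 * nu).+1 e sg)).
split; first by apply: smoothZ; exact: sR.
  move=> q.
  have d1q : dt (mean nu g) q = C * (a * dt F (q.1, a * q.2)) by exact (congr1 (fun f => f q) d1).
  rewrite d2 d1q dL En.
  have := sphere_int_epd fV (2 * nu).+1 e q.1 (a * q.2) sg; rewrite -/F addn2.
  move: (derive _ _ _) (derive _ _ _) (sphere_int _ _ _ _) => A1 A2 A0.
  move: ((2 * nu).+2%:R) => k E.
  transitivity (C * a * (a * q.2 * A2 + k * A1)); first by ring.
  by rewrite E; ring.
move=> v; rewrite -[mean nu g (v, 0)]/(C * sphere_int (2 * nu).+1 e g (v, a * 0)) mulr0 sphere_int_center//.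
have := area_odd R nu; rewrite -/(odd_fact R nu) => E.
have C0 : 2 * (2 * pi) ^+ nu.+1 != 0 :> R.
  by rewrite mulf_neq0// expf_neq0// mulf_neq0// gt_eqF// pi_gt0.
have -> : area R (2 * nu).+1 = 2 * (2 * pi) ^+ nu.+1 / odd_fact R nu.
  by rewrite -E mulfK// odd_fact_neq0.
by rewrite /C -[_ / _ * _]mulrA mulKf// mulrC.
Qed.

(** The solution of the wave equation with initial position 0 and initial velocity g, formally
    B = sinh (a t sqrt Lap) / (a sqrt Lap) g. *)
Definition is_wave (g : V -> R) (B : V * R -> R) :=
  [/\ Csmooth B, forall q, dt (dt B) q = a ^+ 2 * LapH B q,
      forall v, B (v, 0) = 0 & forall v, dt B (v, 0) = g v].

(** For parameter 0 the equation s k'' + 2 k' = s a^2 Lap k is the wave equation for s k. *)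
Lemma epd_wave g k : epd_solution e n a 0 g k -> is_wave g (fun q => q.2 * k q).
Proof.
move=> [sk E H0].
have sd := smooth_D ((0 : V), (1 : R)) sk.
have d1 : dt (fun q : V * R => q.2 * k q) = fun q => q.2 * dt k q + 1 * k q by exact: derive_tM.
split.
- by apply: smoothM => //; exact: smooth_snd.
- move=> q.
  have -> : LapH (fun q : V * R => q.2 * k q) q = q.2 * LapH k q.
    exact (congr1 (fun f => f q) (Lap_tM e n sk)).
  transitivity (dt (fun q : V * R => q.2 * dt k q + 1 * k q) q).
    exact (congr1 (fun f => dt f q) d1).
  transitivity (dt (fun q : V * R => q.2 * dt k q) q + dt (fun q => 1 * k q) q).
    exact (congr1 (fun f => f q) (derive_smoothD _ (smoothM (smooth_snd V) sd) (smoothZ 1 sk))).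
  transitivity (q.2 * dt (dt k) q + 1 * dt k q + 1 * dt k q).
    exact (congr2 +%R (congr1 (fun f => f q) (derive_tM _ sd)) (congr1 (fun f => f q) (derive_smoothZ 1 _ sk))).
  rewrite mulrCA -E muln0 add0n; move: (derive _ _ _) (derive _ _ _) => A1 A2; ring.
- by move=> v; rewrite mul0r.
- move=> v; transitivity (0 * dt k (v, 0) + 1 * k (v, 0)).
    exact (congr1 (fun f => f (v, 0)) d1).
  by rewrite mul0r add0r mul1r H0 /odd_fact big_nat1 divr1.
Qed.

End wave.

Section bracket_wave.
Variable (R : realType).

Lemma laplacianE n : @laplacian R n = Lap (axis R n) n.
Proof.
apply/funext => g; apply/funext => x; apply: eq_bigr => i _.
by rewrite axisE.
Qed.

Lemma iter_cLap (V : normedModType R) (e : nat -> V) n c l F : Csmooth F ->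
  iter l (fun F x => c * Lap e n F x) F = fun x => c ^+ l * iter l (Lap e n) F x.
Proof.
move=> sF; elim: l => [|l IH]; first by apply/funext => x; rewrite expr0 mul1r.
apply/funext => x.
transitivity (c * Lap e n (fun x => c ^+ l * iter l (Lap e n) F x) x).
  exact (congr1 (fun f => c * Lap e n f x) IH).
have sl : Csmooth (iter l (Lap e n) F) by elim: (l) => [//|l' IHl]; exact: smooth_Lap.
transitivity (c * (c ^+ l * Lap e n (iter l (Lap e n) F) x)).
  exact (congr1 (fun f => c * f x) (LapZ e n _ sl)).
by rewrite exprS mulrA.
Qed.

Definition space_axes n : nat -> 'rV[R]_n * R := hor R (axis R n).

(** The Taylor polynomial produced by iter_Iop_epd is cancelled by the sum in bracket, because
    (2l)!! (2l+1)!! = (2l+1)!.  The parameter t0 is carried along so that the same solution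
    serves all right-hand sides f(., tau) and is smooth in tau as well. *)
Lemma bracket_wave nu n (hn : n = (2 * nu + 3)%N) a (f : 'rV[R]_n * R -> R) : Csmooth f ->
  exists2 B : ('rV[R]_n * R) * R -> R, is_wave (space_axes n) n a f B &
  forall x t0 t, bracket nu a (fun y => f (y, t0)) x t = B ((x, t0), t).
Proof.
move=> sf.
have fX : findim 'rV[R]_n by exact: findim_rV.
have fV : findim ('rV[R]_n * R)%type by exact: findim_prod fX (@findim_real R).
have En : n = (2 * nu).+3 by rewrite hn addn3.
have Hh := epd_mean fV (space_axes n) a En sf.
have [k Hk E] := @iter_Iop_epd R _ (space_axes n) n a nu 0 f _ sf Hh.
exists (fun q => q.2 * k q); first exact: epd_wave.
move=> x t0 t; rewrite /bracket /=.
have sx : Csmooth (fun y => f (y, t0)) by apply: smooth_slice => //; exact: findim_real.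
have [sh _ H0] := Hh.
have Q s y : sphere_quotient nu a (fun y => f (y, t0)) s y = mean (space_axes n) a nu f ((y, t0), s).
  rewrite /sphere_quotient; case: eqP => as0.
    have := H0 (y, t0); rewrite /mean /= mulr0 as0 => ->.
    by [].
  clear -as0 sf sx fV En fX Hh; subst n.
  rewrite sphere_integralE// /mean [((y, t0), s).1]/= [((y, t0), s).2]/=.
  rewrite -(@sphere_int_push R _ _ (fun y => (y, t0)) (2 * nu).+1 (axis R (2 * nu).+3) (space_axes (2 * nu).+3) f).
    have abs_even : sphere_int (2 * nu).+1 (axis R (2 * nu).+3) (fun y => f (y, t0)) (y, `|a * s|) =
        sphere_int (2 * nu).+1 (axis R (2 * nu).+3) (fun y => f (y, t0)) (y, a * s).
      by case: (ger0P (a * s)) => _; [|exact: (sphere_int_even fX)].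
    rewrite abs_even.
    have -> : `|a * s| ^+ (2 * nu).+2 = (a * s) ^+ (2 * nu).+2.
      have -> : (2 * nu).+2 = (2 * nu.+1)%N by rewrite mulnS.
      by rewrite -normrX ger0_norm// exprM exprn_ge0// sqr_ge0.
    have p0 : (a * s) ^+ (2 * nu).+2 != 0 by rewrite expf_neq0//; apply/eqP.
    rewrite [(2 * nu).+3.-1]/=; move: (sphere_int _ _ _ _) => S.
    by rewrite [X in X * _]invfM -mulrA mulKf.
  by move=> z c i; rewrite -[RHS]/(z + c *: axis R _ i, t0 + c * 0) mulr0 addr0.
have M s : Mj nu a (fun y => f (y, t0)) x s =
    iter nu (fun F z => a ^+ 2 * Lap (hor R (space_axes n)) n F z) (mean (space_axes n) a nu f) ((x, t0), s).
  rewrite iter_Lap_slice// iter_Lap_slice; last by apply: smooth_slice => //; exact: findim_real.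
  rewrite /Mj laplacianE.
  have -> // : sphere_quotient nu a (fun y => f (y, t0)) s = fun y => mean (space_axes n) a nu f ((y, t0), s).
  by apply/funext => y; exact: Q.
have -> : Mj nu a (fun y => f (y, t0)) x = fun s =>
   iter nu (fun F z => a ^+ 2 * Lap (hor R (space_axes n)) n F z) (mean (space_axes n) a nu f) ((x, t0), s).
  by apply/funext.
rewrite E mulrBr mulr_sumr -addrA -[RHS]addr0; congr (_ + _).
rewrite -sumrN -big_split big1// => l _ /=.
rewrite iter_Lap_slice// (iter_cLap _ _ _ _ sx) add0n even_odd_fact laplacianE.
rewrite -exprM [t ^+ (2 * l).+1]exprS.
move: (iter _ _ _ _) (a ^+ _) (t ^+ _) (_^-1) => X Y Z F; ring.
Qed.

End bracket_wave.

(** * Lagrange interpolation *)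

Section lagrange.
Variable (R : realType).

(** Interpolating X^k at the m nodes is exact for k < m; compare the coefficients of
    X^(m-1). *)
Lemma lagrange_sum m (y : 'I_m -> R) k : injective y -> (k < m)%N ->
  \sum_(j < m) y j ^+ k / \prod_(i < m | i != j) (y j - y i) = (k.+1 == m)%:R.
Proof.
move=> yI km.
pose N j : {poly R} := \prod_(i < m | i != j) ('X - (y i)%:P).
pose d j : R := \prod_(i < m | i != j) (y j - y i).
have d0 j : d j != 0.
  by apply/prodf_neq0 => i ij; rewrite subr_eq0; apply: contra ij => /eqP/yI ->.
have Nj j : (N j).[y j] = d j.
  by rewrite horner_prod; apply: eq_bigr => i _; rewrite hornerXsubC.
have Nij i j : i != j -> (N j).[y i] = 0.
  by move=> ij; rewrite horner_prod (bigD1 i)//= hornerXsubC subrr mul0r.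
have sN j : size (N j) = m.
  rewrite /N -big_filter size_prod_XsubC size_filter -sum1_count.
  by rewrite sum1_card cardC1 card_ord prednK// (leq_trans _ km).
have mN j : N j \is monic by rewrite /N -big_filter monic_prod_XsubC.
pose p : {poly R} := 'X^k - \sum_(j < m) (y j ^+ k / d j) *: N j.
have p0 : p = 0.
  apply: (@roots_geq_poly_eq0 _ p [seq y i | i <- enum 'I_m]).
  - apply/allP => _ /mapP[i _ ->]; apply/rootP; rewrite /p !hornerE horner_sum.
    rewrite (bigD1 i)//= !hornerE Nj divfK// big1 ?addr0 ?subrr// => j ji.
    by rewrite !hornerE Nij ?mulr0// eq_sym.
  - by rewrite map_inj_uniq ?enum_uniq.
  - rewrite size_map size_enum_ord (leq_trans (size_polyD _ _))// geq_max size_polyXn km/=.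
    rewrite size_polyN (leq_trans (size_sum _ _ _))//; apply/bigmax_leqP => j _.
    by rewrite (leq_trans (size_scale_leq _ _))// sN.
have := congr1 (fun p : {poly R} => p`_m.-1) p0.
rewrite coefB coef0 coefXn coef_sum => /eqP; rewrite subr_eq0 => /eqP.
rewrite -(eqSS m.-1) prednK ?(leq_trans _ km)// eq_sym => ->.
apply: eq_bigr => j _; rewrite coefZ -/(d j).
have := mN j; rewrite monicE /lead_coef sN => /eqP ->.
by rewrite mulr1.
Qed.

(** As polynomials in x^2 both sides agree at infinitely many points, hence have the same
    leading coefficient. *)
Lemma polynomial_lead m (a : 'I_m -> R) (b : nat -> R) :
  (forall x : R, \sum_(0 <= k < m.+1) b (2 * k)%N * x ^+ (2 * k) = \prod_(i < m) (x ^+ 2 - a i ^+ 2)) ->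
  b (2 * m)%N = 1.
Proof.
move=> H.
pose p : {poly R} := \poly_(k < m.+1) b (2 * k)%N.
pose q : {poly R} := \prod_(i < m) ('X - (a i ^+ 2)%:P).
have pq x : p.[x ^+ 2] = q.[x ^+ 2].
  rewrite horner_poly horner_prod.
  under [RHS]eq_bigr do rewrite hornerXsubC.
  by rewrite -H big_mkord; apply: eq_bigr => k _; rewrite exprM.
have E : p - q = 0.
  (* The squares of natural numbers are values of x^2. *)
  pose s := [seq (i%:R : R) ^+ 2 | i <- iota 0 (size (p - q))].
  apply: (@roots_geq_poly_eq0 _ _ s).
  - by apply/allP => _ /mapP[i _ ->]; apply/rootP; rewrite hornerD hornerN pq subrr.
  - rewrite map_inj_in_uniq ?iota_uniq// => i j _ _ /eqP.
    by rewrite eqrXn2// eqr_nat => /eqP.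
  - by rewrite size_map size_iota.
have mq : q \is monic by exact: monic_prod_XsubC.
have sq : size q = m.+1 by rewrite size_prod_XsubC /index_enum -enumT size_enum_ord.
have := congr1 (fun p : {poly R} => p`_m) E.
rewrite coefB coef0 coef_poly ltnSn => /eqP; rewrite subr_eq0 => /eqP ->.
by move: mq; rewrite monicE /lead_coef sq => /eqP.
Qed.

End lagrange.

(** * Iterated time integrals of waves *)

Section iter_Lap.
Variables (R : realType) (V : normedModType R).
Variables (e : nat -> V) (n : nat).

Lemma smooth_iter_Lap j (F : V -> R) : Csmooth F -> Csmooth (iter j (Lap e n) F).
Proof. by move=> sF; elim: j => [//|j IH]; exact: smooth_Lap. Qed.

Lemma iter_LapZ j c (F : V -> R) : Csmooth F ->
  iter j (Lap e n) (fun x => c * F x) = fun x => c * iter j (Lap e n) F x.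
Proof.
move=> sF; elim: j => [//|j IH]; rewrite iterS.
exact (eq_trans (congr1 (Lap e n) IH) (LapZ e n c (smooth_iter_Lap j sF))).
Qed.

Lemma iter_LapD j (F G : V -> R) : Csmooth F -> Csmooth G ->
  iter j (Lap e n) (fun x => F x + G x) = fun x => iter j (Lap e n) F x + iter j (Lap e n) G x.
Proof.
move=> sF sG; elim: j => [//|j IH]; rewrite iterS.
exact (eq_trans (congr1 (Lap e n) IH) (LapD e n (smooth_iter_Lap j sF) (smooth_iter_Lap j sG))).
Qed.

Lemma iter_Lap_sum j (I : Type) (r : seq I) (P : pred I) (F : I -> V -> R) :
  (forall i, P i -> Csmooth (F i)) ->
  iter j (Lap e n) (fun x => \sum_(i <- r | P i) F i x) =
  fun x => \sum_(i <- r | P i) iter j (Lap e n) (F i) x.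
Proof.
move=> sF; elim: j => [//|j IH]; rewrite iterS.
exact (eq_trans (congr1 (Lap e n) IH) (Lap_sum e n r (fun i Pi => smooth_iter_Lap j (sF i Pi)))).
Qed.

Lemma iter_Lap_derive j (F : V -> R) w : Csmooth F ->
  iter j (Lap e n) ('D_w F) = 'D_w (iter j (Lap e n) F).
Proof.
move=> sF; elim: j => [//|j IH]; rewrite iterS.
exact (eq_trans (congr1 (Lap e n) IH) (Lap_derive e n w (smooth_iter_Lap j sF))).
Qed.

Lemma iter_Lap_hor (W : normedModType R) j (H : V * W -> R) v w : Csmooth H ->
  iter j (Lap (hor W e) n) H (v, w) = iter j (Lap e n) (fun v => H (v, w)) v.
Proof.
elim: j H v => [//|j IH] H v sH; rewrite !iterSr IH; last exact: smooth_Lap.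
have X : (fun v' => Lap (hor W e) n H (v', w)) = Lap e n (fun v => H (v, w)).
  by apply/funext => v'; rewrite Lap_slice.
exact (congr1 (fun G => iter j (Lap e n) G v) X).
Qed.

End iter_Lap.

Section iterated_integrals.
Variables (R : realType) (V : normedModType R).
Hypothesis fV : findim V.
Variables (e : nat -> V) (n : nat).

Let fVR : findim (V * R)%type. Proof. exact: findim_prod fV (@findim_real R). Qed.
Local Notation dt F := ('D_((0 : V), (1 : R)) F).
Local Notation LapH := (Lap (hor R e) n).

(** Identities between iterated time integrals are proved by differentiating both sides. *)
Lemma dt_unique (F G : V * R -> R) : Csmooth F -> Csmooth G ->
  (forall q, dt F q = dt G q) -> (forall v, F (v, 0) = G (v, 0)) -> F = G.
Proof.
move=> sF sG E E0; apply/funext => -[v t].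
have D (s : R) : is_derive s (1 : R) ((fun s => F (v, s)) - (fun s => G (v, s))) 0.
  have dF := (is_derive_inr _ _ _ _ _).1 (smooth_is_derive (v, s) ((0 : V), (1 : R)) sF).
  have dG := (is_derive_inr _ _ _ _ _).1 (smooth_is_derive (v, s) ((0 : V), (1 : R)) sG).
  have := is_deriveB dF dG; suff -> : dt F (v, s) - dt G (v, s) = 0 by [].
  by rewrite E subrr.
have := is_derive0_cst D t 0; rewrite -![(_ - _ : R -> R) _]/(F _ - G _) E0 subrr => /eqP.
by rewrite subr_eq0 => /eqP.
Qed.

Definition taylor_kernel q (B : V * R -> R) (z : (V * R) * R) : R := z.2 ^+ q / q`!%:R * B z.1.

(** The q-fold time integral of B from 0, by the Cauchy formula for repeated integration. *)
Definition iter_int q (B : V * R -> R) : V * R -> R := if q is q'.+1 then duhamel (taylor_kernel q' B) else B.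

Lemma smooth_taylor_kernel q B : Csmooth B -> Csmooth (taylor_kernel q B).
Proof.
move=> sB; apply: smoothM; last first.
  by apply: (smooth_comp fVR sB); apply: smooth_map_fst; exact: smooth_map_id.
apply: smoothM; last exact: smooth_cst.
by apply: smoothX; exact: smooth_snd.
Qed.

Lemma smooth_iter_int q B : Csmooth B -> Csmooth (iter_int q B).
Proof. by case: q => [//|q] sB; apply: smooth_duhamel => //; exact: smooth_taylor_kernel. Qed.

Lemma iter_int0 q B v : Csmooth B -> iter_int q.+1 B (v, 0) = 0.
Proof. by move=> sB; apply: (duhamel0 fV); exact: smooth_taylor_kernel. Qed.

Lemma is_derive_powfact q (t : R) :
  is_derive t (1 : R) (fun t => t ^+ q.+1 / q.+1`!%:R) (t ^+ q / q`!%:R).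
Proof.
have := is_deriveZ (q`!%:R^-1) (is_derive_pow q t).
have -> : q`!%:R^-1 \*: (fun t : R => t ^+ q.+1 / q.+1%:R) = fun t => t ^+ q.+1 / q.+1`!%:R.
  by apply/funext => x /=; rewrite factS natrM invfM -[_ *: _]/(_ * _); ring.
by rewrite -[_ *: _]/(_ * _) mulrC.
Qed.

Lemma taylor_kernel_derive q B (z : V * R) (s : R) : Csmooth B ->
  'D_((0 : V * R), (1 : R)) (taylor_kernel q B) (z, s) = (if q is q'.+1 then taylor_kernel q' B (z, s) else 0).
Proof.
move=> sB; rewrite (derive_inr z s (1 : R) (smooth_taylor_kernel q sB)).
case: q => [|q].
  rewrite (_ : (fun y => _) = cst (1 / 1 * B z)); first by rewrite derive_cst.
  by apply/funext => y; rewrite /taylor_kernel /= expr0 fact0.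
by have [_ ->] := is_derive_scalel (B z : R) (is_derive_powfact q s).
Qed.

Lemma iter_int_dt q B : Csmooth B -> dt (iter_int q.+1 B) = iter_int q B.
Proof.
move=> sB; apply/funext => -[x t].
transitivity (duhamel ('D_((0 : V * R), (1 : R)) (taylor_kernel q B)) (x, t) + 1 * taylor_kernel q B ((x, t), 0)).
  exact (duhamel_derive fV (smooth_taylor_kernel q sB) x t 0 1).
case: q => [|q].
  have -> : 'D_((0 : V * R), (1 : R)) (taylor_kernel 0 B) = fun=> 0.
    by apply/funext => -[z s]; exact: taylor_kernel_derive.
  rewrite /duhamel oint_cst mulr0 add0r /taylor_kernel expr0 fact0 divr1 !mul1r.
  by [].
have -> : 'D_((0 : V * R), (1 : R)) (taylor_kernel q.+1 B) = taylor_kernel q B.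
  by apply/funext => -[z s]; exact: taylor_kernel_derive.
by rewrite /taylor_kernel /= expr0n /= !mul0r mulr0 addr0.
Qed.

Lemma iter_int_unique q B F : Csmooth B -> Csmooth F -> dt F = iter_int q B ->
  (forall v, F (v, 0) = 0) -> F = iter_int q.+1 B.
Proof.
move=> sB sF E F0; apply: dt_unique => //; first exact: smooth_iter_int.
  move=> p; transitivity (iter_int q B p); first exact (congr1 (fun f => f p) E).
  exact (esym (congr1 (fun f => f p) (iter_int_dt q sB))).
by move=> v; rewrite F0 iter_int0.
Qed.

Lemma iter_int_sum q (I : finType) (c : I -> R) (B : I -> V * R -> R) : (forall i, Csmooth (B i)) ->
  iter_int q (fun p => \sum_i c i * B i p) = fun p => \sum_i c i * iter_int q (B i) p.
Proof.
move=> sB.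
have sS : Csmooth (fun p => \sum_i c i * B i p) by apply: smooth_sum => i _; exact: smoothZ.
have sR q' : Csmooth (fun p => \sum_i c i * iter_int q' (B i) p).
  by apply: smooth_sum => i _; apply: smoothZ; exact: smooth_iter_int.
elim: q => [//|q IH]; apply/esym; apply: iter_int_unique => //; last first.
  by move=> v; apply: big1 => i _; rewrite iter_int0// mulr0.
rewrite IH; apply/funext => p.
transitivity (\sum_i dt (fun p => c i * iter_int q.+1 (B i) p) p).
  exact (congr1 (fun f => f p) (derive_smooth_sum (index_enum I) _ (fun i _ => smoothZ (c i) (smooth_iter_int q.+1 (sB i))))).
apply: eq_bigr => i _.
transitivity (c i * dt (iter_int q.+1 (B i)) p).
  exact (congr1 (fun f => f p) (derive_smoothZ (c i) _ (smooth_iter_int q.+1 (sB i)))).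
exact (congr1 (fun f => c i * f p) (iter_int_dt q (sB i))).
Qed.

Section one_wave.
Variables (a : R) (g : V -> R) (B : V * R -> R).
Hypothesis sg : Csmooth g.
Hypothesis wB : is_wave e n a g B.

Let sB : Csmooth B. Proof. by case: wB. Qed.

Definition taylor_term q (p : V * R) : R := p.2 ^+ q / q`!%:R * g p.1.

Lemma smooth_taylor_term q : Csmooth (taylor_term q).
Proof.
apply: smoothM; last by apply: (smooth_comp fV sg); apply: smooth_map_fst; exact: smooth_map_id.
by apply: smoothM; [apply: smoothX; exact: smooth_snd|exact: smooth_cst].
Qed.

Lemma taylor_term_dt q : dt (taylor_term q.+1) = taylor_term q.
Proof.
apply/funext => -[v t]; rewrite (derive_inr v t (1 : R) (smooth_taylor_term q.+1)).
by have [_ ->] := is_derive_scalel (g v : R) (is_derive_powfact q t).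
Qed.

(** Integrates the wave equation once in time. *)
Lemma Lap_iter_int1 : (fun p => a ^+ 2 * LapH (iter_int 1 B) p) = fun p => dt B p - g p.1.
Proof.
have [_ W B0 B1] := wB.
have sL := smooth_Lap (hor R e) n (smooth_iter_int 1 sB).
have sg1 : Csmooth (fun p : V * R => g p.1) by apply: (smooth_comp fV sg); apply: smooth_map_fst; exact: smooth_map_id.
apply: dt_unique.
- exact: smoothZ.
- by apply: smoothB => //; exact: smooth_D.
- move=> p; transitivity (a ^+ 2 * dt (LapH (iter_int 1 B)) p).
    exact (congr1 (fun f => f p) (derive_smoothZ (a ^+ 2) _ sL)).
  transitivity (a ^+ 2 * LapH (dt (iter_int 1 B)) p).
    exact (congr1 (fun f => a ^+ 2 * f p) (esym (Lap_derive (hor R e) n _ (smooth_iter_int 1 sB)))).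
  transitivity (a ^+ 2 * LapH B p).
    exact (congr1 (fun f => a ^+ 2 * LapH f p) (iter_int_dt 0 sB)).
  rewrite -W.
  have dg : dt (fun p : V * R => g p.1) p = 0.
    case: p => v t; rewrite (derive_inr v t (1 : R) sg1) /=.
    exact: derive_cst.
  have [_ ->] := is_deriveB (smooth_is_derive p ((0 : V), (1 : R)) (smooth_D ((0 : V), (1 : R)) sB))
     (smooth_is_derive p ((0 : V), (1 : R)) sg1).
  by rewrite dg subr0.
- move=> v; rewrite B1 subrr Lap_slice; last exact: smooth_iter_int.
  have -> : (fun v => iter_int 1 B (v, 0)) = fun=> 0 * 0.
    by apply/funext => x; rewrite iter_int0// mulr0.
  have /(congr1 (fun f => f v)) /= := LapZ e n 0 (smooth_cst V (0 : R)).
  by move=> ->; rewrite mul0r mulr0.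
Qed.

Lemma Lap_iter_int q p : a ^+ 2 * LapH (iter_int q.+2 B) p = iter_int q B p - taylor_term q.+1 p.
Proof.
pose F q p := a ^+ 2 * LapH (iter_int q B) p.
have sF q' : Csmooth (F q') by apply: smoothZ; apply: smooth_Lap; exact: smooth_iter_int.
have F0 q' v : F q'.+1 (v, 0) = 0.
  rewrite /F Lap_slice; last exact: smooth_iter_int.
  have -> : (fun v => iter_int q'.+1 B (v, 0)) = fun=> 0 * 0.
    by apply/funext => x; rewrite iter_int0// mulr0.
  have /(congr1 (fun f => f v)) /= := LapZ e n 0 (smooth_cst V (0 : R)).
  by move=> ->; rewrite mul0r mulr0.
have Fd q' p' : dt (F q'.+1) p' = F q' p'.
  transitivity (a ^+ 2 * dt (LapH (iter_int q'.+1 B)) p').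
    exact (congr1 (fun f => f p') (derive_smoothZ (a ^+ 2) _ (smooth_Lap (hor R e) n (smooth_iter_int q'.+1 sB)))).
  transitivity (a ^+ 2 * LapH (dt (iter_int q'.+1 B)) p').
    exact (congr1 (fun f => a ^+ 2 * f p') (esym (Lap_derive (hor R e) n _ (smooth_iter_int q'.+1 sB)))).
  exact (congr1 (fun f => a ^+ 2 * LapH f p') (iter_int_dt q' sB)).
have Gd q' p' : dt (fun p => iter_int q' B p - taylor_term q'.+1 p) p' = dt (iter_int q' B) p' - taylor_term q' p'.
  have [_ ->] := is_deriveB (smooth_is_derive p' ((0 : V), (1 : R)) (smooth_iter_int q' sB))
     (smooth_is_derive p' ((0 : V), (1 : R)) (smooth_taylor_term q'.+1)).
  exact (congr1 (fun f => dt (iter_int q' B) p' - f p') (taylor_term_dt q')).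
have sG q' : Csmooth (fun p => iter_int q' B p - taylor_term q'.+1 p).
  by apply: smoothB; [exact: smooth_iter_int|exact: smooth_taylor_term].
have [_ _ B0 _] := wB.
suff E : F q.+2 = fun p => iter_int q B p - taylor_term q.+1 p by exact (congr1 (fun f => f p) E).
elim: q => [|q IH].
  apply: dt_unique => //.
    move=> p'; rewrite Fd Gd /taylor_term expr0 fact0 divr1 mul1r.
    exact (congr1 (fun f => f p') Lap_iter_int1).
  by move=> v; rewrite F0 /iter_int B0 /taylor_term expr1 !mul0r subrr.
apply: dt_unique => //.
  move=> p'; rewrite Fd Gd.
  transitivity (iter_int q B p' - taylor_term q.+1 p'); first exact (congr1 (fun f => f p') IH).
  exact (congr1 (fun f => f p' - taylor_term q.+1 p') (esym (iter_int_dt q sB))).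
by move=> v; rewrite F0 iter_int0// /taylor_term expr0n /= !mul0r subrr.
Qed.

(** In the formal notation of is_wave, integrating twice and applying a^2 Lap removes the next
    term of the Taylor expansion of B in t. *)
Lemma iter_Lap_iter_int i v t :
  a ^+ (2 * i) * iter i LapH (iter_int (2 * i) B) (v, t) =
  B (v, t) - \sum_(0 <= l < i) t ^+ (2 * l).+1 / ((2 * l).+1)`!%:R * a ^+ (2 * l) * iter l (Lap e n) g v.
Proof.
elim: i => [|i IH]; first by rewrite muln0 expr0 mul1r big_geq// subr0.
rewrite big_nat_recr// opprD addrA -IH.
have E2 : (2 * i.+1)%N = (2 * i).+2 by rewrite mulnS.
have sR := smooth_iter_int (2 * i).+2 sB.
have X : (fun p => a ^+ 2 * LapH (iter_int (2 * i).+2 B) p) = fun p => iter_int (2 * i) B p + (- 1) * taylor_term (2 * i).+1 p.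
  by apply/funext => p; rewrite Lap_iter_int mulN1r.
have H1 : a ^+ 2 * iter i LapH (LapH (iter_int (2 * i).+2 B)) (v, t) =
    iter i LapH (iter_int (2 * i) B) (v, t) - iter i LapH (taylor_term (2 * i).+1) (v, t).
  transitivity (iter i LapH (fun p => a ^+ 2 * LapH (iter_int (2 * i).+2 B) p) (v, t)).
    exact (esym (congr1 (fun f => f (v, t)) (iter_LapZ (hor R e) n i (a ^+ 2) (smooth_Lap (hor R e) n sR)))).
  transitivity (iter i LapH (fun p => iter_int (2 * i) B p + (- 1) * taylor_term (2 * i).+1 p) (v, t)).
    exact (congr1 (fun f => iter i LapH f (v, t)) X).
  transitivity (iter i LapH (iter_int (2 * i) B) (v, t) + iter i LapH (fun p => - 1 * taylor_term (2 * i).+1 p) (v, t)).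
    exact (congr1 (fun f => f (v, t)) (iter_LapD (hor R e) n i (smooth_iter_int (2 * i) sB) (smoothZ (-1) (smooth_taylor_term (2 * i).+1)))).
  rewrite -[- iter i LapH (taylor_term _) _]mulN1r.
  exact (congr1 (fun f => iter i LapH (iter_int (2 * i) B) (v, t) + f (v, t)) (iter_LapZ (hor R e) n i (-1) (smooth_taylor_term (2 * i).+1))).
have H2 : iter i LapH (taylor_term (2 * i).+1) (v, t) = t ^+ (2 * i).+1 / ((2 * i).+1)`!%:R * iter i (Lap e n) g v.
  rewrite iter_Lap_hor; last exact: smooth_taylor_term.
  exact (congr1 (fun f => f v) (iter_LapZ e n i (t ^+ (2 * i).+1 / ((2 * i).+1)`!%:R) sg)).
have P2 : a ^+ (2 * i).+2 = a ^+ (2 * i) * a ^+ 2 by rewrite -exprD addn2.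
rewrite E2 P2 iterSr -mulrA H1 H2 mulrBr.
by move: (iter _ _ _ _) (iter _ _ _ _) => X1 X2; ring.
Qed.

End one_wave.

End iterated_integrals.

(** * The fundamental solution as a superposition of waves *)

Section superposition_of_waves.
Variables (R : realType) (V : normedModType R).
Hypothesis fV : findim V.
Variables (e : nat -> V) (n m : nat) (a : 'I_m -> R) (b : nat -> R).
Variables (g : V -> R) (B : 'I_m -> V * R -> R).
Hypothesis hm : (1 < m)%N.
Hypothesis ha : forall i j : 'I_m, i != j -> a i ^+ 2 != a j ^+ 2.
Hypothesis hb : forall x : R, \sum_(0 <= k < m.+1) b (2 * k)%N * x ^+ (2 * k)
                      = \prod_(i < m) (x ^+ 2 - a i ^+ 2).
Hypothesis sg : Csmooth g.
Hypothesis wB : forall j, is_wave e n (a j) g (B j).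

Local Notation dt F := ('D_((0 : V), (1 : R)) F).
Local Notation idt i F := (iter i (fun G : V * R -> R => dt G) F).
Local Notation LapH := (Lap (hor R e) n).

Let sB j : Csmooth (B j). Proof. by case: (wB j). Qed.

Let coef k j : R := a j ^+ (2 * k) / \prod_(i < m | i != j) (a j ^+ 2 - a i ^+ 2).

Let coef_sum k : (k < m)%N -> \sum_(j < m) coef k j = (k.+1 == m)%:R.
Proof.
move=> km; rewrite -(@lagrange_sum R m (fun j => a j ^+ 2) k _ km).
  by apply: eq_bigr => j _; rewrite /coef exprM.
by move=> i j ij; apply/eqP; apply: contraT => /ha; rewrite ij eqxx.
Qed.

Definition superposition (p : V * R) : R := \sum_(j < m)
  (a j ^+ (2 * m - 2) / \prod_(i < m | i != j) (a j ^+ 2 - a i ^+ 2)) * B j p.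

(** The kernel of the formula, int_0^t (t-tau)^(2m-3)/(2m-3)! W(tau) dtau, is a
    (2m-2)-fold time integral. *)
Definition fundamental : V * R -> R := iter_int (2 * m - 2) superposition.

Let mE : (2 * m - 2 = 2 * m.-1)%N.
Proof. by move: hm; lia. Qed.

Let superpositionE : superposition = fun p => \sum_(j < m) coef m.-1 j * B j p.
Proof. by apply/funext => p; rewrite /superposition mE. Qed.

Let sW : Csmooth superposition.
Proof. by apply: smooth_sum => j _; exact: smoothZ. Qed.

Lemma smooth_fundamental : Csmooth fundamental. Proof. exact: smooth_iter_int. Qed.

Let idt_fundamental i : (i <= 2 * m - 2)%N -> idt i fundamental = iter_int (2 * m - 2 - i) superposition.
Proof.
elim: i => [|i IH] im; first by rewrite subn0.
rewrite iterS (IH (ltnW im)) (_ : (2 * m - 2 - i)%N = (2 * m - 2 - i.+1).+1); last by move: im; lia.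
exact: iter_int_dt.
Qed.

Lemma fundamental_init i v : (i < (2 * m).-1)%N -> idt i fundamental (v, 0) = 0.
Proof.
move=> im; have im2 : (i <= 2 * m - 2)%N by move: im hm; lia.
rewrite idt_fundamental//; case: (_ - _)%N => [|q]; last by rewrite iter_int0.
by rewrite /iter_int /superposition big1// => j _; have [_ _ -> _] := wB j; rewrite mulr0.
Qed.

Let dt_sum (c : 'I_m -> R) (F : 'I_m -> V * R -> R) : (forall j, Csmooth (F j)) ->
  dt (fun p => \sum_(j < m) c j * F j p) = fun p => \sum_(j < m) c j * dt (F j) p.
Proof.
move=> sF; apply/funext => p.
transitivity (\sum_(j < m) dt (fun p => c j * F j p) p).
  exact (congr1 (fun f => f p) (derive_smooth_sum (index_enum 'I_m) _ (fun i _ => smoothZ (c i) (sF i)))).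
by apply: eq_bigr => j _; exact (congr1 (fun f => f p) (derive_smoothZ (c j) _ (sF j))).
Qed.

Let idt_top : idt (2 * m - 2) fundamental = superposition.
Proof. by rewrite idt_fundamental// subnn. Qed.

Let idt_top1 : idt (2 * m).-1 fundamental = fun p => \sum_(j < m) coef m.-1 j * dt (B j) p.
Proof.
have -> : (2 * m).-1 = (2 * m - 2).+1 by move: hm; lia.
rewrite iterS idt_top superpositionE; exact: dt_sum.
Qed.

Let idt_top2 p : idt (2 * m) fundamental p = \sum_(j < m) coef m j * LapH (B j) p.
Proof.
have -> : (2 * m)%N = ((2 * m).-1).+1 by move: hm; lia.
rewrite iterS idt_top1.
transitivity (\sum_(j < m) coef m.-1 j * dt (dt (B j)) p).
  exact (congr1 (fun f => f p) (dt_sum _ (fun j => smooth_D _ (sB j)))).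
apply: eq_bigr => j _; have [_ -> _ _] := wB j.
rewrite mulrA; congr (_ * _); rewrite /coef mulrAC -exprD; congr (_ ^+ _ / _).
by move: hm; lia.
Qed.

Lemma fundamental_init_top v : idt (2 * m).-1 fundamental (v, 0) = g v.
Proof.
rewrite idt_top1.
transitivity (\sum_(j < m) coef m.-1 j * g v).
  by apply: eq_bigr => j _; have [_ _ _ ->] := wB j.
by rewrite -mulr_suml coef_sum ?prednK ?eqxx ?mul1r// ltnW.
Qed.

(** The factor a_j^(2i) that is needed to cancel the 2i-fold integration, with i = m-1-k,
    is taken from a_j^(2m-2); what remains is a_j^(2k).  The Taylor polynomials carry the sums of
    a_j^(2(k+l)) over prod_(i != j) (a_j^2 - a_i^2) with k + l < m-1, which vanish. *)
Let fundamental_term k p : (k <= m)%N ->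
  iter (m - k) LapH (idt (2 * k) fundamental) p = \sum_(j < m) coef k j * LapH (B j) p.
Proof.
rewrite leq_eqVlt => /orP[/eqP ->|km]; first by rewrite subnn; exact: idt_top2.
pose i := (m.-1 - k)%N.
have ki : (m - k)%N = i.+1 by rewrite /i; move: km hm; lia.
have ik : (i + k)%N = m.-1 by rewrite /i; move: km hm; lia.
have i2 : (2 * m - 2 - 2 * k)%N = (2 * i)%N by rewrite mE -mulnBr.
rewrite idt_fundamental; last by move: km hm; lia.
rewrite i2 ki iterS superpositionE.
have sR j : Csmooth (iter_int (2 * i) (B j)) by exact: smooth_iter_int.
have X : iter i LapH (iter_int (2 * i) (fun p => \sum_(j < m) coef m.-1 j * B j p)) =
    fun p => \sum_(j < m) coef k j * B j p.
  rewrite (iter_int_sum fV (2 * i) (coef m.-1) sB); apply/funext => -[v t].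
  transitivity (\sum_(j < m) coef m.-1 j * iter i LapH (iter_int (2 * i) (B j)) (v, t)).
    transitivity (\sum_(j < m) iter i LapH (fun p => coef m.-1 j * iter_int (2 * i) (B j) p) (v, t)).
      exact (congr1 (fun f => f (v, t)) (iter_Lap_sum (hor R e) n i (index_enum 'I_m) (fun j _ => smoothZ (coef m.-1 j) (sR j)))).
    by apply: eq_bigr => j _; exact (congr1 (fun f => f (v, t)) (iter_LapZ (hor R e) n i _ (sR j))).
  transitivity (\sum_(j < m) (coef k j * B j (v, t) -
     \sum_(0 <= l < i) t ^+ (2 * l).+1 / ((2 * l).+1)`!%:R * iter l (Lap e n) g v * coef (k + l) j)).
    apply: eq_bigr => j _.
    (* 2 (m - 1) = 2 k + 2 i, an identity of exponents that also covers a_j = 0. *)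
    have -> : coef m.-1 j = coef k j * a j ^+ (2 * i).
      by rewrite /coef -ik addnC mulnDr exprD mulrAC.
    rewrite -mulrA (iter_Lap_iter_int fV sg (wB j)) mulrBr; congr (_ - _).
    rewrite mulr_sumr; apply: eq_bigr => l _.
    by rewrite /coef mulnDr exprD; ring.
  rewrite sumrB exchange_big /= [X in _ - X]big1_seq ?subr0// => l.
  rewrite mem_index_iota => /andP[_ li].
  rewrite -mulr_sumr coef_sum; last by move: li ik; lia.
  by rewrite (_ : ((k + l).+1 == m) = false) ?mulr0//; move: li ik hm; lia.
transitivity (LapH (fun p => \sum_(j < m) coef k j * B j p) p).
  exact (congr1 (fun f => LapH f p) X).
transitivity (\sum_(j < m) LapH (fun p => coef k j * B j p) p).
  exact (congr1 (fun f => f p) (Lap_sum (hor R e) n (index_enum 'I_m) (fun j _ => smoothZ (coef k j) (sB j)))).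
by apply: eq_bigr => j _; exact (congr1 (fun f => f p) (LapZ (hor R e) n _ (sB j))).
Qed.

(** By fundamental_term each summand is a combination of the Lap (B j), and the coefficient of
    Lap (B j) in the sum is a multiple of the characteristic polynomial at its root a_j. *)
Lemma fundamental_eq p : \sum_(0 <= k < m.+1) b (2 * k)%N * iter (m - k) LapH (idt (2 * k) fundamental) p = 0.
Proof.
transitivity (\sum_(0 <= k < m.+1) \sum_(j < m) (b (2 * k)%N * a j ^+ (2 * k)) *
    ((\prod_(i < m | i != j) (a j ^+ 2 - a i ^+ 2))^-1 * LapH (B j) p)).
  apply: eq_big_nat => k /andP[_ km]; rewrite fundamental_term// mulr_sumr.
  by apply: eq_bigr => j _; rewrite /coef; ring.
rewrite exchange_big big1// => j _.
by rewrite -mulr_suml hb (bigD1 j)//= subrr !mul0r.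
Qed.

End superposition_of_waves.

(** * The Cauchy problem with given data *)

Section cauchy_operator.
Variables (R : realType) (V : normedModType R).
Hypothesis fV : findim V.
Variables (e : nat -> V) (n m : nat) (b : nat -> R).

Local Notation dt F := ('D_((0 : V), (1 : R)) F).
Local Notation idt i F := (iter i (fun G : V * R -> R => dt G) F).
Local Notation LapH := (Lap (hor R e) n).

Definition cauchy_op (F : V * R -> R) (p : V * R) : R :=
  \sum_(0 <= k < m.+1) b (2 * k)%N * iter (m - k) LapH (idt (2 * k) F) p.

Lemma smooth_idt i (F : V * R -> R) : Csmooth F -> Csmooth (idt i F).
Proof. by move=> sF; elim: i => [//|i IH]; exact: smooth_D. Qed.

Lemma smooth_Lidt j i (F : V * R -> R) : Csmooth F -> Csmooth (iter j LapH (idt i F)).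
Proof. by move=> sF; apply: smooth_iter_Lap; exact: smooth_idt. Qed.

Lemma idt_sum i (I : Type) (r : seq I) (P : pred I) (F : I -> V * R -> R) : (forall j, P j -> Csmooth (F j)) ->
  idt i (fun p => \sum_(j <- r | P j) F j p) = fun p => \sum_(j <- r | P j) idt i (F j) p.
Proof.
move=> sF; elim: i => [//|i IH]; rewrite iterS.
exact (eq_trans (congr1 (fun f => dt f) IH) (derive_smooth_sum r _ (fun j Pj => smooth_idt i (sF j Pj)))).
Qed.

Lemma idtZ i c F : Csmooth F -> idt i (fun p => c * F p) = fun p => c * idt i F p.
Proof.
move=> sF; elim: i => [//|i IH]; rewrite iterS.
exact (eq_trans (congr1 (fun f => dt f) IH) (derive_smoothZ c _ (smooth_idt i sF))).
Qed.

Lemma idt_iter_Lap i j F : Csmooth F -> idt i (iter j LapH F) = iter j LapH (idt i F).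
Proof.
move=> sF; elim: i => [//|i IH]; rewrite !iterS.
exact (eq_trans (congr1 (fun f => dt f) IH) (esym (iter_Lap_derive (hor R e) n j _ (smooth_idt i sF)))).
Qed.

Lemma Lidt_sum j i (I : Type) (r : seq I) (P : pred I) (F : I -> V * R -> R) : (forall k, P k -> Csmooth (F k)) ->
  iter j LapH (idt i (fun p => \sum_(k <- r | P k) F k p)) =
  fun p => \sum_(k <- r | P k) iter j LapH (idt i (F k)) p.
Proof.
move=> sF.
exact (eq_trans (congr1 (iter j LapH) (idt_sum i r sF)) (iter_Lap_sum (hor R e) n j r (fun k Pk => smooth_idt i (sF k Pk)))).
Qed.

Lemma LidtZ j i c F : Csmooth F ->
  iter j LapH (idt i (fun p => c * F p)) = fun p => c * iter j LapH (idt i F) p.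
Proof.
move=> sF.
exact (eq_trans (congr1 (iter j LapH) (idtZ i c sF)) (iter_LapZ (hor R e) n j c (smooth_idt i sF))).
Qed.

Lemma Lidt_comp j i j' i' F : Csmooth F ->
  iter j LapH (idt i (iter j' LapH (idt i' F))) = iter (j + j') LapH (idt (i + i') F).
Proof.
move=> sF; rewrite iterD [idt (i + i') F]iterD.
exact (congr1 (iter j LapH) (idt_iter_Lap i j' (smooth_idt i' sF))).
Qed.

Lemma cauchy_op_sum (I : Type) (r : seq I) (P : pred I) (F : I -> V * R -> R) p : (forall k, P k -> Csmooth (F k)) ->
  cauchy_op (fun p => \sum_(k <- r | P k) F k p) p = \sum_(k <- r | P k) cauchy_op (F k) p.
Proof.
move=> sF; rewrite /cauchy_op exchange_big; apply: eq_bigr => k _.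
rewrite -mulr_sumr.
exact (congr1 (fun f => b (2 * k)%N * f p) (Lidt_sum (m - k) (2 * k) r sF)).
Qed.

Lemma idtD i F G : Csmooth F -> Csmooth G ->
  idt i (fun p => F p + G p) = fun p => idt i F p + idt i G p.
Proof.
move=> sF sG; elim: i => [//|i IH]; rewrite iterS.
exact (eq_trans (congr1 (fun f => dt f) IH) (derive_smoothD _ (smooth_idt i sF) (smooth_idt i sG))).
Qed.

Lemma cauchy_opD F G p : Csmooth F -> Csmooth G -> cauchy_op (fun p => F p + G p) p = cauchy_op F p + cauchy_op G p.
Proof.
move=> sF sG; rewrite /cauchy_op -big_split /=; apply: eq_bigr => k _; rewrite -mulrDr.
transitivity (b (2 * k)%N * iter (m - k) LapH (fun p => idt (2 * k) F p + idt (2 * k) G p) p).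
  exact (congr1 (fun f => b (2 * k)%N * iter (m - k) LapH f p) (idtD (2 * k) sF sG)).
exact (congr1 (fun f => b (2 * k)%N * f p) (iter_LapD (hor R e) n (m - k) (smooth_idt (2 * k) sF) (smooth_idt (2 * k) sG))).
Qed.

Lemma cauchy_opZ c F p : Csmooth F -> cauchy_op (fun p => c * F p) p = c * cauchy_op F p.
Proof.
move=> sF; rewrite /cauchy_op mulr_sumr; apply: eq_bigr => k _; rewrite mulrCA.
exact (congr1 (fun f => b (2 * k)%N * f p) (LidtZ (m - k) (2 * k) c sF)).
Qed.

Lemma cauchy_op_Lidt j i F p : Csmooth F -> cauchy_op (iter j LapH (idt i F)) p = iter j LapH (idt i (cauchy_op F)) p.
Proof.
move=> sF.
transitivity (\sum_(0 <= k < m.+1) iter j LapH (idt i (fun p => b (2 * k)%N * iter (m - k) LapH (idt (2 * k) F) p)) p); last first.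
  exact (esym (congr1 (fun f => f p) (Lidt_sum j i (index_iota 0 m.+1) (fun k _ => smoothZ (b (2 * k)%N) (smooth_Lidt (m - k) (2 * k) sF))))).
apply: eq_bigr => k _.
transitivity (b (2 * k)%N * iter j LapH (idt i (iter (m - k) LapH (idt (2 * k) F))) p); last first.
  exact (esym (congr1 (fun f => f p) (LidtZ j i (b (2 * k)%N) (smooth_Lidt (m - k) (2 * k) sF)))).
have E1 := Lidt_comp (m - k) (2 * k) j i sF.
have E2 := Lidt_comp j i (m - k) (2 * k) sF.
rewrite addnC [(2 * k + i)%N]addnC in E1.
exact (congr1 (fun f => b (2 * k)%N * f p) (eq_trans E1 (esym E2))).
Qed.

Lemma Lidt0 j i : iter j LapH (idt i (fun=> 0)) = fun=> 0.
Proof.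
have := LidtZ j i 0 (smooth_cst (V * R)%type (0 : R)).
rewrite (_ : (fun p : V * R => 0 * 0) = fun=> 0); last by apply/funext => p; rewrite mulr0.
by move=> ->; apply/funext => p; rewrite mul0r.
Qed.

Definition is_fundamental (g : V -> R) (F : V * R -> R) :=
  [/\ Csmooth F, forall p, cauchy_op F p = 0,
      forall i v, (i < (2 * m).-1)%N -> idt i F (v, 0) = 0 &
      forall v, idt (2 * m).-1 F (v, 0) = g v].

Section data_solution.
Variables (phi : nat -> V -> R) (D : nat -> V * R -> R).
Hypothesis hm : (1 < m)%N.
Hypothesis bm : b (2 * m)%N = 1.
Hypothesis hD : forall r, (r < 2 * m)%N -> is_fundamental (phi r) (D r).

Definition data_solution (p : V * R) : R :=
  \sum_(1 <= k < m.+1) b (2 * k)%N *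
    iter (m - k) LapH (fun p => \sum_(0 <= r < 2 * k) idt (2 * k - 1 - r) (D r) p) p.

Let J r := if (r < 2 * m)%N then D r else fun=> 0.

Let sJ r : Csmooth (J r).
Proof. by rewrite /J; case: ifP => [/hD[]//|_]; exact: smooth_cst. Qed.

Let PJ r p : cauchy_op (J r) p = 0.
Proof.
rewrite /J; case: ifP => [/hD[]//|_]; rewrite /cauchy_op big1// => k _.
by rewrite Lidt0 mulr0.
Qed.

Let J0 r i v : (i < (2 * m).-1)%N -> idt i (J r) (v, 0) = 0.
Proof.
rewrite /J; case: ifP => [/hD[_ _ H _]//|_ _]; first exact: H.
exact (congr1 (fun f => f (v, 0)) (Lidt0 0 i)).
Qed.

(** Rewritten as a rectangular double sum, so that the summation order can be exchanged.  The cutoff at 2m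
    concerns only functions whose index exceeds the number of initial conditions. *)
Lemma data_solutionE : data_solution = fun p => \sum_(0 <= k < m.+1) \sum_(0 <= r < 2 * m)
  (if (r < 2 * k)%N then b (2 * k)%N else 0) * iter (m - k) LapH (idt (2 * k - 1 - r) (J r)) p.
Proof.
apply/funext => p; rewrite [RHS]big_nat_recl//= [X in X + _]big1 ?add0r; last first.
  by move=> r _; rewrite mul0r.
rewrite /data_solution big_add1 /=; apply: eq_big_nat => k /andP[_ km].
transitivity (b (2 * k.+1)%N * \sum_(0 <= r < 2 * k.+1) iter (m - k.+1) LapH (idt (2 * k.+1 - 1 - r) (J r)) p).
  congr (_ * _).
  have X : (fun p => \sum_(0 <= r < 2 * k.+1) idt (2 * k.+1 - 1 - r) (D r) p) =
      fun p => \sum_(0 <= r < 2 * k.+1) idt (2 * k.+1 - 1 - r) (J r) p.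
    apply/funext => q; apply: eq_big_nat => r /andP[_ rk].
    by rewrite /J ifT//; move: rk km; lia.
  transitivity (iter (m - k.+1) LapH (fun p => \sum_(0 <= r < 2 * k.+1) idt (2 * k.+1 - 1 - r) (J r) p) p).
    exact (congr1 (fun f => iter (m - k.+1) LapH f p) X).
  exact (congr1 (fun f => f p) (iter_Lap_sum (hor R e) n (m - k.+1) (index_iota 0 (2 * k.+1))
     (fun r _ => smooth_idt (2 * k.+1 - 1 - r) (sJ r)))).
have k2m : (2 * k.+1 <= 2 * m)%N by move: km; lia.
rewrite mulr_sumr [RHS](big_cat_nat (leq0n _) k2m) /=.
rewrite [X in _ = _ + X]big1_seq ?addr0; last first.
  by move=> r /andP[_]; rewrite mem_index_iota => /andP[kr _]; rewrite ltnNge kr mul0r.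
by apply: eq_big_nat => r /andP[_ ->].
Qed.

Let cf k r : R := if (r < 2 * k)%N then b (2 * k)%N else 0.

Let sT k r : Csmooth (fun p => cf k r * iter (m - k) LapH (idt (2 * k - 1 - r) (J r)) p).
Proof. by apply: smoothZ; exact: smooth_Lidt. Qed.

Let sTk k : Csmooth (fun p => \sum_(0 <= r < 2 * m) cf k r * iter (m - k) LapH (idt (2 * k - 1 - r) (J r)) p).
Proof. by apply: smooth_sum => r _. Qed.

Lemma smooth_data_solution : Csmooth data_solution.
Proof. by rewrite data_solutionE; apply: smooth_sum => k _; exact: sTk. Qed.

Lemma cauchy_op_data p : cauchy_op data_solution p = 0.
Proof.
rewrite data_solutionE cauchy_op_sum; last by move=> k _; exact: sTk.
rewrite big1// => k _; rewrite cauchy_op_sum; last by move=> r _; exact: sT.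
rewrite big1// => r _; rewrite cauchy_opZ; last exact: smooth_Lidt.
rewrite cauchy_op_Lidt// (_ : cauchy_op (J r) = fun=> 0); last by apply/funext => q.
by rewrite Lidt0 mulr0.
Qed.

(** For r < q the sum over k may start at 0, since the terms with 2k <= r involve derivatives
    of order below 2m-1; it is then a time derivative of P (D r) = 0. *)
Lemma data_init q v : (q < 2 * m)%N -> idt q data_solution (v, 0) = phi q v.
Proof.
move=> qm.
pose t k r := iter (m - k) LapH (idt (q + (2 * k - 1 - r)) (J r)) (v, 0).
have t0 k r : (q + (2 * k - 1 - r) < (2 * m).-1)%N -> t k r = 0.
  move=> lt; rewrite /t iter_Lap_hor; last exact: smooth_idt.
  have -> : (fun v => idt (q + (2 * k - 1 - r)) (J r) (v, 0)) = fun=> 0 * 0.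
    by apply/funext => x; rewrite J0// mulr0.
  by rewrite (iter_LapZ e n _ 0 (smooth_cst V (0 : R))) mul0r.
have -> : idt q data_solution (v, 0) = \sum_(0 <= r < 2 * m) \sum_(0 <= k < m.+1) cf k r * t k r.
  rewrite data_solutionE exchange_big /=.
  transitivity (\sum_(0 <= k < m.+1) idt q (fun p => \sum_(0 <= r < 2 * m) cf k r * iter (m - k) LapH (idt (2 * k - 1 - r) (J r)) p) (v, 0)).
    exact (congr1 (fun f => f (v, 0)) (idt_sum q (index_iota 0 m.+1) (fun k _ => sTk k))).
  apply: eq_bigr => k _.
  transitivity (\sum_(0 <= r < 2 * m) idt q (fun p => cf k r * iter (m - k) LapH (idt (2 * k - 1 - r) (J r)) p) (v, 0)).
    exact (congr1 (fun f => f (v, 0)) (idt_sum q (index_iota 0 (2 * m)) (fun r _ => sT k r))).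
  apply: eq_bigr => r _.
  transitivity (cf k r * idt q (iter (m - k) LapH (idt (2 * k - 1 - r) (J r))) (v, 0)).
    exact (congr1 (fun f => f (v, 0)) (idtZ q (cf k r) (smooth_Lidt (m - k) (2 * k - 1 - r) (sJ r)))).
  exact (congr1 (fun f => cf k r * f (v, 0)) (Lidt_comp 0 q (m - k) (2 * k - 1 - r) (sJ r))).
rewrite (bigD1_seq q)/= ?mem_index_iota ?iota_uniq//.
rewrite [X in _ + X]big1_seq ?addr0; last first.
  move=> r /andP[rq]; rewrite mem_index_iota => /andP[_ rm].
  case: (ltngtP r q) rq => // rq _; last first.
    apply: big1_seq => k /andP[_]; rewrite mem_index_iota => /andP[_ km].
    rewrite /cf; case: ifP => rk; last by rewrite mul0r.
    by rewrite t0 ?mulr0//; move: rq rk km; lia.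
  (* r < q: complete the sum over k to the operator P. *)
  transitivity (cauchy_op (idt (q - 1 - r) (J r)) (v, 0)).
    apply: eq_big_nat => k /andP[_ km].
    have [rk|rk] := ltnP r (2 * k).
      rewrite /cf rk; congr (_ * _); rewrite /t -iterD.
      by congr (iter _ _ (iter _ _ _) _); move: rk rq; lia.
    rewrite /cf ltnNge rk mul0r.
    have E := Lidt_comp (m - k) (2 * k) 0 (q - 1 - r) (sJ r).
    rewrite iter_Lap_hor; last by apply: smooth_idt; exact: smooth_idt.
    have -> : (fun v => idt (2 * k) (idt (q - 1 - r) (J r)) (v, 0)) = fun=> 0 * 0.
      by apply/funext => x; rewrite -iterD J0 ?mulr0//; move: rk rq qm; lia.
    by rewrite (iter_LapZ e n _ 0 (smooth_cst V (0 : R))) mul0r mulr0.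
  have E := cauchy_op_Lidt 0 (q - 1 - r) (v, 0) (sJ r).
  transitivity (idt (q - 1 - r) (cauchy_op (J r)) (v, 0)); first exact E.
  rewrite (_ : cauchy_op (J r) = fun=> 0); last by apply/funext => x.
  exact (congr1 (fun f => f (v, 0)) (Lidt0 0 (q - 1 - r))).
rewrite big_nat_recr//= big1_seq ?add0r; last first.
  move=> k /andP[_]; rewrite mem_index_iota => /andP[_ km].
  rewrite /cf; case: ifP => rk; last by rewrite mul0r.
  by rewrite t0 ?mulr0//; move: rk km; lia.
rewrite /cf qm bm mul1r /t subnn (_ : (q + (2 * m - 1 - q))%N = (2 * m).-1); last by move: qm; lia.
by rewrite /J qm; have [_ _ _ H] := hD qm; exact: H.
Qed.

End data_solution.

End cauchy_operator.

(** * The Duhamel principle *)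

Section duhamel_principle.
Variables (R : realType) (X : normedModType R).
Hypothesis fX : findim X.
Variables (e : nat -> X) (n m : nat) (b : nat -> R).

Let fXR : findim (X * R)%type. Proof. exact: findim_prod fX (@findim_real R). Qed.
Local Notation V := (X * R)%type.
Local Notation dX F := ('D_((0 : X), (1 : R)) F).
Local Notation dV F := ('D_((0 : V), (1 : R)) F).
Local Notation idX i F := (iter i (fun G : X * R -> R => dX G) F).
Local Notation idV i F := (iter i (fun G : V * R -> R => dV G) F).
Local Notation LapX := (Lap (hor R e) n).
Local Notation LapV := (Lap (hor R (hor R e)) n).

Lemma duhamel_dt (F : V * R -> R) p : Csmooth F ->
  dX (duhamel F) p = duhamel (dV F) p + F (p, 0).
Proof.
case: p => x t sF; rewrite -[F _]mul1r.
exact (duhamel_derive fX sF x t 0 1).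
Qed.

Lemma duhamel_dx (F : V * R -> R) (w : X) : Csmooth F ->
  'D_(w, (0 : R)) (duhamel F) = duhamel ('D_((w, (0 : R)), (0 : R)) F).
Proof.
move=> sF; apply/funext => -[x t].
transitivity (duhamel ('D_((w, (0 : R)), (0 : R)) F) (x, t) + 0 * F ((x, t), 0)).
  exact (duhamel_derive fX sF x t w 0).
by rewrite mul0r addr0.
Qed.

Lemma duhamel_continuous (F : V * R -> R) (p : X * R) : Csmooth F ->
  continuous (fun s => F ((p.1, s), p.2 - s)).
Proof.
move=> sF; case: p => x t; apply: (@smooth_continuous R R (fun s => F ((x, s), t - s))).
apply: (smooth_comp (findim_prod fXR (@findim_real R)) sF); apply: smooth_map_pair.
  by apply: smooth_map_pair; [exact: smooth_map_cst|exact: smooth_map_id].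
apply: smooth_map_real; apply: smoothB; first exact: smooth_cst.
exact: smooth_linform (linform_id R).
Qed.

Lemma duhamel_sum (r : seq nat) (c : nat -> R) (F : nat -> V * R -> R) p : (forall k, Csmooth (F k)) ->
  duhamel (fun z => \sum_(k <- r) c k * F k z) p = \sum_(k <- r) c k * duhamel (F k) p.
Proof.
move=> sF; elim: r => [|k r IH].
  rewrite big_nil /duhamel (oint_eq _ _ (g := fun=> 0)) ?oint_cst ?mulr0// => s.
  by rewrite big_nil.
have sS : Csmooth (fun z => \sum_(k <- r) c k * F k z) by apply: smooth_sum => i _; exact: smoothZ.
rewrite big_cons -IH /duhamel -ointZ; last exact: duhamel_continuous.
rewrite -ointD; first by apply: oint_eq => s; rewrite big_cons.
  exact (@duhamel_continuous _ p (smoothZ (c k) (sF k))).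
exact (@duhamel_continuous _ p sS).
Qed.

Lemma duhamel_Lap (F : V * R -> R) : Csmooth F -> LapX (duhamel F) = duhamel (LapV F).
Proof.
move=> sF; apply/funext => p.
transitivity (\sum_(i < n) duhamel ('D_(hor R (hor R e) i) ('D_(hor R (hor R e) i) F)) p).
  apply: eq_bigr => i _.
  transitivity ('D_(hor R e i) (duhamel ('D_(hor R (hor R e) i) F)) p).
    exact (congr1 (fun f => derive f p (hor R e i)) (duhamel_dx (e i) sF)).
  exact (congr1 (fun f => f p) (duhamel_dx (e i) (smooth_D (hor R (hor R e) i) sF))).
pose F' k := 'D_(hor R (hor R e) k) ('D_(hor R (hor R e) k) F).
have := @duhamel_sum (index_iota 0 n) (fun=> 1) F' p (fun k => smooth_D _ (smooth_D _ sF)).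
rewrite big_mkord => E.
transitivity (\sum_(i < n) 1 * duhamel (F' i) p).
  by apply: eq_bigr => i _; rewrite mul1r.
rewrite -E /duhamel; apply: oint_eq => s; rewrite big_mkord.
by apply: eq_bigr => i _; rewrite mul1r.
Qed.

Lemma duhamel_iter_Lap j (F : V * R -> R) : Csmooth F ->
  iter j LapX (duhamel F) = duhamel (iter j LapV F).
Proof.
move=> sF; elim: j => [//|j IH]; rewrite !iterS.
exact (eq_trans (congr1 LapX IH) (duhamel_Lap (smooth_iter_Lap (hor R (hor R e)) n j sF))).
Qed.

Variables (f : V -> R) (E : V * R -> R).
Hypothesis hm : (1 < m)%N.
Hypothesis bm : b (2 * m)%N = 1.
Hypothesis hE : is_fundamental (hor R e) n m b f E.

Let sE : Csmooth E. Proof. by case: hE. Qed.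

(** The boundary terms are the initial values of E, which vanish up to this order. *)
Lemma duhamel_idt i : (i <= (2 * m).-1)%N -> idX i (duhamel E) = duhamel (idV i E).
Proof.
have [_ _ E0 _] := hE.
elim: i => [//|i IH] im; rewrite !iterS.
apply: (eq_trans (congr1 (fun F => dX F) (IH (ltnW im)))).
apply/funext => p.
transitivity (duhamel (dV (idV i E)) p + idV i E (p, 0)).
  exact (duhamel_dt p (smooth_idt i sE)).
by rewrite E0// addr0.
Qed.

Lemma duhamel_idt_top p : idX (2 * m) (duhamel E) p = duhamel (idV (2 * m) E) p + f p.
Proof.
have [_ _ _ E1] := hE.
have -> : (2 * m)%N = ((2 * m).-1).+1 by move: hm; lia.
rewrite !iterS -E1.
transitivity (dX (duhamel (idV (2 * m).-1 E)) p).
  exact (congr1 (fun F => dX F p) (duhamel_idt (leqnn _))).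
exact (duhamel_dt p (smooth_idt (2 * m).-1 sE)).
Qed.

(** Only the time derivative of order 2m produces a boundary term, and it is f. *)
Lemma duhamel_cauchy_op p : cauchy_op e n m b (duhamel E) p = f p.
Proof.
have [_ PE _ _] := hE.
pose F k := iter (m - k) LapV (idV (2 * k) E).
have sF k : Csmooth (F k) by exact: smooth_Lidt.
have Z := @duhamel_sum (index_iota 0 m.+1) (fun k => b (2 * k)%N) F p sF.
have Z0 : duhamel (fun z => \sum_(0 <= k < m.+1) b (2 * k)%N * F k z) p = 0.
  rewrite /duhamel (oint_eq _ _ (g := fun=> 0)) ?oint_cst ?mulr0// => s.
  exact: PE.
rewrite -[RHS]add0r -Z0 Z /cauchy_op !big_nat_recr//= -addrA; congr (_ + _).
  apply: eq_big_nat => k /andP[_ km]; congr (_ * _).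
  have k2 : (2 * k <= (2 * m).-1)%N by move: km; lia.
  transitivity (iter (m - k) LapX (duhamel (idV (2 * k) E)) p).
    exact (congr1 (fun G => iter (m - k) LapX G p) (duhamel_idt k2)).
  exact (congr1 (fun G => G p) (duhamel_iter_Lap (m - k) (smooth_idt (2 * k) sE))).
by rewrite /F subnn bm !mul1r; exact: duhamel_idt_top.
Qed.

Lemma duhamel_init i x : (i < 2 * m)%N -> idX i (duhamel E) (x, 0) = 0.
Proof.
move=> im; have im' : (i <= (2 * m).-1)%N by move: im; lia.
rewrite duhamel_idt//; apply: (duhamel0 fX); exact: smooth_idt.
Qed.

End duhamel_principle.

Section freeze.
Variables (R : realType) (X : normedModType R).
Hypothesis fX : findim X.
Variables (e : nat -> X) (n m : nat) (b : nat -> R).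

Let fXR : findim (X * R)%type. Proof. exact: findim_prod fX (@findim_real R). Qed.
Local Notation V := (X * R)%type.

(** The data phi_r are treated as right-hand sides that do not depend on the parameter tau;
    freezing the parameter returns to functions of (x, t). *)
Definition freeze (F : V * R -> R) (p : X * R) : R := F ((p.1, 0), p.2).

Lemma smooth_freeze F : Csmooth F -> Csmooth (freeze F).
Proof.
move=> sF; apply: (smooth_comp (findim_prod fXR (@findim_real R)) sF).
apply: smooth_map_pair; last by apply: smooth_map_snd; exact: smooth_map_id.
by apply: smooth_map_pair; [apply: smooth_map_fst; exact: smooth_map_id|exact: smooth_map_cst].
Qed.

Lemma freeze_derive F w c : Csmooth F ->
  'D_(w, c) (freeze F) = freeze ('D_((w, (0 : R)), c) F).
Proof.
move=> sF; apply/funext => p.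
have dL : is_derive p (w, c) (fun p : X * R => ((p.1, (0 : R)), p.2)) ((w, (0 : R)), c).
  apply: (is_derive_linmap (L := fun p : X * R => ((p.1, (0 : R)), p.2))) => h.
  by rewrite -[RHS]/((h *: w + p.1, h * 0 + 0), h *: c + p.2) mulr0 addr0.
by have [_ ->] := smooth_chain (findim_prod fXR (@findim_real R)) sF dL.
Qed.

Lemma freeze_iter_Lap j F : Csmooth F ->
  iter j (Lap (hor R e) n) (freeze F) = freeze (iter j (Lap (hor R (hor R e)) n) F).
Proof.
move=> sF; elim: j => [//|j IH]; rewrite !iterS.
have sj := smooth_iter_Lap (hor R (hor R e)) n j sF.
apply: (eq_trans (congr1 (Lap (hor R e) n) IH)).
apply/funext => p; apply: eq_bigr => i _.
transitivity ('D_(hor R e i) (freeze ('D_(hor R (hor R e) i) (iter j (Lap (hor R (hor R e)) n) F))) p).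
  exact (congr1 (fun f => derive f p (hor R e i)) (freeze_derive (e i) 0 sj)).
exact (congr1 (fun f => f p) (freeze_derive (e i) 0 (smooth_D (hor R (hor R e) i) sj))).
Qed.

Lemma freeze_idt i F : Csmooth F ->
  iter i (fun G : X * R -> R => 'D_((0 : X), (1 : R)) G) (freeze F) =
  freeze (iter i (fun G : V * R -> R => 'D_((0 : V), (1 : R)) G) F).
Proof.
move=> sF; elim: i => [//|i IH]; rewrite !iterS.
apply: (eq_trans (congr1 (fun G => 'D_((0 : X), (1 : R)) G) IH)).
exact (freeze_derive 0 1 (smooth_idt i sF)).
Qed.

Lemma is_fundamental_freeze (g : V -> R) F : is_fundamental (hor R e) n m b g F ->
  is_fundamental e n m b (fun x => g (x, 0)) (freeze F).
Proof.
move=> [sF PF F0 F1]; split; first exact: smooth_freeze.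
- move=> p; rewrite -(PF ((p.1, 0), p.2)); apply: eq_bigr => k _; congr (_ * _).
  transitivity (iter (m - k) (Lap (hor R e) n) (freeze (iter (2 * k) (fun G : V * R -> R => 'D_((0 : V), (1 : R)) G) F)) p).
    exact (congr1 (fun G => iter (m - k) (Lap (hor R e) n) G p) (freeze_idt (2 * k) sF)).
  exact (congr1 (fun G => G p) (freeze_iter_Lap (m - k) (smooth_idt (2 * k) sF))).
- by move=> i v im; rewrite freeze_idt//; exact: F0.
- by move=> v; rewrite freeze_idt//; exact: F1.
Qed.

End freeze.

(** * The solution formula *)

Section link.
Variables (R : realType) (n : nat).
Local Notation X := ('rV[R]_n).
Local Notation dX F := ('D_((0 : X), (1 : R)) F).
Local Notation idX i F := (iter i (fun G : X * R -> R => dX G) F).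
Local Notation LapX := (Lap (hor R (axis R n)) n).

Lemma derive1n_idt i (G : X * R -> R) y t : Csmooth G ->
  derive1n i (fun t => G (y, t)) t = idX i G (y, t).
Proof.
move=> sG; elim: i t => [//|i IH] t.
have E : derive1n i (fun t => G (y, t)) = fun t => idX i G (y, t) by apply/funext.
transitivity ('D_(1 : R) (derive1n i (fun t => G (y, t))) t); first exact (derive1E _ t).
transitivity ('D_(1 : R) (fun t => idX i G (y, t)) t).
  exact (congr1 (fun f => derive f t (1 : R)) E).
exact (esym (derive_inr y t (1 : R) (smooth_idt i sG))).
Qed.

Lemma iter_laplacianE j (H : X * R -> R) x t : Csmooth H ->
  iter j (@laplacian R n) (fun y => H (y, t)) x = iter j LapX H (x, t).
Proof.
move=> sH; transitivity (iter j (Lap (axis R n) n) (fun y => H (y, t)) x).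
  exact (congr1 (fun L => iter j L (fun y => H (y, t)) x) (laplacianE R n)).
exact (esym (iter_Lap_hor (axis R n) n j x t sH)).
Qed.

Lemma Pop_cauchy_op m b (U : X * R -> R) x t : Csmooth U ->
  Pop m b (fun y t => U (y, t)) x t = cauchy_op (axis R n) n m b U (x, t).
Proof.
move=> sU; apply: eq_bigr => k _; congr (_ * _).
have -> : (fun y => derive1n (2 * k) (fun t => U (y, t)) t) = fun y => idX (2 * k) U (y, t).
  by apply/funext => y; exact: derive1n_idt.
exact: iter_laplacianE (smooth_idt (2 * k) sU).
Qed.

End link.

Section solution.
Variables (R : realType) (m n nu : nat) (a : 'I_m -> R) (b : nat -> R).
Hypothesis hm : (1 < m)%N.
Hypothesis hn : n = (2 * nu + 3)%N.
Hypothesis ha : forall i j : 'I_m, i != j -> a i ^+ 2 != a j ^+ 2.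
Hypothesis hb : forall x : R, \sum_(0 <= k < m.+1) b (2 * k)%N * x ^+ (2 * k)
                      = \prod_(i < m) (x ^+ 2 - a i ^+ 2).
Local Notation X := ('rV[R]_n).
Local Notation kernel_integral g x t := (oint 0 t (fun tau =>
  (t - tau) ^+ (2 * m - 3) / (2 * m - 3)`!%:R * weighted_sum nu a g x tau)).

(** One function E serves the integrands f(., t0) for all t0 at once and depends smoothly
    on t0; this is what the Duhamel integral needs. *)
Lemma fundamental_solution (f : X * R -> R) : Csmooth f ->
  exists2 E : (X * R) * R -> R, is_fundamental (space_axes R n) n m b f E &
  forall x t0 t, kernel_integral (fun y => f (y, t0)) x t = E ((x, t0), t).
Proof.
move=> sf.
have fV : findim (X * R)%type by apply: findim_prod; [exact: findim_rV|exact: findim_real].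
have /choice[B HB] : forall j : 'I_m, exists B : (X * R) * R -> R, is_wave (space_axes R n) n (a j) f B /\
    forall x t0 t, bracket nu (a j) (fun y => f (y, t0)) x t = B ((x, t0), t).
  by move=> j; have [B wB EB] := bracket_wave hn (a j) sf; exists B.
have wB j : is_wave (space_axes R n) n (a j) f (B j) by have [] := HB j.
(* The B j are chosen once for all parameters t0. *)
exists (fundamental a B).
  split.
  - exact: smooth_fundamental wB.
  - by move=> p; exact (fundamental_eq fV hm ha hb sf wB p).
  - by move=> i v; exact: (fundamental_init fV hm wB).
  - by move=> v; exact: (fundamental_init_top fV hm ha wB).
move=> x t0 t; rewrite /fundamental (_ : (2 * m - 2)%N = (2 * m - 3).+1); last by move: hm; lia.
rewrite /= /duhamel /taylor_kernel /=; apply: oint_eq => tau; congr (_ * _).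
rewrite /weighted_sum /superposition; apply: eq_bigr => j _; congr (_ * _).
by have [_ ->] := HB j.
Qed.

End solution.

Theorem theorem3 (R : realType) (m n nu : nat) (a : 'I_m -> R) (b : nat -> R)
  (f : 'rV[R]_n -> R -> R) (phi : nat -> 'rV[R]_n -> R)
  (hm : (1 < m)%N)
  (hn : n = (2 * nu + 3)%N)
  (ha : forall i j : 'I_m, i != j -> a i ^+ 2 != a j ^+ 2)
  (hb : forall x : R, \sum_(0 <= k < m.+1) b (2 * k)%N * x ^+ (2 * k)
                      = \prod_(i < m) (x ^+ 2 - a i ^+ 2))
  (hf : Csmooth (fun z : 'rV[R]_n * R => f z.1 z.2))
  (hphi : forall r : nat, (r < 2 * m)%N -> Csmooth (phi r)) :
  solves_cauchy m b f phi (cauchy_formula nu a b f phi).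
Proof.
have fX : findim 'rV[R]_n by exact: findim_rV.
have fV : findim ('rV[R]_n * R)%type by apply: findim_prod; [|exact: findim_real].
have bm := polynomial_lead hb.
have [E hE EE] := fundamental_solution hm hn ha hb hf.
have [sE _ _ _] := hE.
have /choice[D HD] : forall r, exists D : 'rV[R]_n * R -> R, Csmooth D /\ ((r < 2 * m)%N ->
    is_fundamental (axis R n) n m b (phi r) D /\
    forall x t, oint 0 t (fun tau =>
      (t - tau) ^+ (2 * m - 3) / (2 * m - 3)`!%:R * weighted_sum nu a (phi r) x tau) = D (x, t)).
  move=> r; case: (ltnP r (2 * m)) => rm; last by exists (fun=> 0); split => //; exact: smooth_cst.
  have sphi : Csmooth (fun z : 'rV[R]_n * R => phi r z.1).
    by apply: (smooth_comp fX (hphi r rm)); apply: smooth_map_fst; exact: smooth_map_id.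
  have [F hF EF] := fundamental_solution hm hn ha hb sphi.
  have hD := is_fundamental_freeze fX hF.
  exists (freeze F); split; first by case: hD.
  by move=> _; split=> // x t; exact: (EF x 0 t).
have sD r : Csmooth (D r) by have [] := HD r.
have hD r : (r < 2 * m)%N -> is_fundamental (axis R n) n m b (phi r) (D r).
  by move=> rm; have [_ /(_ rm)[]] := HD r.
have ED r x t : (r < 2 * m)%N -> oint 0 t (fun tau =>
      (t - tau) ^+ (2 * m - 3) / (2 * m - 3)`!%:R * weighted_sum nu a (phi r) x tau) = D r (x, t).
  by move=> rm; have [_ /(_ rm)[]] := HD r.
pose u1 := duhamel E.
pose u2 := data_solution (axis R n) n m b D.
have su1 : Csmooth u1 by exact: smooth_duhamel.
have su2 : Csmooth u2 by exact: (smooth_data_solution hm hD).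
pose U p := u1 p + u2 p.
have sU : Csmooth U by exact: smoothD.
have uE : cauchy_formula nu a b f phi = fun x t => U (x, t).
  apply/funext => x; apply/funext => t; rewrite /cauchy_formula /U; congr (_ + _).
    by apply: oint_eq => tau; exact: (EE x tau (t - tau)).
  apply: eq_big_nat => k /andP[_ km]; congr (_ * _).
  have sS : Csmooth (fun p => \sum_(0 <= r < 2 * k)
      iter (2 * k - 1 - r) (fun G : 'rV[R]_n * R -> R => 'D_((0 : 'rV[R]_n), (1 : R)) G) (D r) p).
    by apply: smooth_sum => r _; exact: smooth_idt.
  rewrite -(iter_laplacianE (m - k) x t sS).
  congr (iter _ _ _ _); apply/funext => y; apply: eq_big_nat => r /andP[_ rk].
  rewrite -(derive1n_idt (2 * k - 1 - r) y t (sD r)).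
  congr (derive1n _ _ _); apply/funext => t'; apply: ED.
  by move: rk km; lia.
rewrite uE; split.
- rewrite (_ : (fun z => _) = U); first exact: sU.
  by apply/funext => -[x t].
- move=> x t; rewrite (Pop_cauchy_op m b x t sU) cauchy_opD// (duhamel_cauchy_op fX hm bm hE).
  by rewrite (cauchy_op_data hm hD) addr0.
- move=> r x rm.
  rewrite (derive1n_idt r x 0 sU).
  transitivity (iter r (fun G : 'rV[R]_n * R -> R => 'D_((0 : 'rV[R]_n), (1 : R)) G) u1 (x, 0) +
    iter r (fun G : 'rV[R]_n * R -> R => 'D_((0 : 'rV[R]_n), (1 : R)) G) u2 (x, 0)).
    exact (congr1 (fun G => G (x, 0)) (idtD r su1 su2)).
  rewrite (duhamel_init fX hm hE)// add0r; exact: (data_init hm bm hD).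
Qed.
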